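(* Let $q>2$ be a prime power, and let $F(t)=\sum_{n\geq 0}a_nt^n$, where $a_0=1$ and $a_n=|\mathcal{A}_n(q)|/|\mathrm{GL}_n(q)|$ for $n\geq 1$, with $\mathcal{A}_n(q)$ as defined in the context. Then $$F(t)=\left(\prod_{i=0}^\infty(1-q^{-(i+1)}t)^{-1}\right)\left(\prod_{m\geq 2,\;i,j\geq 0}(1-q^{-(i+j+2m-1)}t^m)^{-1}\right).$$ Moreover, $F(t)$ has a simple pole at $t=q$, and $(1-q^{-1}t)F(t)$ is analytic on a disk of radius $q^{3/2}$.
   Context: $\mathrm{GL}_n(q)$ is the group of invertible $n\times n$ matrices over the field $k$ with $q$ elements, acting on $V=k^n$. For a group $A$ acting $k$-linearly, an $A$-module is indecomposable if it is nonzero and is not the direct sum of two nonzero $A$-submodules. For $n\geq1$, $\mathcal{A}_n(q)$ is the set of abelian subgroups $A$ of $\mathrm{GL}_n(q)$ such that the $A$-module $V$ has a decomposition $V=V_1\oplus\cdots\oplus V_r$ into indecomposable $A$-modules satisfying: (i) $A=A_1\times\cdots\times A_r$, where $A_i\subseteq\mathrm{GL}(V_i)$ (with $A_i$ acting trivially on $V_j$ for $j\neq i$); (ii) for each $i=1,\ldots,r$, $A_i=C_{\mathrm{GL}(V_i)}(a_i)$ for some $a_i\in\mathrm{GL}(V_i)$ such that $V_i$ is an indecomposable $\langle a_i\rangle$-module. The identity for $F(t)$ is one of power series at $t=0$ (equivalently, of analytic functions of a complex variable $t$ near $0$). Disks are open and centred at $0$ in the complex plane; statements about poles and about analyticity beyond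 the disk of convergence refer to analytic continuation. *)

(* Defs.v *)
From HB Require Import structures.
From mathcomp Require Import all_boot all_order all_algebra all_fingroup.
From mathcomp Require Import all_solvable all_field all_character.
From mathcomp Require Import finmap.
From mathcomp Require Import complex.
From mathcomp Require Import boolp classical_sets functions reals ereal.
From mathcomp Require Import topology normedtype sequences exp.

Set Implicit Arguments.
Unset Strict Implicit.
Unset Printing Implicit Defensive.

Import Order.TTheory GRing.Theory Num.Theory.
Import numFieldNormedType.Exports.

Local Open Scope ring_scope.

(* Subspaces are row spaces of square matrices, as in mxalgebra and
   mxrepresentation; groups of matrices act on row vectors on the right. *)

Definition mxindecomposable (k : fieldType) (gT : finGroupType)
    (G : {group gT}) (n : nat) (rG : mx_representation k G n)
    (U : 'M[k]_n) : Prop :=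
  [/\ mxmodule rG U, U != 0 &
      forall W1 W2 : 'M[k]_n,
        mxmodule rG W1 -> mxmodule rG W2 ->
        (W1 + W2 :=: U)%MS -> mxdirect (W1 + W2)%MS ->
        W1 = 0 \/ W2 = 0].

Section AbelianSubgroups.

Variables (k : finFieldType) (n : nat).

(* The dimension is n.+1, so that 'GL_n.+1[k] acts on 'rV[k]_n.+1. *)
Local Notation gT := {'GL_n.+1[k]}.

Definition natural_repr (A : {group gT}) : mx_representation k A n.+1 :=
  subg_repr (GLrepr k n) (finset.subsetT A).

(* For a decomposition of the space as the direct sum of the V j, the group
   GL(V i), embedded in the general linear group by letting it act trivially
   on V j for j != i. *)
Definition GLsummand (r : nat) (V : 'I_r -> 'M[k]_n.+1) (i : 'I_r) :
    {group gT} :=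
  [group of rstabs (GLrepr k n) (V i)
     :&: \bigcap_(j < r | j != i) rstab (GLrepr k n) (V j)].

Definition in_calA (A : {group gT}) : Prop :=
  abelian A /\
  exists (r : nat) (V : 'I_r -> 'M[k]_n.+1),
    [/\ (\sum_(i < r) V i :=: 1%:M)%MS,
        mxdirect (\sum_(i < r) V i)%MS,
        forall i, mxindecomposable (natural_repr A) (V i) &
        exists B : 'I_r -> {group gT},
          [/\ forall i, B i \subset GLsummand V i,
              \big[dprod/1%g]_(i < r) B i = A &
              forall i, exists a : gT,
                [/\ a \in GLsummand V i,
                    mxindecomposable (natural_repr <[a]>) (V i) &
                    B i = 'C_(GLsummand V i)[a]%g :> {set gT}]]].

Definition calA : {set {group gT}} := [set A | `[< in_calA A >]].

End AbelianSubgroups.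

Definition coefA (k : finFieldType) (K : numFieldType) (n : nat) : K :=
  if n is m.+1 then #|calA k m|%:R / #|'GL_m.+1[k]%g|%:R else 1.

Local Open Scope classical_set_scope.

Definition has_psum (K : numFieldType) (c : nat -> K) (t l : K) : Prop :=
  series (fun n => c n * t ^+ n) @ \oo --> l.

Definition has_prod_seq (K : numFieldType) (f : nat -> K) (l : K) : Prop :=
  (fun N : nat => \prod_(0 <= i < N) f i) @ \oo --> l.

(* Limit along the directed set of finite sets of indices. *)
Definition has_prod (K : numFieldType) (I : choiceType) (P : pred I)
    (f : I -> K) (l : K) : Prop :=
  forall e : K, 0 < e ->
    exists J0 : {fset I}, forall J : {fset I}, (J0 `<=` J)%fset ->
      `|\prod_(i <- J | P i) f i - l| < e.

Definition analytic_at (K : numFieldType) (f : K -> K) (z : K) : Prop :=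
  exists c : nat -> K, \forall w \near z, has_psum c (w - z) (f w).

Definition analytic_on (K : numFieldType) (D : set K) (f : K -> K) : Prop :=
  forall z, D z -> analytic_at f z.

(* The value of f at z itself is irrelevant. *)
Definition simple_pole (K : numFieldType) (f : K -> K) (z : K) : Prop :=
  exists g : K -> K,
    [/\ analytic_at g z, g z != 0 & \forall w \near z^', f w = g w / (w - z)].

(* The complex numbers as a numFieldType, hence with the topology given by the
   modulus. *)
Definition Cplx (R : realType) : numFieldType := R[i].

(* Main.v *)
Require Import Defs.
From HB Require Import structures.
From mathcomp Require Import all_boot all_order all_algebra all_fingroup.
From mathcomp Require Import all_solvable all_field all_character.
From mathcomp Require Import finmap.
From mathcomp Require Import complex.
From mathcomp Require Import boolp classical_sets functions reals ereal.
From mathcomp Require Import topology normedtype sequences exp.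
From mathcomp Require Import ring lra zify.

Set Implicit Arguments.
Unset Strict Implicit.
Unset Printing Implicit Defensive.

Import Order.TTheory GRing.Theory Num.Theory.
Import numFieldNormedType.Exports.

(** Write a_n = |A_n(q)| / |GL_n(q)|. The identity for F comes from a recursion for a_n,
    and its analytic consequences from the positivity of all the coefficients.

    A group of the family is the commutant, in the general linear group, of a family of
    blocks: a complete system of orthogonal idempotents e, one for each indecomposable
    summand, each with a matrix that acts indecomposably on the row space of e
    (card_calA). Since q > 2 there is a scalar lam different from 0 and 1, and the
    idempotents are determined by the group: they are the minimal nonzero idempotents e
    for which 1 + (lam - 1) e belongs to it (comps_torus). Counting the pairs formed by a
    group and one of its idempotents, weighted by the rank N of the idempotent, gives
      n a_n = sum over N of N c_N a_(n-N)      (calAm_recursion),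
    where c_N |GL_N(q)| is the number of centralisers in GL_N(q) of elements that act
    indecomposably.

    An element b acts indecomposably exactly when its minimal polynomial is f^m with f
    irreducible of degree d and N = d m; its commutant is then k[b], with
    q^N - q^(N-d) units. A polynomial h of degree d, irreducible and different from X,
    is fixed for each d. Every centraliser with parameters (d, m) contains the same
    number d * kappa d m of elements with minimal polynomial h^m: there are d roots of h
    modulo f, and for m > 1 their lifts modulo f^m are counted when they are not roots
    of h modulo f^2 (card_minpoly_algebra). As the elements with minimal polynomial h^m
    form one conjugacy class, this gives (card_Icyc)
      c_N = sum over d m = N of 1 / ((q^N - q^(N-d)) * d * kappa d m).
    The term with parameters (d, m) of N c_N is what the factors 1 / (1 - w t^m) of the
    infinite product contribute to N times the coefficient of t^N in its logarithm
    (logcoef_Icyc). Hence the a_n are the coefficients of the product (coefA_expo).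

    For the convergence, the coefficients of finite products increase to those of the
    infinite product. At a nonnegative real point, monotone convergence identifies the sum
    of the series with the limit of the products (box_real); at a complex point the errors
    are dominated by those at its modulus (box_complex). This applies to the full product
    for |t| < 1. Once the factor 1 - t / q is removed, the weights are small enough for all
    |t| < q^(3/2) (wt_bound_big), and the remaining product G is analytic there
    (analytic_psum). So F = G / (1 - t / q) is analytic in this disk outside q (analytic_div), and the
    pole at q is simple because G(q) >= 1. *)

Local Open Scope ring_scope.

(** * Matrices that act indecomposably *)

Section CyclicMatrices.

Variable F : fieldType.

(** The row space F^n is an indecomposable <b>-module: the only idempotents in the
    commutant of b are 0 and 1. For n = 0 the condition holds trivially, so
    positivity of the dimension has to be required separately. *)
Definition idem_indecomposable n (b : 'M[F]_n) : Prop :=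
  forall p : 'M_n, p *m p = p -> p *m b = b *m p -> p = 0 \/ p = 1%:M.

(** The D x (n+1) matrix with rows v, v b, ..., v b^(D-1). *)
Definition krylov n D (v : 'rV[F]_n.+1) (b : 'M_n.+1) : 'M_(D, n.+1) :=
  \matrix_(i < D) (v *m b ^+ i).

Lemma horner_mxE n (b : 'M[F]_n.+1) D (x : 'rV_D) :
  horner_mx b (rVpoly x) = \sum_(i < D) x 0 i *: b ^+ i.
Proof.
rewrite /rVpoly poly_def rmorph_sum /=; apply: eq_bigr => i _.
by rewrite valK linearZ /= rmorphXn /= horner_mx_X.
Qed.

Lemma mul_krylov n D (v : 'rV[F]_n.+1) (b : 'M_n.+1) (x : 'rV_D) :
  x *m krylov D v b = v *m horner_mx b (rVpoly x).
Proof.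
rewrite mulmx_sum_row horner_mxE mulmx_sumr; apply: eq_bigr => i _.
by rewrite rowK -scalemxAr.
Qed.

Lemma irreducible_power_factor (p : {poly F}) :
    p \is monic -> (1 < size p)%N ->
  exists f m u, [/\ irreducible_poly f, f \is monic, (0 < m)%N,
    p = f ^+ m * u & coprimep f u].
Proof.
move=> p_mon p_gt1.
have p0 : p != 0 by rewrite monic_neq0.
have exf : exists s, `[< exists f, [/\ f \is monic, f %| p, (1 < size f)%N & size f = s] >].
  by exists (size p); apply/asboolP; exists p; rewrite dvdpp.
have [s /asboolP [f [f_mon f_p f_gt1 <-]] f_min] := ex_minnP exf.
have f0 : f != 0 by rewrite monic_neq0.
have f_irr : irreducible_poly f.
  split=> // g g_ne1 g_f.
  have g0 : g != 0 by apply: contraTneq g_f => ->; rewrite dvd0p.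
  have g_gt1 : (1 < size g)%N by rewrite ltn_neqAle eq_sym g_ne1 size_poly_gt0.
  have lc0 : (lead_coef g)^-1 != 0 by rewrite invr_eq0 lead_coef_eq0.
  rewrite -dvdp_size_eqp // eqn_leq dvdp_leq //=.
  have -> : size g = size ((lead_coef g)^-1 *: g) by rewrite size_scale.
  apply: f_min; apply/asboolP; exists ((lead_coef g)^-1 *: g).
  split=> //; last by rewrite size_scale.
    by rewrite monicE lead_coefZ mulVf // lead_coef_eq0.
  by rewrite dvdpZl // (dvdp_trans g_f).
have exm : exists m, f ^+ m %| p by exists 0%N; rewrite expr0 dvd1p.
have bm m : f ^+ m %| p -> (m <= size p)%N.
  move=> /dvdp_leq -/(_ p0) le_mp.
  have le2 : ((size f).-1 * m <= size p)%N.
    by rewrite -size_exp (leq_trans (leq_pred _)).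
  by apply: leq_trans le2; rewrite leq_pmull // -ltnS prednK // ltnW.
have [m fm_p m_max] := ex_maxnP exm bm.
have p_eq : p = f ^+ m * (p %/ f ^+ m) by rewrite mulrC divpK.
exists f, m, (p %/ f ^+ m); split => //.
  by apply: m_max; rewrite expr1.
rewrite irreducible_poly_coprime //; apply/negP => f_u.
(* The exponent m is maximal. *)
suff: (m.+1 <= m)%N by rewrite ltnn.
by apply: m_max; rewrite p_eq exprSr dvdp_mul.
Qed.

Lemma coprime_power_dvd (f g : {poly F}) m : irreducible_poly f ->
  ~~ (f ^+ m %| g) -> (0 < m)%N ->
  exists r s, r * g + s * f ^+ m = f ^+ m.-1.
Proof.
move=> f_irr nfg m0.
have f0 := irredp_neq0 f_irr.
have g0 : g != 0 by apply: contraNneq nfg => ->; rewrite dvdp0.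
have exs : exists s, f ^+ s %| g by exists 0%N; rewrite expr0 dvd1p.
have bs s : f ^+ s %| g -> (s <= m)%N.
  move=> fs; rewrite leqNgt; apply: contra nfg => ms.
  by apply: dvdp_trans fs; rewrite dvdp_exp2l // ltnW.
have [s fs_g s_max] := ex_maxnP exs bs.
have s_m : (s < m)%N.
  rewrite ltn_neqAle bs // andbT; apply: contraNneq nfg => <- //.
set h := g %/ f ^+ s.
have g_eq : g = f ^+ s * h by rewrite mulrC divpK.
have cop : coprimep h (f ^+ m).
  rewrite coprimep_sym coprimep_expl // irreducible_poly_coprime //.
  apply/negP => f_h; suff: (s.+1 <= s)%N by rewrite ltnn.
  by apply: s_max; rewrite g_eq exprSr dvdp_mul.
have /Bezout_eq1_coprimepP [[u v] /= uv] := cop.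
exists (u * f ^+ (m.-1 - s)), (v * f ^+ m.-1).
have sm1 : (s <= m.-1)%N by rewrite -ltnS prednK.
have -> : u * f ^+ (m.-1 - s) * g = u * h * f ^+ m.-1.
  by rewrite g_eq -[in RHS](subnK sm1) exprD; ring.
have -> : v * f ^+ m.-1 * f ^+ m = v * f ^+ m * f ^+ m.-1 by ring.
by rewrite -mulrDl uv mul1r.
Qed.

(** If p annihilates b and has degree D, then b acts on the Krylov rows through
    the companion matrix of p, which depends on p only. *)
Lemma krylov_stable n (v : 'rV[F]_n.+1) (b : 'M_n.+1) D (p : {poly F}) :
  horner_mx b p = 0 -> p != 0 -> D = (size p).-1 ->
  krylov D v b *m b = (\matrix_(i < D) poly_rV (('X^(i.+1) : {poly F}) %% p)) *m krylov D v b.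
Proof.
move=> pb p0 ->; apply/row_matrixP => i.
rewrite !row_mul !rowK mul_krylov poly_rV_K; last first.
  by rewrite -ltnS prednK ?ltn_modp // size_poly_gt0.
have := divp_eq ('X^(i.+1) : {poly F}) p => /(congr1 (horner_mx b)).
rewrite rmorphD rmorphM /= pb mulr0 add0r => <-.
by rewrite rmorphXn /= horner_mx_X exprSr mulmxA.
Qed.

Lemma mxvec_neq0_functional n (M : 'M[F]_n) :
  M != 0 -> exists v : 'rV_n, exists phi : 'cV_n, v *m M *m phi != 0.
Proof.
move=> M0.
have [/existsP [i /existsP [j Mij]]|] := boolP [exists i, exists j, M i j != 0].
  exists (delta_mx 0 i), (delta_mx j 0).
  apply: contraNneq Mij => /(congr1 (fun A : 'M__ => A 0 0)).
  by rewrite -rowE -colE !mxE => ->.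
rewrite negb_exists => /forallP all0.
case/eqP: M0; apply/matrixP => i j; rewrite mxE.
by have := all0 i; rewrite negb_exists => /forallP /(_ j); rewrite negbK => /eqP.
Qed.

(** The matrix b has a cyclic vector. *)
Definition kcyclic n (b : 'M[F]_n.+1) : Prop :=
  exists v : 'rV_n.+1, krylov n.+1 v b \in unitmx.

(** When the minimal polynomial is f^m of degree D, there are a vector v and a
    functional phi with v f(b)^(m-1) phi nonzero. Let U be the Krylov matrix of v
    and K its dual, with columns b^i phi. Then U K is an invertible Hankel matrix,
    and K (U K)^-1 U is an idempotent of rank D that commutes with b. *)
Lemma krylov_idempotent n (b : 'M[F]_n.+1) (f : {poly F}) m D :
    irreducible_poly f -> (0 < m)%N -> mxminpoly b = f ^+ m ->
    D.+1 = size (mxminpoly b) ->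
  exists (v : 'rV_n.+1) (K : 'M_(n.+1, D)),
    [/\ krylov D v b *m K \in unitmx &
     let p := K *m invmx (krylov D v b *m K) *m krylov D v b in
     p *m b = b *m p].
Proof.
move=> f_irr m0 bf D_eq.
have P0 : f ^+ m != 0 by rewrite -bf monic_neq0 // mxminpoly_monic.
have f0 := irredp_neq0 f_irr.
have Db : D = (size (f ^+ m)).-1 by rewrite -bf -D_eq.
have fmb : horner_mx b (f ^+ m) = 0 by rewrite -bf mx_root_minpoly.
have nz : horner_mx b (f ^+ m.-1) != 0.
  rewrite -dvd_mxminpoly bf; apply/negP => /dvdp_leq; rewrite expf_neq0 // => /(_ isT).
  rewrite -[in X in (X <= _)%N](prednK m0) exprS size_mul ?expf_neq0 //.
  have [sf _] := f_irr; move: sf; case: (size f) => [|[|s]] // _.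
  by lia.
have [v [phi vphi]] := mxvec_neq0_functional nz.
pose U := krylov D v b.
pose K := (krylov D phi^T b^T)^T.
have mulK (y : 'rV_D) : K *m y^T = horner_mx b (rVpoly y) *m phi.
  rewrite -[LHS]trmxK trmx_mul /K !trmxK mul_krylov trmx_mul trmxK.
  congr (_ *m _); rewrite !horner_mxE linear_sum /=; apply: eq_bigr => i _.
  rewrite linearZ /=; congr (_ *: _).
  elim: (i : nat) => [|k IH]; first by rewrite !expr0 trmx1.
  by rewrite exprS exprSr trmx_mul IH trmxK.
have Hu : U *m K \in unitmx.
  rewrite -row_free_unit -kermx_eq0; apply/eqP/row_matrixP => i; rewrite row0.
  set x := row i _.
  have xUK : x *m (U *m K) = 0 by apply/sub_kermxP; apply: row_sub.
  apply/eqP; apply: contraT => x0.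
  pose g := rVpoly x.
  have g0 : g != 0 by apply: contra x0 => /eqP gx; rewrite -(rVpolyK x) -/g gx linear0.
  have nfg : ~~ (f ^+ m %| g).
    apply/negP => /dvdp_leq -/(_ g0); rewrite leqNgt => /negP; apply.
    by rewrite -bf -D_eq ltnS size_poly.
  (* A row x killed by U K yields a polynomial g with v g(b) b^i phi = 0 for i < D;
     as f^(m-1) is in the ideal (g, f^m), this contradicts the choice of v and phi. *)
  have [r [s rs]] := coprime_power_dvd f_irr nfg m0.
  case/negP: vphi.
  rewrite -rs rmorphD !rmorphM /= fmb mulr0 addr0.
  have szr : (size (r %% f ^+ m)%R <= D)%N.
    by rewrite -ltnS D_eq bf ltn_modp.
  have -> : horner_mx b r = horner_mx b (r %% f ^+ m).
    by rewrite {1}(divp_eq r (f ^+ m)) rmorphD rmorphM /= fmb mulr0 add0r.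
  rewrite -(poly_rV_K szr).
  rewrite -[_ * _]/(_ *m _) [_ *m horner_mx b g]comm_horner_mx2 -[_ * _]/(_ *m _).
  rewrite mulmxA -(mulmxA _ _ phi) -mulK -mul_krylov.
  by rewrite -(mulmxA x) (mulmxA U) mulmxA xUK mul0mx.
exists v, K; split=> //; rewrite -/U.
set H := U *m K.
have UbC := krylov_stable v fmb P0 Db.
move: UbC; set C := \matrix_(_ < _) _; rewrite -/U => UbC.
have [C' bK] : exists C', b *m K = K *m C'.
  have fmbT : horner_mx b^T (f ^+ m) = 0.
    move: (f ^+ m) fmb => g gb.
    apply: (can_inj trmxK); rewrite trmx0 -gb.
    have -> : g = rVpoly (poly_rV g : 'rV_(size g)) by rewrite poly_rV_K.
    rewrite !horner_mxE linear_sum /=; apply: eq_bigr => i _.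
    rewrite linearZ /=; congr (_ *: _).
    elim: (i : nat) => [|k IH]; first by rewrite !expr0 trmx1.
    by rewrite exprS exprSr trmx_mul IH trmxK.
  have := krylov_stable phi^T fmbT P0 Db.
  set C1 := \matrix_(_ < _) _ => /(congr1 trmx); rewrite !trmx_mul trmxK => E.
  by exists C1^T.
have HC : H *m C' = C *m H by rewrite /H -mulmxA -bK mulmxA UbC mulmxA.
rewrite /= -!mulmxA UbC !mulmxA bK; congr (_ *m _).
rewrite -!mulmxA; congr (_ *m _).
by rewrite -[RHS](mulKmx Hu) -/H (mulmxA H C') HC -(mulmxA C) mulmxV // mulmx1.
Qed.

Lemma kcyclic_minpoly n (b : 'M[F]_n.+1) (f : {poly F}) m :
    irreducible_poly f -> (0 < m)%N -> mxminpoly b = f ^+ m ->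
    size (mxminpoly b) = n.+2 ->
  kcyclic b.
Proof.
move=> f_irr m0 bf sz.
have [v [K [H _]]] := krylov_idempotent f_irr m0 bf (esym sz).
exists v; move: H; rewrite !unitmxE det_mulmx.
by rewrite unitrM => /andP[].
Qed.

Lemma size_mxminpoly_le n (b : 'M[F]_n.+1) : (size (mxminpoly b) <= n.+2)%N.
Proof.
have /dvdp_leq := mxminpoly_dvd_char b; rewrite size_char_poly; apply.
by rewrite monic_neq0 // char_poly_monic.
Qed.

(** An indecomposable matrix has a power of an irreducible polynomial as minimal
    polynomial, by the Bezout idempotents, and that polynomial has degree n+1,
    by the Hankel idempotent of krylov_idempotent. *)
Lemma idem_indecomposable_minpoly n (b : 'M[F]_n.+1) :
    idem_indecomposable b ->
  exists f m, [/\ irreducible_poly f, f \is monic, (0 < m)%N,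
    mxminpoly b = f ^+ m & size (mxminpoly b) = n.+2].
Proof.
move=> b_ind.
have P_mon := mxminpoly_monic b.
have P_gt1 : (1 < size (mxminpoly b))%N by rewrite size_mxminpoly ltnS mxminpoly_nonconstant.
have [f [m [u [f_irr f_mon m0 P_eq cop]]]] := irreducible_power_factor P_mon P_gt1.
have f0 := irredp_neq0 f_irr.
have copm : coprimep (f ^+ m) u by rewrite coprimep_expl.
have /Bezout_eq1_coprimepP [[s t] /= st] := copm.
have bP : mxminpoly b = f ^+ m.
  (* The idempotent given by the coprime factorisation f^m u of the minimal polynomial. *)
  pose p := horner_mx b (s * f ^+ m).
  have tt : t * u = 1 - s * f ^+ m by rewrite -st addrC addKr.
  have pp : p *m p = p.
    apply/eqP; rewrite -subr_eq0 -[p *m p]/(p * p) -rmorphM -rmorphB /=.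
    rewrite -dvd_mxminpoly P_eq.
    have -> : s * f ^+ m * (s * f ^+ m) - s * f ^+ m = (f ^+ m * u) * (- (s * t)).
      by transitivity (- (s * f ^+ m * (1 - s * f ^+ m))); [ring | rewrite -tt; ring].
    by rewrite dvdp_mulr.
  have [||] := b_ind p pp.
  - by apply: comm_horner_mx; rewrite /comm_mx.
  - move/eqP; rewrite -dvd_mxminpoly P_eq mulrC dvdp_mul2r ?expf_neq0 // => u_s.
    have : u %| 1 by rewrite -st; apply: dvdp_add; [exact: dvdp_mulr | exact: dvdp_mulIr].
    have u_mon : u \is monic by move: P_mon; rewrite P_eq monicMl // monic_exp.
    rewrite dvdp1 => /size_poly1P [c c0 uc].
    move: u_mon; rewrite uc monicE lead_coefC => /eqP ->.
    by rewrite mul1r.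
  - move/eqP; rewrite -subr_eq0 -(horner_mx_C b 1) -rmorphB polyC1 -dvd_mxminpoly.
    rewrite -opprB -tt dvdpNr P_eq => /(dvdp_trans (dvdp_mulr _ (dvdpp _))) f_tu.
    have : f ^+ m %| 1 by rewrite -st dvdp_add // dvdp_mull.
    have f_fm : f %| f ^+ m by rewrite -{1}(expr1 f) dvdp_exp2l.
    move=> /(dvdp_trans f_fm); rewrite dvdp1.
    by have [] := f_irr; case: (size f) => [|[]].
exists f, m; split=> //.
have [v [K [Hu]]] := krylov_idempotent f_irr m0 bP (esym (size_mxminpoly b)).
set U := krylov _ v b in Hu *; set p := _ *m U; move=> pb.
have pp : p *m p = p.
  rewrite /p -!mulmxA (mulmxA U) mulKmx //.
have D0 := mxminpoly_nonconstant b.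
have [p0|p1] := b_ind p pp pb.
  have : U *m p *m K = U *m K.
    by rewrite /p !mulmxA mulmxV // mul1mx.
  rewrite p0 mulmx0 mul0mx => UK0; move: Hu; rewrite -UK0 unitmxE.
  by case: (degree_mxminpoly b) D0 => // D _; rewrite det0 unitr0.
apply/eqP; rewrite eqn_leq size_mxminpoly_le /= size_mxminpoly ltnS.
rewrite -(mxrank1 F n.+1) -p1 /p.
by rewrite (leq_trans (mxrankM_maxr _ _)) // rank_leq_row.
Qed.

(** The commutant of a matrix with a cyclic vector consists of its polynomials. *)
Lemma kcyclic_comm n (b x : 'M[F]_n.+1) : kcyclic b -> x *m b = b *m x ->
  exists g : {poly F}, x = horner_mx b g.
Proof.
move=> [v Uu] xb; set U := krylov _ v b in Uu.
pose c := v *m x *m invmx U.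
exists (rVpoly c).
have vx : v *m x = v *m horner_mx b (rVpoly c) by rewrite -mul_krylov mulmxKV.
apply: (can_inj (mulKmx Uu)); apply/row_matrixP => i.
rewrite !row_mul rowK -!mulmxA.
have bx y : y *m b = b *m y -> b ^+ i *m y = y *m b ^+ i.
  by move=> yb; symmetry; apply: (commrX i (x := y) (y := b) yb).
rewrite bx // bx ?mulmxA ?vx //; exact: comm_horner_mx.
Qed.

Lemma minpoly_idem_indecomposable n (b : 'M[F]_n.+1) f m :
    irreducible_poly f -> (0 < m)%N -> mxminpoly b = f ^+ m ->
    size (mxminpoly b) = n.+2 ->
  idem_indecomposable b.
Proof.
move=> f_irr m0 bf sz p pp pb.
have [g pg] := kcyclic_comm (kcyclic_minpoly f_irr m0 bf sz) pb.
have : f ^+ m %| g * (g - 1).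
  rewrite -bf dvd_mxminpoly mulrBr mulr1 rmorphB rmorphM /= -pg.
  by rewrite -[p * p]/(p *m p) pp subrr.
have [fg|nfg] := boolP (f %| g).
  have cop : coprimep (f ^+ m) (g - 1).
    rewrite coprimep_expl // irreducible_poly_coprime //; apply/negP => fg1.
    have : f %| 1 by rewrite -[1](subKr g) dvdp_sub.
    by rewrite dvdp1; have [] := f_irr; case: (size f) => [|[]].
  rewrite Gauss_dvdpl // -bf dvd_mxminpoly => /eqP.
  by rewrite -pg; left.
have cop : coprimep (f ^+ m) g by rewrite coprimep_expl // irreducible_poly_coprime.
rewrite Gauss_dvdpr // -bf dvd_mxminpoly rmorphB rmorph1 /= -pg subr_eq0 => /eqP.
by right.
Qed.

(** Two matrices with the same minimal polynomial f^m of full degree are both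
    conjugate to its companion matrix. *)
Lemma minpoly_conj n (b b' : 'M[F]_n.+1) f m :
    irreducible_poly f -> (0 < m)%N -> mxminpoly b = f ^+ m ->
    mxminpoly b' = f ^+ m -> size (f ^+ m) = n.+2 ->
  exists2 P, P \in unitmx & b' = invmx P *m b *m P.
Proof.
move=> f_irr m0 bf b'f sz.
have [v U] := kcyclic_minpoly f_irr m0 bf (etrans (congr1 (fun p : {poly F} => size p) bf) sz).
have [v' U'] := kcyclic_minpoly f_irr m0 b'f (etrans (congr1 (fun p : {poly F} => size p) b'f) sz).
have P0 : f ^+ m != 0 by rewrite -size_poly_eq0 sz.
have S : n.+1 = (size (f ^+ m)).-1 by rewrite sz.
have fb : horner_mx b (f ^+ m) = 0 by rewrite -bf mx_root_minpoly.
have fb' : horner_mx b' (f ^+ m) = 0 by rewrite -b'f mx_root_minpoly.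
have E := krylov_stable v fb P0 S.
have E' := krylov_stable v' fb' P0 S.
exists (invmx (krylov n.+1 v b) *m krylov n.+1 v' b').
  by rewrite unitmx_mul unitmx_inv U.
move: E E'; set C := \matrix_(_ < _) _; set u := krylov _ _ _ in U *.
set u' := krylov _ _ _ in U' * => E E'.
have bE : b = invmx u *m C *m u by rewrite -mulmxA -E mulKmx.
have -> : b' = invmx u' *m C *m u' by rewrite -mulmxA -E' mulKmx.
apply: (can_inj (mulKmx (_ : invmx u *m u' \in unitmx))).
  by rewrite unitmx_mul unitmx_inv U.
rewrite -!(mulmxA (invmx (invmx u *m u'))) mulKVmx ?unitmx_mul ?unitmx_inv ?U //.
by rewrite {1}bE !mulmxA !mulmxK // mulmxKV // -!mulmxA.
Qed.

(** Multiplication by X modulo p has minimal polynomial p. *)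
Lemma exists_minpoly n (p : {poly F}) : p \is monic -> size p = n.+2 ->
  exists b : 'M[F]_n.+1, mxminpoly b = p.
Proof.
move=> p_mon sz.
have p0 := monic_neq0 p_mon.
pose h (u : 'rV[F]_n.+1) : 'rV[F]_n.+1 := poly_rV (rVpoly u * 'X %% p).
have h_lin : linear h.
  by move=> a u v; rewrite /h !linearP /= mulrDl -scalerAl modpD modpZl linearP.
pose hL := GRing.isLinear.Build _ _ _ _ h h_lin.
pose hl : {linear 'rV[F]_n.+1 -> 'rV[F]_n.+1} := HB.pack h hL.
pose b := lin1_mx hl.
have szm (g : {poly F}) : (size (g %% p)%R <= n.+1)%N by rewrite -ltnS -sz ltn_modp.
have bE (g q : {poly F}) : poly_rV (q %% p) *m horner_mx b g = poly_rV (q * g %% p).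
  elim/poly_ind: g q => [|g c IH] q.
    by rewrite rmorph0 mulmx0 mulr0 mod0p linear0.
  rewrite rmorphD rmorphM /= horner_mx_X horner_mx_C mulmxDr.
  rewrite mulmxA IH mul_rV_lin1 /= /h poly_rV_K // mulrDr modpD linearD /=.
  rewrite [_ %% p * 'X]mulrC modp_mul [q * (g * 'X)]mulrA [_ * 'X]mulrC.
  by rewrite mul_mx_scalar -linearZ /= -modpZl [q * c%:P]mulrC mul_polyC.
exists b.
have sz1 : (1 : {poly F}) %% p = 1 by rewrite modp_small // size_poly1 sz.
apply/eqP; rewrite -eqp_monic ?mxminpoly_monic //; apply/andP; split.
  rewrite dvd_mxminpoly; apply/eqP/row_matrixP => i.
  rewrite row0 rowE -(rVpolyK (delta_mx 0 i)).
  set q := rVpoly _.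
  have -> : q = q %% p by rewrite modp_small // sz ltnS size_poly.
  by rewrite bE modp_mull linear0.
have := bE (mxminpoly b) 1; rewrite mx_root_minpoly mulmx0 mul1r => /esym E.
by apply/modp_eq0P; rewrite -(poly_rV_K (szm (mxminpoly b))) E linear0.
Qed.

End CyclicMatrices.

(** * Polynomials over a finite field *)

Section FiniteFieldPolynomials.

Variable k : finFieldType.
Local Notation q := #|k|.

Lemma card_natr_eq0 : q%:R = 0 :> k.
Proof.
have [r r_pr rk] := finPcharP k.
rewrite (card_pprimeChar rk); case: (logn _ _) (card_pprimeChar rk) => [|n _].
  by move=> E; have := finNzRing_gt1 k; rewrite E.
by rewrite expnS natrM (pcharf0 rk) mul0r.
Qed.

Lemma separable_Xq_subX (d : nat) : (0 < d)%N ->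
  separable_poly ('X^(q ^ d) - 'X : {poly k}).
Proof.
case: d => // d _; rewrite unlock derivB derivXn derivX.
have -> : 'X^((q ^ d.+1).-1) *+ (q ^ d.+1) = 0 :> {poly k}.
  rewrite expnS mulrnA -[_ *+ #|k|]mulr_natr -polyC_natr.
  by rewrite card_natr_eq0 polyC0 mulr0 mul0rn.
by rewrite sub0r -[- 1]scaleN1r coprimepZr ?coprimep1 // oppr_eq0 oner_eq0.
Qed.

(** The splitting field of X^(q^d) - X has degree d: the d-th power of the
    Frobenius generator of its Galois group is trivial, and there are q^d roots. *)
Lemma splitting_field_degree (d : nat) : (0 < d)%N ->
  exists L : splittingFieldType k, \dim {:L} = d.
Proof.
move=> d0.
have q1 : (1 < q)%N := finNzRing_gt1 k.
have qd1 : (1 < q ^ d)%N by rewrite -(exp1n d) ltn_exp2r.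
pose p : {poly k} := 'X^(q ^ d) - 'X.
have szp : size p = (q ^ d).+1.
  by rewrite size_polyDl size_polyXn // size_polyN size_polyX.
have p0 : p != 0 by rewrite -size_poly_eq0 szp.
have [L [rs prs rsL]] := FinSplittingFieldFor p0.
exists L.
have pE : map_poly (in_alg L) p = 'X^(q ^ d) - 'X.
  by rewrite rmorphB /= map_polyXn map_polyX.
rewrite pE in prs.
have sep : separable_poly ('X^(q ^ d) - 'X : {poly L}).
  by rewrite -pE separable_map; apply: separable_Xq_subX.
have rs_uniq : uniq rs by rewrite -separable_prod_XsubC -(eqp_separable prs).
have sz_rs : size rs = (q ^ d)%N.
  have := eqp_size prs; rewrite size_prod_XsubC size_polyDl size_polyXn.
    by case.
  by rewrite size_polyN size_polyX.
have rs_fix x : x \in rs -> x ^+ (q ^ d) = x.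
  rewrite -root_prod_XsubC -(eqp_root prs) rootE !hornerE subr_eq0.
  by move/eqP.
have [alpha gen alphaE] := finField_galois_generator (sub1v {:L}).
have aE x : alpha x = x ^+ q by rewrite alphaE ?memvf // dimv1 expn1.
have aX i x : (alpha ^+ i)%g x = x ^+ (q ^ i).
  elim: i x => [|i IH] x; first by rewrite expg0 gal_id expr1.
  by rewrite expgSr galM ?memvf // IH aE -exprM -expnSr.
have full : ({:L} <= fixedField [set alpha ^+ d]%g)%VS.
  rewrite -rsL; apply/Fadjoin_seqP; split; first exact: sub1v.
  move=> x xrs; apply/fixedFieldP; rewrite ?memvf // => y /set1P ->.
  by rewrite aX rs_fix.
have ad1 : (alpha ^+ d = 1)%g.
  apply/eqP/gal_eqP => x _; rewrite gal_id.
  by have /fixedFieldP -> := subvP full x (memvf x); rewrite ?memvf ?set11.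
have ord_a : #[alpha]%g = \dim {:L}.
  have := galois_dim (finField_galois (sub1v {:L})); rewrite dimv1 divn1 => ->.
  by rewrite orderE; move: gen => /eqP ->.
apply/eqP; rewrite eqn_leq; apply/andP; split.
  by apply: dvdn_leq => //; rewrite -ord_a order_dvdn ad1.
have cardL := card_vspacef (Vector.class (finvect_type L : vectType k)).
rewrite card_vspace in cardL.
rewrite -(leq_exp2l _ _ q1) -sz_rs [X in (_ <= X)%N]cardL.
by rewrite -(card_uniqP (T := finvect_type L) rs_uniq) max_card.
Qed.

Lemma exists_irreducible_poly (d : nat) : (0 < d)%N ->
  exists h : {poly k}, [/\ irreducible_poly h, h \is monic & size h = d.+1].
Proof.
move=> d0; have [L dL] := splitting_field_degree d0.
pose x := separable_generator 1 {:L}.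
have sep : separable 1 {:L}.
  by have /and3P [_ ? _] := finField_galois (sub1v {:L}).
have genx : {:L}%VS = <<1; x>>%VS := eq_adjoin_separable_generator sep (sub1v _).
have /polyOver1P [h hE] := minPolyOver 1 x.
have szh : size h = d.+1.
  by rewrite -(size_map_poly (in_alg L)) -hE size_minPoly adjoin_degreeE dimv1 divn1 -genx dL.
exists h; split=> //; last first.
  by rewrite -(map_monic (in_alg L)) -hE monic_minPoly.
split; first by rewrite szh ltnS.
move=> g g1 gh.
have := @minPoly_irr _ _ 1%AS x (map_poly (in_alg L) g) (alg_polyOver _ _).
rewrite hE dvdp_map gh => /(_ isT) /orP[]; first by rewrite eqp_map.
rewrite -(rmorph1 (map_poly (in_alg L))) eqp_map => /eqp_size.
by rewrite size_poly1 => /eqP; rewrite (negPf g1).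
Qed.

(** Excluding X makes the companion matrices invertible. *)
Lemma exists_irreducible_poly_neqX (d : nat) : (0 < d)%N ->
  exists h : {poly k},
    [/\ irreducible_poly h, h \is monic, size h = d.+1 & ~~ ('X %| h)].
Proof.
case: d => [|[|d]] // _.
  exists ('X - 1%:P); rewrite monicXsubC size_XsubC; split=> //.
    exact: irredp_XsubC.
  by rewrite -{1}['X]subr0 -polyC0 dvdp_XsubCl rootE !hornerE oppr_eq0 oner_eq0.
have [h [h_irr h_mon h_sz]] := exists_irreducible_poly (ltn0Sn d.+1).
exists h; split=> //; apply/negP => /(h_irr.2 'X); rewrite size_polyX.
by move=> /(_ isT)/eqp_size; rewrite size_polyX h_sz.
Qed.

Section Roots.

Variables (f h : {poly k}) (d : nat).
Hypotheses (f_irr : irreducible_poly f) (f_mon : f \is monic) (szf : size f = d.+1).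
Hypotheses (h_irr : irreducible_poly h) (h_mon : h \is monic) (szh : size h = d.+1).

Let fI : monic_irreducible_poly f := (f_irr, f_mon).
Let hI : monic_irreducible_poly h := (h_irr, h_mon).
Local Notation Ff := {poly %/ f with fI}.

Lemma irreducible_deg_gt0 : (0 < d)%N.
Proof. by have [] := f_irr; rewrite szf. Qed.

Lemma in_qpoly_eq0 (g : {poly k}) : (in_qpoly f g == 0) = (f %| g).
Proof.
apply/eqP/idP => [/(congr1 val)|/modp_eq0P fg].
  rewrite /= (mk_monicE fI) => E; apply/modp_eq0P.
  by rewrite -Pdiv.IdomainMonic.modpE // in E.
apply/val_inj; rewrite /= (mk_monicE fI) -Pdiv.IdomainMonic.modpE //.
Qed.

Lemma size_qfpoly (x : Ff) : (size (x : {poly k}) <= d)%N.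
Proof.
by rewrite -ltnS -szf (leq_trans (size_mk_monic x)) // (mk_monicE fI).
Qed.

Lemma in_qpolyE (g : {poly k}) : Pdiv.CommonRing.rmodp g (mk_monic f) = g %% f.
Proof. by rewrite (mk_monicE fI) -Pdiv.IdomainMonic.modpE. Qed.

Lemma in_qfpolyK (x : Ff) : in_qpoly f (x : {poly k}) = x.
Proof. by apply: val_inj; rewrite /= in_qpolyE modp_small // szf ltnS size_qfpoly. Qed.

Lemma irreducible_dvd_Xq_subX : h %| 'X^(q ^ d) - 'X.
Proof.
have := expf_card (in_qpoly h 'X : {poly %/ h with hI}).
rewrite card_qfpoly szh /= => E.
have : in_qpoly h ('X^(q ^ d) - 'X) = 0.
  by rewrite rmorphB rmorphXn /= E subrr.
move/(congr1 val); rewrite /= (mk_monicE hI) -Pdiv.IdomainMonic.modpE //.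
by move/modp_eq0P.
Qed.

Lemma irreducible_coprime_deriv : coprimep h h^`().
Proof.
have d0 : (0 < d)%N by have [] := h_irr; rewrite szh.
have := separable_Xq_subX d0.
have [u ->] := dvdpP _ _ irreducible_dvd_Xq_subX.
by rewrite separable_mul unlock => /and3P[].
Qed.

(** Roots of h modulo f are simple. *)
Lemma comp_deriv_ndvd (g : {poly k}) : f %| h \Po g -> ~~ (f %| h^`() \Po g).
Proof.
move=> fhg; apply/negP => fh'g.
have /Bezout_eq1_coprimepP [[u v] /= uv] := irreducible_coprime_deriv.
have : f %| 1.
  rewrite -polyC1 -(comp_polyC 1 g) polyC1 -uv comp_polyD !comp_polyM.
  by apply: dvdp_add; apply: dvdp_mull.
by rewrite dvdp1 szf; have := irreducible_deg_gt0; case: d.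
Qed.

(** An irreducible h of degree d splits in the field with q^d elements, here k[X]/f. *)
Lemma card_comp_roots : #|[set x : Ff | f %| h \Po (x : {poly k})]| = d.
Proof.
pose hF : {poly Ff} := map_poly (qpolyC f) h.
have cF : #|Ff| = (q ^ d)%N by rewrite card_qfpoly szf.
have dv : hF %| \prod_(x <- enum Ff) ('X - x%:P).
  rewrite big_enum -finField_genPoly cF.
  have -> : 'X^(q ^ d) - 'X = map_poly (qpolyC f) ('X^(q ^ d) - 'X : {poly k}) :> {poly Ff}.
    by rewrite rmorphB /= map_polyXn map_polyX.
  have [u ->] := dvdpP _ _ irreducible_dvd_Xq_subX.
  by rewrite rmorphM dvdp_mull.
have [m hFm] := dvdp_prod_XsubC dv.
set rs := mask m _ in hFm.
have rsU : uniq rs by rewrite mask_uniq // enum_uniq.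
have sz_rs : size rs = d.
  have := eqp_size hFm; rewrite size_prod_XsubC size_map_inj_poly ?szh; first by case.
    by move=> x y /(congr1 val) /polyC_inj.
  exact: qpolyC0.
rewrite -[RHS]sz_rs -(card_uniqP rsU); apply: eq_card => x.
rewrite inE -root_prod_XsubC -(eqp_root hFm) rootE /hF -in_qpoly_eq0.
rewrite in_qpoly_comp_horner; congr (_.[_] == _).
exact: in_qfpolyK.
Qed.

(** Euclidean division by f: a polynomial of degree less than d + n is x + f u with
    x reduced modulo f and u of degree less than n. *)
Lemma card_poly_decomp n (P : pred {poly k}) :
  #|[set g : {poly_(d + n) k} | P g]| =
  (\sum_(x : Ff) #|[set u : {poly_n k} | P ((x : {poly k}) + f * u)%R]|)%N.
Proof.
pose phi (y : Ff * {poly_n k}) : {poly_(d + n) k} := npolyp (d + n) ((y.1 : {poly k}) + f * y.2).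
pose psi (g : {poly_(d + n) k}) : Ff * {poly_n k} :=
  (in_qpoly f g : Ff, npolyp n ((g : {poly k}) %/ f)).
have f0 : f != 0 := irredp_neq0 f_irr.
have szphi (y : Ff * {poly_n k}) : (size ((y.1 : {poly k}) + f * y.2)%R <= d + n)%N.
  rewrite (leq_trans (size_polyD _ _)) // geq_max (leq_trans (size_qfpoly _)) ?leq_addr //=.
  rewrite (leq_trans (size_polyMleq _ _)) // szf addSn /= leq_add2l; exact: size_npoly.
have szmod (x : Ff) : (size (x : {poly k}) < size f)%N by rewrite szf ltnS size_qfpoly.
have phiK : cancel phi psi.
  move=> [x u]; rewrite /psi /phi /=; congr (_, _); apply: val_inj => /=.
    rewrite in_qpolyE npolypK ?(szphi (x, u)) //.
    by rewrite modpD modp_small // mulrC modp_mull addr0.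
  rewrite npolypK ?(szphi (x, u)) // divpD divp_small // add0r mulrC mulpK //.
  by rewrite npolypK // size_npoly.
have psiK : cancel psi phi.
  move=> g; apply: val_inj; rewrite /phi /psi /=.
  rewrite [npolyp n _ : {poly k}]npolypK; last first.
    rewrite size_divp // szf leq_subLR; exact: size_npoly.
  rewrite in_qpolyE npolypK.
    by rewrite addrC mulrC -divp_eq.
  by rewrite addrC mulrC -divp_eq size_npoly.
rewrite -sum1dep_card (reindex phi); last by exists psi => y _; [apply: phiK | apply: psiK].
under [RHS]eq_bigr do rewrite -sum1dep_card.
rewrite pair_big_dep /=; apply: eq_bigl => -[x u] /=.
by rewrite npolypK ?(szphi (x, u)).
Qed.

Lemma card_dvd_poly n : #|[set g : {poly_(d + n) k} | f %| g]| = (q ^ n)%N.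
Proof.
rewrite card_poly_decomp (bigD1 (0 : Ff)) //= [X in (_ + X)%N]big1 ?addn0.
  rewrite -(card_npoly k n) -cardsT; apply: eq_card => u.
  by rewrite !inE add0r dvdp_mulr.
move=> x x0; apply/eqP; rewrite cards_eq0; apply/eqP/setP => u.
rewrite !inE dvdp_addl ?dvdp_mulr //; apply/negP => /dvdp_leq.
rewrite (_ : (x : {poly k}) != 0); last by apply: contra x0 => /eqP E; apply/eqP/val_inj.
by move=> /(_ isT); rewrite leqNgt szf ltnS size_qfpoly.
Qed.

Lemma comp_poly_taylor2 (p x y : {poly k}) :
  exists r, p \Po (x + y) = p \Po x + y * (p^`() \Po x) + y ^+ 2 * r.
Proof.
elim/poly_ind: p => [|p c [r IH]].
  by exists 0; rewrite deriv0 !comp_poly0 !mulr0 !addr0.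
exists (p^`() \Po x + r * (x + y)).
rewrite derivD derivC derivM derivX !(comp_polyD, comp_polyM, comp_polyX, comp_polyC) IH.
by rewrite polyC0 polyC1; ring.
Qed.

(** For a root x of h modulo f, exactly one class of u modulo f makes
    h (x + f u) divisible by f^2, by the Taylor expansion of h at x. *)
Lemma card_comp_sqr_dvd n (x : {poly k}) : f %| h \Po x ->
  #|[set u : {poly_(d + n) k} | f ^+ 2 %| h \Po (x + f * (u : {poly k}))]| = (q ^ n)%N.
Proof.
move=> fhx; have f0 : f != 0 := irredp_neq0 f_irr.
have [c hx] := dvdpP _ _ fhx.
have nh' := comp_deriv_ndvd fhx.
have E (u : {poly k}) : (f ^+ 2 %| h \Po (x + f * u)) = (f %| c + u * (h^`() \Po x)).
  have [r ->] := comp_poly_taylor2 h x (f * u).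
  rewrite dvdp_addl; last by rewrite exprMn -mulrA dvdp_mulr.
  rewrite hx expr2 [c * f]mulrC -mulrA -mulrDr dvdp_mul2l //.
rewrite (card_poly_decomp n (fun u => f ^+ 2 %| h \Po (x + f * u))).
(* The class of u solving c + u h'(x) = 0 modulo f. *)
pose y0 : Ff := - in_qpoly f c / in_qpoly f (h^`() \Po x).
have dn0 : in_qpoly f (h^`() \Po x) != 0 :> Ff by rewrite in_qpoly_eq0.
have E2 (y : Ff) (w : {poly k}) :
    (f ^+ 2 %| h \Po (x + f * ((y : {poly k}) + f * w))) = (y == y0).
  rewrite E mulrDl addrA dvdp_addl; last by rewrite -mulrA dvdp_mulr.
  rewrite -in_qpoly_eq0 rmorphD rmorphM /=.
  have -> : in_qpoly f (y : {poly k}) = y.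
    exact: in_qfpolyK.
  rewrite /y0 addrC addr_eq0.
  by rewrite -(can2_eq (mulfK dn0) (mulfVK dn0)).
clearbody y0; rewrite (bigD1 y0) //= [X in (_ + X)%N]big1 ?addn0.
  rewrite -(card_npoly k n) -cardsT; apply: eq_card => u.
  by rewrite !inE E2 eqxx.
move=> y yy0; apply/eqP; rewrite cards_eq0; apply/eqP/setP => u.
by rewrite !inE E2 (negPf yy0).
Qed.

End Roots.

End FiniteFieldPolynomials.

(** * Counting the centralisers of indecomposable elements *)

Lemma subn_injr (a b c : nat) :
  (b <= a)%N -> (c <= a)%N -> (a - b = a - c)%N -> b = c.
Proof. by lia. Qed.

Section CountCyclic.

Variable k : finFieldType.
Local Notation q := #|k|.

(** Invertible matrices as a set of matrices; unlike the group type for the general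
    linear group, this makes sense in dimension 0. *)
Definition GLmx n : {set 'M[k]_n} := [set g | g \in unitmx].

(** The centraliser of b in the general linear group. *)
Definition centGL n (b : 'M[k]_n) : {set 'M[k]_n} :=
  [set g in GLmx n | g *m b == b *m g].

Lemma card_conj_class n (c : 'M[k]_n) :
  (#|[set invmx P *m c *m P | P in GLmx n]| * #|centGL c| = #|GLmx n|)%N.
Proof.
rewrite -[RHS]sum1_card (partition_big_imset (fun P => invmx P *m c *m P)) /=.
rewrite -sum_nat_const; apply: eq_bigr => y /imsetP [P0 P0u ->].
rewrite inE in P0u.
rewrite sum1dep_card -(card_in_imset (f := fun h => h *m P0) (D := mem (centGL c))); last first.
  by move=> h h' _ _ /= E; rewrite -(mulmxK P0u h) E mulmxK.
apply: eq_card => P; rewrite !inE; apply/imsetP/andP => [[h]|[Pu /eqP E]].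
  rewrite !inE => /andP [hu /eqP hc] ->; rewrite unitmx_mul hu P0u; split=> //.
  apply/eqP; apply: (can_inj (mulKmx (_ : h *m P0 \in unitmx))).
    by rewrite unitmx_mul hu.
  rewrite -(mulmxA (invmx (h *m P0))) mulKVmx ?unitmx_mul ?hu //.
  by rewrite -(mulmxA (invmx P0)) -(mulmxA h) mulKVmx // !mulmxA hc.
exists (P *m invmx P0); last by rewrite mulmxKV.
rewrite !inE unitmx_mul Pu unitmx_inv P0u /=; apply/eqP.
have : P *m (invmx P *m c *m P) = P *m (invmx P0 *m c *m P0) by rewrite E.
rewrite -!mulmxA mulKVmx // => E2.
rewrite !mulmxA; apply: (can_inj (mulmxK P0u)).
by rewrite mulmxKV // -!mulmxA -E2.
Qed.

Lemma horner_mx_comp n (b : 'M[k]_n.+1) (g p : {poly k}) :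
  horner_mx (horner_mx b g) p = horner_mx b (p \Po g).
Proof.
elim/poly_ind: p => [|p c IH]; first by rewrite comp_poly0 !rmorph0.
rewrite comp_polyD comp_polyM comp_polyX comp_polyC !rmorphD !rmorphM /= IH.
by rewrite horner_mx_X !horner_mx_C.
Qed.

Lemma dvdp_irreducible_power (p h : {poly k}) m : irreducible_poly h -> (0 < m)%N ->
  p %| h ^+ m -> p %| h ^+ m.-1 \/ h ^+ m %| p.
Proof.
move=> h_irr m0 ph; have [|nhp] := boolP (h ^+ m %| p); [by right | left].
have [r [s <-]] := coprime_power_dvd h_irr nhp m0.
by rewrite dvdp_add ?dvdp_mull.
Qed.

Lemma irreducible_ndvd1 (f : {poly k}) : irreducible_poly f -> ~~ (f %| 1).
Proof. by case=> + _; rewrite dvdp1; case: (size f) => [|[]]. Qed.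

Lemma irreducible_dvd_exp (f g : {poly k}) m : irreducible_poly f ->
  f %| g ^+ m -> f %| g.
Proof.
move=> f_irr; apply: contraTT => nfg.
have cop : coprimep f (g ^+ m) by rewrite coprimep_expr // irreducible_poly_coprime.
apply: contra (irreducible_ndvd1 f_irr) => fg.
by rewrite -(Gauss_dvdpr 1 cop) mulr1.
Qed.

(** A polynomial g(b) in a matrix b with minimal polynomial f^m has minimal
    polynomial h^m exactly when f divides h(g) once; for m = 1 it is enough that
    f divides h(g). *)
Lemma minpoly_horner_power n (b : 'M[k]_n.+1) (f h g : {poly k}) m :
    irreducible_poly f -> irreducible_poly h -> h \is monic -> (0 < m)%N ->
    mxminpoly b = f ^+ m ->
  (mxminpoly (horner_mx b g) == h ^+ m) =
  (f %| h \Po g) && ((1 < m)%N ==> ~~ (f ^+ 2 %| h \Po g)).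
Proof.
move=> f_irr h_irr h_mon m0 bf.
have f0 := irredp_neq0 f_irr; have h0 := irredp_neq0 h_irr.
have dvE p : (mxminpoly (horner_mx b g) %| p) = (f ^+ m %| p \Po g).
  by rewrite dvd_mxminpoly horner_mx_comp -dvd_mxminpoly bf.
have hXE i : (h ^+ i) \Po g = (h \Po g) ^+ i by rewrite /= rmorphXn.
have nhh : ~~ (h ^+ m %| h ^+ m.-1).
  apply/negP; rewrite -[in X in X %| _](prednK m0) exprS -[X in _ %| X]mul1r.
  by rewrite dvdp_mul2r ?expf_neq0 // (negPf (irreducible_ndvd1 h_irr)).
apply/eqP/andP => [E|[fhg nf2]].
  have f_hg : f %| h \Po g.
    apply: (@irreducible_dvd_exp _ _ m) => //.
    rewrite -hXE; apply: dvdp_trans (_ : f ^+ m %| _).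
      by rewrite -{1}(expr1 f) dvdp_exp2l.
    by rewrite -dvE E.
  split=> //; apply/implyP => m1; apply: contra nhh => f2.
  rewrite -E dvE hXE; apply: dvdp_trans (_ : f ^+ (2 * m.-1) %| _).
    by rewrite dvdp_exp2l //; lia.
  by rewrite exprM dvdp_exp2r.
have Phm : mxminpoly (horner_mx b g) %| h ^+ m by rewrite dvE hXE dvdp_exp2r.
have [|hmP] := dvdp_irreducible_power h_irr m0 Phm.
  rewrite dvE hXE; have [c cE] := dvdpP _ _ fhg.
  rewrite cE exprMn; move: nf2; case: (ltngtP 1%N m) m0 => // [m1|<-] _ /=; last first.
    by rewrite !expr0 expr1 mulr1 (negPf (irreducible_ndvd1 f_irr)).
  rewrite cE expr2 dvdp_mul2r // => nfc.
  rewrite -[in X in X %| _](prednK (ltnW m1)) exprS dvdp_mul2r ?expf_neq0 //.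
  by move=> /(irreducible_dvd_exp f_irr); rewrite (negPf nfc).
by apply/eqP; rewrite -eqp_monic ?mxminpoly_monic ?monic_exp //; apply/andP.
Qed.

(** For deg f = d, the number of classes u modulo f^(m-1) for which x + f u is a root
    of h modulo f but not modulo f^2, where x is a given root of h modulo f; the
    second condition is void when m = 1. *)
Definition kappa d m := (if m == 1 then 1 else q ^ (d * m.-1) - q ^ (d * m.-2))%N.

Section FixedDegree.

Variables (f h : {poly k}) (d m n : nat).
Hypotheses (f_irr : irreducible_poly f) (f_mon : f \is monic) (szf : size f = d.+1).
Hypotheses (h_irr : irreducible_poly h) (h_mon : h \is monic) (szh : size h = d.+1).
Hypotheses (m0 : (0 < m)%N) (n_eq : n.+1 = (d * m)%N).

Lemma dim_split : n.+1 = (d + d * m.-1)%N.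
Proof. by rewrite n_eq -mulnS prednK. Qed.

Lemma size_power : size (f ^+ m) = n.+2.
Proof.
have f0 := irredp_neq0 f_irr.
rewrite -[size _]prednK ?size_poly_gt0 ?expf_neq0 //.
by rewrite size_exp szf /= -n_eq.
Qed.

Lemma card_minpoly_comp :
  #|[set g : {poly_(d + d * m.-1) k} |
     (f %| h \Po (g : {poly k})) && ((1 < m)%N ==> ~~ (f ^+ 2 %| h \Po (g : {poly k})))]|
  = (d * kappa d m)%N.
Proof.
rewrite (card_poly_decomp f_irr f_mon szf _
  (fun g => (f %| h \Po g) && ((1 < m)%N ==> ~~ (f ^+ 2 %| h \Po g)))).
rewrite (bigID (fun x : {poly %/ f with (f_irr, f_mon)} => f %| h \Po (x : {poly k}))) /= [X in (_ + X)%N]big1 ?addn0; last first.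
  move=> x nx; apply/eqP; rewrite cards_eq0; apply/eqP/setP => u; rewrite !inE.
  have [r ->] := comp_poly_taylor2 h x (f * u).
  by rewrite -addrA dvdp_addl ?(negPf nx) // expr2 -!mulrA -mulrDr dvdp_mulr.
have -> : (d * kappa d m = \sum_(x in [set x : {poly %/ f with (f_irr, f_mon)} |
    (f %| h \Po (x : {poly k}))%R]) kappa d m)%N.
  by rewrite sum_nat_const (card_comp_roots f_irr f_mon szf h_irr h_mon szh).
apply: eq_big => [x|x fx]; first by rewrite inE.
have fu (u : {poly k}) : f %| h \Po ((x : {poly k}) + f * u).
  have [r ->] := comp_poly_taylor2 h x (f * u).
  by rewrite -addrA dvdp_addl // expr2 -!mulrA -mulrDr dvdp_mulr.
rewrite /kappa; case: (ltngtP 1%N m) m0 => // [m1|<-] _ /=; last first.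
  rewrite muln0 -[RHS](expn0 q) -(card_npoly k 0) -cardsT.
  by apply: eq_card => u; rewrite !inE fu.
have r_eq : (d * m.-1 = d + d * m.-2)%N by rewrite -mulnS prednK // -ltnS prednK.
rewrite r_eq -(card_comp_sqr_dvd f_irr f_mon szf h_irr h_mon szh (d * m.-2) fx).
rewrite -(card_npoly k (d + _)) -cardsT.
rewrite -(finset.setTI [set u : {poly_(d + d * m.-2) k} | _ %| _]) -cardsD.
by apply: eq_card => u; rewrite !inE fu andbT.
Qed.

Lemma card_dvd_poly_small : #|[set g : {poly_(d + d * m.-1) k} | ~~ (f %| (g : {poly k}))]|
  = (q ^ n.+1 - q ^ (n.+1 - d))%N.
Proof.
have -> : (n.+1 - d = d * m.-1)%N by rewrite dim_split addKn.
rewrite -(card_dvd_poly f_irr f_mon szf (d * m.-1)) dim_split.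
rewrite -(card_npoly k (d + _)) -cardsT.
rewrite -(finset.setTI [set g : {poly_(d + d * m.-1) k} | f %| _]) -cardsD.
by apply: eq_card => u; rewrite !inE andbT.
Qed.

Section FixedMatrix.

Variable b : 'M[k]_n.+1.
Hypothesis bf : mxminpoly b = f ^+ m.

Lemma horner_npoly_inj :
  injective (fun g : {poly_(d + d * m.-1) k} => horner_mx b (g : {poly k})).
Proof.
move=> g g' /eqP; rewrite -subr_eq0 -rmorphB /= -dvd_mxminpoly bf.
have : (size ((g : {poly k}) - (g' : {poly k}))%R < size (f ^+ m))%N.
  rewrite size_power ltnS dim_split (leq_trans (size_polyD _ _)) //.
  by rewrite size_polyN geq_max !size_npoly.
move=> sz /modp_eq0P; rewrite modp_small // => /eqP; rewrite subr_eq0 => /eqP E.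
exact: val_inj.
Qed.

Lemma minpoly_kcyclic : kcyclic b.
Proof. by apply: (kcyclic_minpoly f_irr m0 bf); rewrite bf size_power. Qed.

Lemma comm_horner_npoly x : x *m b = b *m x ->
  exists g : {poly_(d + d * m.-1) k}, x = horner_mx b (g : {poly k}).
Proof.
move=> /(kcyclic_comm minpoly_kcyclic) [g ->].
have P0 : f ^+ m != 0 by rewrite expf_neq0 // irredp_neq0.
have sz : (size (g %% f ^+ m)%R <= d + d * m.-1)%N.
  by rewrite -dim_split -ltnS -size_power ltn_modp.
exists (npolyp _ (g %% f ^+ m)); rewrite npolypK //.
rewrite {1}(divp_eq g (f ^+ m)) rmorphD rmorphM /= -[in X in _ * X + _]bf.
by rewrite mx_root_minpoly mulr0 add0r.
Qed.

(** The commutant k[b] of a matrix b with minimal polynomial f^m contains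
    d * kappa d m matrices with minimal polynomial h^m, whichever f and h of
    degree d are chosen. *)
Lemma card_minpoly_algebra :
  #|[set b' | (b' *m b == b *m b') && (mxminpoly b' == h ^+ m)]| = (d * kappa d m)%N.
Proof.
rewrite -card_minpoly_comp -(card_imset _ horner_npoly_inj).
apply: eq_card => b'; rewrite inE; apply/andP/imsetP => [[/eqP /comm_horner_npoly [g ->]]|].
  by rewrite (minpoly_horner_power _ f_irr h_irr h_mon m0 bf) => gh; exists g; rewrite // inE.
move=> [g]; rewrite inE => gh ->; rewrite (minpoly_horner_power _ f_irr h_irr h_mon m0 bf) gh.
by split=> //; apply/eqP; apply: comm_horner_mx.
Qed.

Lemma horner_unitmx (g : {poly k}) : (horner_mx b g \in unitmx) = ~~ (f %| g).
Proof.
have [fg|nfg] /= := boolP (f %| g).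
  apply/negP => u.
  have : horner_mx b g ^+ m = 0.
    by rewrite -rmorphXn /=; apply/eqP; rewrite -dvd_mxminpoly bf dvdp_exp2r.
  move=> E; have : horner_mx b g ^+ m \in unitmx by apply: (unitrX m u).
  by rewrite E unitmxE det0 unitr0.
have cop : coprimep g (f ^+ m).
  by rewrite coprimep_sym coprimep_expl // irreducible_poly_coprime.
have /Bezout_eq1_coprimepP [[u v] /= uv] := cop.
have E : horner_mx b u *m horner_mx b g = 1%:M.
  have := congr1 (horner_mx b) uv; rewrite rmorphD !rmorphM /= -bf mx_root_minpoly.
  by rewrite mulr0 addr0 rmorph1.
by case/mulmx1_unit: E.
Qed.

Lemma card_centGL : #|centGL b| = (q ^ n.+1 - q ^ (n.+1 - d))%N.
Proof.
rewrite -card_dvd_poly_small -(card_imset _ horner_npoly_inj).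
apply: eq_card => x; rewrite !inE; apply/andP/imsetP => [[xu /eqP /comm_horner_npoly [g E]]|].
  by exists g; rewrite // inE -horner_unitmx -E.
move=> [g]; rewrite inE => gh ->; rewrite horner_unitmx gh; split=> //.
by apply/eqP; apply: comm_horner_mx.
Qed.

(** An element b' of the same type (d, m) that commutes with b generates the same
    algebra k[b'] = k[b], which is the commutant of both. *)
Lemma centGL_minpoly_algebra b' : b' \in unitmx -> mxminpoly b' = h ^+ m ->
  (centGL b' == centGL b) = (b' *m b == b *m b').
Proof.
move=> b'u b'h; apply/eqP/eqP => [E|/esym E].
  have : b' \in centGL b by rewrite -E !inE b'u eqxx.
  by rewrite !inE => /andP [_ /eqP].
have b'c : kcyclic b'.
  apply: (kcyclic_minpoly h_irr m0 b'h); rewrite b'h.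
  have h0 := irredp_neq0 h_irr.
  rewrite -[size _]prednK ?size_poly_gt0 ?expf_neq0 //.
  by rewrite size_exp szh /= -n_eq.
apply/setP => x; rewrite !inE; congr (_ && _); apply/eqP/eqP => xb.
  have [g ->] := kcyclic_comm b'c xb.
  by apply: comm_horner_mx; rewrite /comm_mx.
have [g ->] := kcyclic_comm minpoly_kcyclic xb.
by apply: comm_horner_mx; rewrite /comm_mx.
Qed.

End FixedMatrix.

(** The matrices with minimal polynomial f^m of full degree form one conjugacy class,
    and their centralisers are isomorphic to the unit group of k[X]/f^m. *)
Lemma card_minpoly :
  (#|[set b : 'M[k]_n.+1 | mxminpoly b == f ^+ m]| * (q ^ n.+1 - q ^ (n.+1 - d))
   = #|GLmx n.+1|)%N.
Proof.
have [c cf] := exists_minpoly (monic_exp m f_mon) size_power.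
rewrite -(card_centGL cf) -(card_conj_class c); congr (_ * _)%N.
apply: eq_card => b; rewrite inE; apply/eqP/imsetP => [bf|[P Pu ->]].
  have [P Pu ->] := minpoly_conj f_irr m0 cf bf size_power.
  by exists P; rewrite // inE.
rewrite inE in Pu.
have E p : horner_mx (invmx P *m c *m P) p = invmx P *m horner_mx c p *m P.
  elim/poly_ind: p => [|p a IH]; first by rewrite !rmorph0 mulmx0 mul0mx.
  rewrite !rmorphD !rmorphM /= IH !horner_mx_X !horner_mx_C mulmxDr mulmxDl.
  by rewrite scalar_mxC -(mulmxA a%:M) mulVmx // mulmx1 -!mulmxE !mulmxA mulmxK.
apply/eqP; rewrite -cf -eqp_monic ?mxminpoly_monic //; apply/andP; split.
  by rewrite dvd_mxminpoly E mx_root_minpoly mulmx0 mul0mx.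
rewrite dvd_mxminpoly; apply/eqP.
apply: (can_inj (mulmxK Pu)); apply: (can_inj (mulKVmx Pu)).
by rewrite mulmxA -E mx_root_minpoly mul0mx mulmx0.
Qed.

End FixedDegree.

(** Invertible matrices for which the nonzero row space is indecomposable. *)
Definition cyc n (b : 'M[k]_n) : Prop :=
  [/\ (0 < n)%N, b \in unitmx & idem_indecomposable b].

(** The set of centralisers of such matrices: the possible factors A_i. *)
Definition Icyc n : {set {set 'M[k]_n}} :=
  [set centGL b | b in [set b | `[< cyc b >]]].

Lemma kappa_gt0 d m : (0 < d)%N -> (0 < m)%N -> (0 < kappa d m)%N.
Proof.
move=> d0; rewrite /kappa; case: m => [|[|m]] //= _.
by rewrite subn_gt0 ltn_exp2l ?finNzRing_gt1 // ltn_mul2l d0 ltnSn.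
Qed.

Lemma centdim_gt0 d n : (0 < d <= n)%N -> (0 < q ^ n - q ^ (n - d))%N.
Proof. by move=> dn; rewrite subn_gt0 ltn_exp2l ?finNzRing_gt1 //; lia. Qed.

(** The centralisers are sorted by the type (d, m), with d m = n + 1. One irreducible
    polynomial h d is fixed for each degree; a centraliser of type (d, m) contains
    d * kappa d m matrices with minimal polynomial (h d)^m, and all these matrices
    form one conjugacy class. *)
Lemma card_Icyc (K : numFieldType) n :
  #|Icyc n.+1|%:R / #|GLmx n.+1|%:R =
  \sum_(d < n.+2 | (0 < d)%N && (d %| n.+1)%N)
     ((q ^ n.+1 - q ^ (n.+1 - d)) * (d * kappa d (n.+1 %/ d)))%N%:R^-1 :> K.
Proof.
have /choice [h hP] (d : nat) : exists h : {poly k}, (0 < d)%N ->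
    [/\ irreducible_poly h, h \is monic, size h = d.+1 & ~~ ('X %| h)].
  have [d0|_] := boolP (0 < d)%N; last by exists 0.
  by have [h hP] := exists_irreducible_poly_neqX k d0; exists h.
pose J (d : 'I_n.+2) : {set {set 'M[k]_n.+1}} :=
  if (0 < d)%N && (d %| n.+1)%N then
    [set centGL b | b in [set b : 'M[k]_n.+1 | mxminpoly b == h d ^+ (n.+1 %/ d)]]
  else finset.set0.
have dm (d : nat) : (d %| n.+1)%N -> (n.+1 = d * (n.+1 %/ d))%N.
  by move=> dn; rewrite mulnC divnK.
have m_gt0 (d : nat) : (0 < d)%N -> (d %| n.+1)%N -> (0 < n.+1 %/ d)%N.
  by move=> d0 dn; rewrite divn_gt0 // dvdn_leq.
have unit_of (b : 'M[k]_n.+1) f m : irreducible_poly f -> (0 < m)%N ->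
    mxminpoly b = f ^+ m -> (b \in unitmx) = ~~ (f %| 'X).
  move=> f_irr m0 bf; rewrite -{1}(horner_mx_X b) (horner_unitmx f_irr bf) //.
have XF (f : {poly k}) : irreducible_poly f -> (f %| 'X) = ('X %| f).
  move=> f_irr; have szf1 : size f != 1 by have [] := f_irr; case: (size f) => [|[]].
  have X_irr : irreducible_poly ('X : {poly k}) by rewrite -['X]subr0 -polyC0; apply: irredp_XsubC.
  apply/idP/idP => [/(X_irr.2 _ szf1)|/(f_irr.2 'X)]; rewrite /eqp.
    by case/andP.
  by rewrite size_polyX => /(_ isT) /andP[].
have J_card (d : 'I_n.+2) : (0 < d)%N -> (d %| n.+1)%N ->
   (#|J d| * (d * kappa d (n.+1 %/ d)) * (q ^ n.+1 - q ^ (n.+1 - d)) = #|GLmx n.+1|)%N.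
  move=> d0 dn; have [h_irr h_mon szh nX] := hP d d0.
  have m0 := m_gt0 d d0 dn.
  rewrite -(card_minpoly h_irr h_mon szh m0 (dm d dn)); congr (_ * _)%N.
  rewrite -[RHS]sum1_card (partition_big_imset (@centGL n.+1)) /=.
  rewrite /J d0 dn /= -sum_nat_const; apply: eq_bigr => B /imsetP [b].
  rewrite inE => /eqP bh ->.
  rewrite sum1dep_card -(card_minpoly_algebra h_irr h_mon szh h_irr h_mon szh m0 (dm d dn) bh).
  apply: eq_card => b'; rewrite !inE andbC; apply: andb_id2l => /eqP b'h.
  rewrite (centGL_minpoly_algebra h_irr szh h_irr szh m0 (dm d dn) bh) //.
  by rewrite (unit_of _ _ _ h_irr m0 b'h) XF.
(* Centralisers of different types have different orders. *)
have J_disj (d d' : 'I_n.+2) : d != d' -> [disjoint J d & J d'].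
  move=> dd'; apply/pred0P => B /=; apply/negbTE/negP; rewrite /J.
  case: ifP => [/andP [d0 dn]|]; last by rewrite inE.
  case: ifP => [/andP [d'0 d'n]|]; last by rewrite inE andbF.
  case/andP => /imsetP [b + ->] /imsetP [b' + ].
  rewrite !inE => /eqP bh /eqP b'h E.
  have [h_irr h_mon szh nX] := hP d d0; have [h'_irr h'_mon szh' nX'] := hP d' d'0.
  have := card_centGL h_irr h_mon szh (m_gt0 _ d0 dn) (dm d dn) bh.
  rewrite E (card_centGL h'_irr h'_mon szh' (m_gt0 _ d'0 d'n) (dm d' d'n) b'h).
  have q1 := finNzRing_gt1 k.
  have le_d i : (q ^ (n.+1 - i) <= q ^ n.+1)%N by rewrite leq_exp2l // leq_subr.
  move=> E2; have /eqP : (q ^ (n.+1 - d') = q ^ (n.+1 - d))%N.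
    exact: subn_injr (le_d _) (le_d _) E2.
  rewrite eqn_exp2l // => /eqP E3; case/eqP: dd'; apply: val_inj => /=.
  by apply/esym/(@subn_injr n.+1) => //; apply: dvdn_leq.
have IJ : Icyc n.+1 = \bigcup_d J d.
  apply/setP => B; apply/imsetP/bigcupP => [[b]|[d _]].
    rewrite inE => /asboolP [_ bu b_ind] ->.
    have [f [m [f_irr f_mon m0 bf szm]]] := idem_indecomposable_minpoly b_ind.
    have d0 : (0 < (size f).-1)%N by have [] := f_irr; case: (size f) => [|[]].
    have szf : size f = (size f).-1.+1 by rewrite prednK // size_poly_gt0 irredp_neq0.
    have n_eq : n.+1 = ((size f).-1 * m)%N.
      by rewrite -size_exp -bf szm.
    have dn : ((size f).-1 %| n.+1)%N by rewrite n_eq dvdn_mulr.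
    have dlt : ((size f).-1 < n.+2)%N by rewrite ltnS dvdn_leq.
    have mE : (n.+1 %/ (size f).-1 = m)%N by rewrite n_eq mulKn.
    exists (Ordinal dlt) => //; rewrite /J /= d0 dn /= mE.
    have [h_irr h_mon szh nX] := hP _ d0.
    have := card_minpoly_algebra f_irr f_mon szf h_irr h_mon szh m0 n_eq bf.
    have : (0 < (size f).-1 * kappa (size f).-1 m)%N by rewrite muln_gt0 d0 kappa_gt0.
    move=> /[swap] <- /card_gt0P [b']; rewrite inE => /andP [b'b /eqP b'h].
    apply/imsetP; exists b'; first by rewrite inE b'h.
    apply/esym/eqP; rewrite (centGL_minpoly_algebra f_irr szf h_irr szh m0 n_eq bf) //.
    by rewrite (unit_of _ _ _ h_irr m0 b'h) XF.
  rewrite /J; case: ifP => [/andP [d0 dn]|]; last by rewrite inE.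
  case/imsetP => b; rewrite inE => /eqP bh ->; exists b => //.
  have [h_irr h_mon szh nX] := hP d d0.
  have m0 := m_gt0 d d0 dn.
  rewrite inE; apply/asboolP; split=> //.
    by rewrite (unit_of _ _ _ h_irr m0 bh) XF.
  apply: (minpoly_idem_indecomposable h_irr m0 bh).
  by rewrite bh (size_power h_irr szh (dm d dn)).
have -> : #|Icyc n.+1| = (\sum_d #|J d|)%N.
  rewrite IJ -sum1_card partition_disjoint_bigcup //.
  by apply: eq_bigr => d _; rewrite sum1_card.
rewrite natr_sum mulr_suml [RHS]big_mkcond; apply: eq_bigr => d _.
case: ifP => [/andP [d0 dn]|E]; last by rewrite /J E cards0 mul0r.
have dn' : (0 < d <= n.+1)%N by rewrite d0 dvdn_leq.
have q1 := centdim_gt0 dn'.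
have k0 : (0 < d * kappa d (n.+1 %/ d))%N by rewrite muln_gt0 d0 kappa_gt0 ?m_gt0.
have G0 : (#|J d| * (d * kappa d (n.+1 %/ d)) * (q ^ n.+1 - q ^ (n.+1 - d)))%N%:R != 0 :> K.
  rewrite J_card // pnatr_eq0 -lt0n; apply/card_gt0P; exists 1%:M.
  by rewrite inE unitmx1.
rewrite -(J_card d d0 dn); move: G0; rewrite !natrM !mulf_eq0 !negb_or.
move=> /andP [/andP [J0 /andP [dd0 kk0]] qq0].
by field; rewrite J0 dd0 kk0 qq0.
Qed.

End CountCyclic.

(** * The recursion given by the removal of one block *)

Section Recursion.

Variable k : finFieldType.
Local Notation GLmx := (GLmx k).

(** A block: e is an idempotent of rank N, factored as Y X with X Y = 1, and b acts on
    the row space of e as an element of type cyc and kills the row space of 1 - e. *)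
Definition block_of n (e b : 'M[k]_n) : Prop :=
  exists N (X : 'M[k]_(N, n)) (Y : 'M[k]_(n, N)) (b0 : 'M[k]_N),
    [/\ cyc b0, X *m Y = 1%:M, e = Y *m X & b = Y *m b0 *m X].

(** A complete orthogonal system E of idempotents, with a block on each of them; the
    values of beta outside E are irrelevant. *)
Definition datum n (E : {set 'M[k]_n}) (beta : 'M[k]_n -> 'M[k]_n) : Prop :=
  [/\ {in E &, forall e e', e != e' -> e *m e' = 0},
      \sum_(e in E) e = 1%:M &
      {in E, forall e, block_of e (beta e)}].

(** The invertible matrices that commute with all the blocks. *)
Definition torus n (E : {set 'M[k]_n}) (beta : 'M[k]_n -> 'M[k]_n) : {set 'M[k]_n} :=
  [set g in GLmx n | [forall e in E, g *m beta e == beta e *m g]].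

(** The groups of the family as sets of n x n matrices, including n = 0. *)
Definition calAm n : {set {set 'M[k]_n}} :=
  [set S | `[< exists E beta, datum E beta /\ S = torus E beta >]].

Lemma torusP n (E : {set 'M[k]_n}) beta g :
  reflect (g \in unitmx /\ {in E, forall e, g *m beta e = beta e *m g})
          (g \in torus E beta).
Proof.
rewrite !inE; apply: (iffP andP) => -[gu gE]; split=> //.
  by move=> e eE; apply/eqP/(forall_inP gE).
by apply/forall_inP => e eE; apply/eqP/gE.
Qed.

Lemma one_torus n (E : {set 'M[k]_n}) beta : 1%:M \in torus E beta.
Proof. by apply/torusP; split=> [|e _]; rewrite ?unitmx1 // mul1mx mulmx1. Qed.

Lemma idem_of n N (X : 'M[k]_(N, n)) (Y : 'M[k]_(n, N)) : X *m Y = 1%:M ->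
  [/\ (Y *m X) *m (Y *m X) = Y *m X, X *m (Y *m X) = X & (Y *m X) *m Y = Y].
Proof.
move=> XY; split.
- by rewrite mulmxA -(mulmxA Y) XY mulmx1.
- by rewrite mulmxA XY mul1mx.
- by rewrite -mulmxA XY mulmx1.
Qed.

Section BlockOf.

Variables (n : nat) (e b : 'M[k]_n).
Hypothesis eb : block_of e b.

Lemma block_idem : [/\ e *m e = e, e *m b = b & b *m e = b].
Proof.
have [N [X [Y [b0 [_ XY eE bE]]]]] := eb.
have [ee Xe eY] := idem_of XY.
rewrite eE; split=> //; rewrite bE; first by rewrite !mulmxA -eE eE eY.
by rewrite -!mulmxA Xe.
Qed.

Lemma block_neq0 : e != 0.
Proof.
have [N [X [Y [b0 [[N0 _ _] XY eE bE]]]]] := eb.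
apply/eqP => e0; have : X *m e *m Y = 1%:M.
  by rewrite eE !mulmxA XY mul1mx.
rewrite e0 mulmx0 mul0mx => /(congr1 (fun A : 'M_N => A (Ordinal N0) (Ordinal N0))).
by rewrite !mxE eqxx => /esym/eqP; rewrite oner_eq0.
Qed.

(** Since b is invertible on the row space of e, its commutant preserves the
    decomposition given by e. *)
Lemma block_comm g : g *m b = b *m g -> g *m e = e *m g.
Proof.
have [ee eb' be] := block_idem.
have [N [X [Y [b0 [[N0 b0u _] XY eE bE]]]]] := eb.
pose b' := Y *m invmx b0 *m X.
have bb' : b *m b' = e.
  by rewrite bE /b' !mulmxA -(mulmxA _ X Y) XY mulmx1 -(mulmxA Y) mulmxV // mulmx1.
have b'b : b' *m b = e.
  by rewrite bE /b' !mulmxA -(mulmxA _ X Y) XY mulmx1 -(mulmxA Y) mulVmx // mulmx1.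
move=> gb.
have -> : g *m e = e *m g *m e.
  by rewrite -{1}bb' mulmxA gb -{1}eb' -(mulmxA e b) -gb -!mulmxA bb'.
have -> : e *m g = b' *m g *m b by rewrite -b'b -(mulmxA b' b) -gb mulmxA.
by rewrite -mulmxA be.
Qed.

(** The row space of e is indecomposable under b. *)
Lemma block_dichotomy p : p *m p = p -> p *m b = b *m p ->
  e *m p = 0 \/ e *m p = e.
Proof.
move=> pp pb; have pe := block_comm pb.
have [N [X [Y [b0 [[N0 b0u b0i] XY eE bE]]]]] := eb.
have [ee Xe eY] := idem_of XY.
have b0E : b0 = X *m b *m Y.
  by rewrite bE !mulmxA XY mul1mx -mulmxA XY mulmx1.
have epE : e *m p = Y *m (X *m p *m Y) *m X.
  have -> : Y *m (X *m p *m Y) *m X = e *m p *m e by rewrite eE !mulmxA.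
  by rewrite -mulmxA pe mulmxA; have [-> _ _] := block_idem.
have [||p0|p0] := b0i (X *m p *m Y).
- rewrite !mulmxA -(mulmxA _ Y X) -eE -(mulmxA X) pe mulmxA eE Xe.
  by rewrite -(mulmxA X p p) pp.
- rewrite b0E !mulmxA -(mulmxA _ Y X) -eE -(mulmxA X) pe mulmxA {1}eE Xe.
  rewrite -(mulmxA X p b) pb -(mulmxA _ Y X) -eE mulmxA.
  by rewrite -(mulmxA _ e p) -pe mulmxA -(mulmxA _ p e) -(mulmxA _ (p *m e)) -(mulmxA p e) eE eY mulmxA.
- by left; rewrite epE p0 mulmx0 mul0mx.
by right; rewrite epE p0 mulmx1 -eE.
Qed.

End BlockOf.

Section Components.

Variable lam : k.
Hypotheses (lam0 : lam != 0) (lam1 : lam != 1).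

(** The minimal nonzero idempotents e among those for which S contains the matrix
    1 + (lam - 1) e, which is lam on the row space of e and 1 on that of 1 - e. A
    scalar lam other than 0 and 1 exists exactly when q > 2, and this is where that
    hypothesis enters. *)
Definition comps n (S : {set 'M[k]_n}) : {set 'M[k]_n} :=
  [set e | [&& e *m e == e, e != 0, 1%:M + (lam - 1) *: e \in S &
    [forall e', (e' *m e' == e') ==> (1%:M + (lam - 1) *: e' \in S) ==>
       ((e *m e' == e) || (e *m e' == 0))]]].

(** For an idempotent e, membership of 1 + (lam - 1) e in the group says that e
    commutes with the blocks. *)
Lemma idem_torus n (E : {set 'M[k]_n}) beta e : e *m e = e ->
  reflect {in E, forall x, e *m beta x = beta x *m e}
          (1%:M + (lam - 1) *: e \in torus E beta).
Proof.
move=> ee; have l1 : lam - 1 != 0 by rewrite subr_eq0.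
apply: (iffP (torusP _ _ _)) => [[_ gE] x xE|eE].
  have := gE x xE; rewrite mulmxDl mulmxDr mul1mx mulmx1 => /addrI.
  by rewrite -scalemxAl -scalemxAr => /(scalerI l1).
split; last first.
  by move=> x xE; rewrite mulmxDl mulmxDr mul1mx mulmx1 -scalemxAl -scalemxAr eE.
suff : (1%:M + (lam^-1 - 1) *: e) *m (1%:M + (lam - 1) *: e) = 1%:M.
  by case/mulmx1_unit.
rewrite mulmxDl !mulmxDr !mul1mx !mulmx1 -scalemxAl -scalemxAr ee scalerA.
rewrite -addrA -!scalerDl.
have -> : lam - 1 + (lam^-1 - 1 + (lam^-1 - 1) * (lam - 1)) = 0 by field.
by rewrite scale0r addr0.
Qed.

Section OneDatum.

Variables (n : nat) (E : {set 'M[k]_n}) (beta : 'M[k]_n -> 'M[k]_n).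
Hypothesis D : datum E beta.

Lemma datum_orth : {in E &, forall e e', e *m beta e' = if e == e' then beta e' else 0}.
Proof.
have [orth _ blk] := D.
move=> e e' eE e'E; have [ee' eb' be'] := block_idem (blk e' e'E).
case: eqVneq => [->//|ne].
by rewrite -eb' mulmxA (orth e e' eE e'E ne) mul0mx.
Qed.

Lemma datum_orth_r : {in E &, forall e e', beta e' *m e = if e == e' then beta e' else 0}.
Proof.
have [orth _ blk] := D.
move=> e e' eE e'E; have [ee' eb' be'] := block_idem (blk e' e'E).
case: eqVneq => [->//|ne].
by rewrite eq_sym in ne; rewrite -be' -mulmxA (orth e' e e'E eE ne) mulmx0.
Qed.

(** The idempotents of a datum depend only on the group that it defines. *)
Lemma comps_torus : comps (torus E beta) = E.
Proof.
have [orth sumE blk] := D.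
apply/setP => e; rewrite inE; apply/and4P/idP => [[/eqP ee e0 /idem_torus eT /forallP emin]|eE].
  have {}eT := eT ee.
  have [x xE ex0] : exists2 x, x \in E & e *m x != 0.
    have [/existsP [x /andP [xE ex]]|] := boolP [exists x in E, e *m x != 0].
      by exists x.
    rewrite negb_exists_in => /forall_inP all0.
    case/eqP: e0; rewrite -(mulmx1 e) -sumE mulmx_sumr big1 // => x /all0.
    by rewrite negbK => /eqP.
  have [xx xb bx] := block_idem (blk x xE).
  have xT : 1%:M + (lam - 1) *: x \in torus E beta.
    apply/(idem_torus _ _ xx) => y yE; rewrite datum_orth // datum_orth_r //.
  have := emin x; rewrite xx eqxx xT /= (negPf ex0) orbF => /eqP exe.
  have ex := block_comm (blk x xE) (eT x xE).
  have [xe0|xex] := block_dichotomy (blk x xE) ee (eT x xE).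
    by case/eqP: ex0; rewrite ex.
  by rewrite -exe ex xex.
have [ee eb be] := block_idem (blk e eE).
split.
- exact/eqP.
- exact: block_neq0 (blk e eE).
- by apply/(idem_torus _ _ ee) => y yE; rewrite datum_orth // datum_orth_r.
apply/forallP => p; apply/implyP => /eqP pp; apply/implyP => /(idem_torus _ _ pp) pT.
by have [->|->] := block_dichotomy (blk e eE) pp (pT e eE); rewrite eqxx ?orbT.
Qed.

Lemma sum_rank_datum : (\sum_(e in E) \rank e)%N = n.
Proof.
have [orth sumE blk] := D.
have dx : mxdirect (\sum_(e in E) e)%MS.
  apply/mxdirect_sumsP => e eE; apply/eqP; rewrite -submx0.
  apply/rV_subP => u; rewrite sub_capmx => /andP [/submxP [a ->] /sub_sumsmxP [c uc]].
  have [ee _ _] := block_idem (blk e eE).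
  have -> : a *m e = 0.
    rewrite -[e in LHS]ee mulmxA uc mulmx_suml big1 // => x /andP [xE xe].
    by rewrite -mulmxA orth // mulmx0.
  exact: sub0mx.
move/mxdirectP: dx => /= <-.
apply/eqP; rewrite eqn_leq rank_leq_row /= -[X in (X <= _)%N](mxrank1 k n).
by apply: mxrankS; rewrite -sumE; apply: summx_sub_sums.
Qed.

End OneDatum.

Lemma cyc_transport N N1 (b1 : 'M[k]_N1) (U : 'M[k]_(N, N1)) (V : 'M[k]_(N1, N)) :
  cyc b1 -> U *m V = 1%:M -> V *m U = 1%:M -> cyc (U *m b1 *m V).
Proof.
move=> [N10 b1u b1i] UV VU.
have hUV m (A : 'M[k]_(m, N)) : A *m U *m V = A by rewrite -mulmxA UV mulmx1.
have hVU m (A : 'M[k]_(m, N1)) : A *m V *m U = A by rewrite -mulmxA VU mulmx1.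
split.
- case: N U V UV VU {hUV hVU} => // U V UV VU.
  have : (1%:M : 'M[k]_N1) = 0 by rewrite -VU [V]thinmx0 mul0mx.
  move/(congr1 (fun A : 'M_N1 => A (Ordinal N10) (Ordinal N10))).
  by rewrite !mxE eqxx => /eqP; rewrite oner_eq0.
- have E : U *m b1 *m V *m (U *m invmx b1 *m V) = 1%:M.
    by rewrite !mulmxA hVU -(mulmxA U) mulmxV // mulmx1.
  by case/mulmx1_unit: E.
move=> p pp pb; have [||p0|p1] := b1i (V *m p *m U).
- by rewrite !mulmxA hUV -(mulmxA V p p) pp.
- have := congr1 (fun A => V *m A *m U) pb; rewrite /= !mulmxA !hVU VU mul1mx.
  by move=> ->.
- left; rewrite -[p](hUV _ p) -(mul1mx p) -UV -(mulmxA U) -(mulmxA U) p0.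
  by rewrite mulmx0 mul0mx.
right; rewrite -[p](hUV _ p) -(mul1mx p) -UV -(mulmxA U) -(mulmxA U) p1.
by rewrite mulmx1 UV.
Qed.

Section Glue.

Variables (n N N' : nat).
Variables (X : 'M[k]_(N, n)) (Y : 'M[k]_(n, N)) (X' : 'M[k]_(N', n)) (Y' : 'M[k]_(n, N')).
Hypotheses (XY : X *m Y = 1%:M) (X'Y' : X' *m Y' = 1%:M).
Hypotheses (XY' : X *m Y' = 0) (X'Y : X' *m Y = 0).
Hypothesis YX1 : Y *m X + Y' *m X' = 1%:M.

(* The rows of X and X' are bases of complementary subspaces of k^n, with dual
   bases Y and Y'. *)

Let hXY m (A : 'M[k]_(m, N)) : A *m X *m Y = A.
Proof. by rewrite -mulmxA XY mulmx1. Qed.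
Let hX'Y' m (A : 'M[k]_(m, N')) : A *m X' *m Y' = A.
Proof. by rewrite -mulmxA X'Y' mulmx1. Qed.
Let hXY' m (A : 'M[k]_(m, N)) : A *m X *m Y' = 0.
Proof. by rewrite -mulmxA XY' mulmx0. Qed.
Let hX'Y m (A : 'M[k]_(m, N')) : A *m X' *m Y = 0.
Proof. by rewrite -mulmxA X'Y mulmx0. Qed.

Let glueE := (hXY, hX'Y', hXY', hX'Y, XY, X'Y', XY', X'Y, mul0mx, mulmx0, mul1mx, mulmx1, addr0, add0r).

(** The block-diagonal matrix with blocks g and h in the decomposition given by X, X'. *)
Definition glue_mx (g : 'M[k]_N) (h : 'M[k]_N') := Y *m g *m X + Y' *m h *m X'.

(** The block-diagonal matrices with blocks in B and S. *)
Definition glue (B : {set 'M[k]_N}) (S : {set 'M[k]_N'}) : {set 'M[k]_n} :=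
  [set glue_mx g h | g in B, h in S].

Lemma glue_mx_ul g h : X *m glue_mx g h *m Y = g.
Proof. by rewrite /glue_mx mulmxDr mulmxDl !mulmxA !glueE. Qed.

Lemma glue_mx_dr g h : X' *m glue_mx g h *m Y' = h.
Proof. by rewrite /glue_mx mulmxDr mulmxDl !mulmxA !glueE. Qed.

Lemma glue_mxM g h g' h' : glue_mx g h *m glue_mx g' h' = glue_mx (g *m g') (h *m h').
Proof. by rewrite /glue_mx !(mulmxDr, mulmxDl) !mulmxA !glueE. Qed.

Lemma glue_mx1 : glue_mx 1%:M 1%:M = 1%:M.
Proof. by rewrite /glue_mx !mulmx1. Qed.

Lemma glue_mx_split g : g *m (Y *m X) = Y *m X *m g -> g = glue_mx (X *m g *m Y) (X' *m g *m Y').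
Proof.
move=> ge.
have ge' : g *m (Y' *m X') = Y' *m X' *m g.
  have -> : Y' *m X' = 1%:M - Y *m X by rewrite -YX1 addrC addKr.
  by rewrite mulmxBl mulmxBr ge mul1mx mulmx1.
have -> : glue_mx (X *m g *m Y) (X' *m g *m Y') = Y *m X *m g *m (Y *m X) + Y' *m X' *m g *m (Y' *m X').
  by rewrite /glue_mx !mulmxA.
rewrite -(mulmxA _ g) ge -(mulmxA _ g (Y' *m X')) ge' !mulmxA !glueE -mulmxDl YX1.
by rewrite mul1mx.
Qed.

Lemma glue_mx_unit g h : (glue_mx g h \in unitmx) = (g \in unitmx) && (h \in unitmx).
Proof.
apply/idP/andP => [u|[gu hu]].
  have ge : glue_mx g h *m (Y *m X) = Y *m X *m glue_mx g h.
    by rewrite /glue_mx !(mulmxDr, mulmxDl) !mulmxA !glueE.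
  set G := glue_mx g h in u ge *.
  have iGe : invmx G *m (Y *m X) = Y *m X *m invmx G.
    apply: (can_inj (mulKmx u)); rewrite mulKVmx // (mulmxA G) ge.
    by rewrite -(mulmxA _ G) mulmxV // mulmx1.
  have := mulmxV u; rewrite {1}/G (glue_mx_split iGe) glue_mxM => E.
  have Eg := congr1 (fun A => X *m A *m Y) E; have Eh := congr1 (fun A => X' *m A *m Y') E.
  rewrite /= glue_mx_ul in Eg; rewrite /= glue_mx_dr in Eh.
  rewrite mulmx1 XY in Eg; rewrite mulmx1 X'Y' in Eh.
  by case/mulmx1_unit: Eg => -> _; case/mulmx1_unit: Eh => -> _.
have : glue_mx g h *m glue_mx (invmx g) (invmx h) = 1%:M.
  by rewrite glue_mxM !mulmxV // glue_mx1.
by case/mulmx1_unit.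
Qed.

Lemma glue_inj (B B2 : {set 'M[k]_N}) (S S2 : {set 'M[k]_N'}) : 
  1%:M \in B -> 1%:M \in S -> 1%:M \in B2 -> 1%:M \in S2 ->
  glue B S = glue B2 S2 -> B = B2 /\ S = S2.
Proof.
have rec_l (B0 : {set 'M[k]_N}) (S0 : {set 'M[k]_N'}) : 1%:M \in S0 -> B0 = [set X *m g *m Y | g in glue B0 S0].
  move=> S1; apply/setP => g; apply/idP/imsetP => [gB|[_ /imset2P [g' h gB hS ->] ->]].
    by exists (glue_mx g 1%:M); rewrite ?glue_mx_ul //; apply/imset2P; exists g 1%:M.
  by rewrite glue_mx_ul.
have rec_r (B0 : {set 'M[k]_N}) (S0 : {set 'M[k]_N'}) : 1%:M \in B0 -> S0 = [set X' *m g *m Y' | g in glue B0 S0].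
  move=> S1; apply/setP => g; apply/idP/imsetP => [gB|[_ /imset2P [g' h gB hS ->] ->]].
    by exists (glue_mx 1%:M g); rewrite ?glue_mx_dr //; apply/imset2P; exists 1%:M g.
  by rewrite glue_mx_dr.
move=> B1 S1 B21 S21 E; split.
  by rewrite (rec_l B S S1) E -(rec_l B2 S2 S21).
by rewrite (rec_r B S B1) E -(rec_r B2 S2 B21).
Qed.

Section GlueDatum.

Variables (b0 : 'M[k]_N) (E' : {set 'M[k]_N'}) (beta' : 'M[k]_N' -> 'M[k]_N').
Hypotheses (b0c : cyc b0) (D' : datum E' beta').

(** Adding to a datum on the second summand one block on the first: the idempotents,
    and the blocks on them. *)
Definition glue_idems : {set 'M[k]_n} := (Y *m X) |: [set Y' *m x *m X' | x in E'].
Definition glue_gens (x : 'M[k]_n) : 'M[k]_n :=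
  if x == Y *m X then Y *m b0 *m X else Y' *m beta' (X' *m x *m Y') *m X'.

Lemma glue_block_ul : block_of (Y *m X) (Y *m b0 *m X).
Proof. by exists N, X, Y, b0. Qed.

Lemma glue_idem_neq x : (Y' *m x *m X' == Y *m X) = false.
Proof.
apply/eqP => E.
have := block_neq0 glue_block_ul.
have [ee _ _] := idem_of XY.
by rewrite -ee -{1}E !mulmxA !glueE eqxx.
Qed.

Lemma glue_gens_dr x : glue_gens (Y' *m x *m X') = Y' *m beta' x *m X'.
Proof. by rewrite /glue_gens glue_idem_neq !mulmxA !glueE. Qed.

Lemma glue_gens_ul : glue_gens (Y *m X) = Y *m b0 *m X.
Proof. by rewrite /glue_gens eqxx. Qed.

Lemma glue_datum : datum glue_idems glue_gens.
Proof.
have [orth sumE blk] := D'.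
split.
- move=> e e' /setU1P [->|/imsetP [x xE ->]] /setU1P [->|/imsetP [x' x'E ->]].
  + by rewrite eqxx.
  + by rewrite !mulmxA !glueE.
  + by rewrite !mulmxA !glueE.
  move=> ne; rewrite !mulmxA !glueE -(mulmxA Y') (orth x x' xE x'E) ?mulmx0 ?mul0mx //.
  by apply: contra ne => /eqP ->.
- rewrite big_setU1 /=; last first.
    by apply/negP => /imsetP [x _] /esym/eqP; rewrite glue_idem_neq.
  rewrite big_imset /=; last first.
    move=> x x' _ _ /(congr1 (fun A => X' *m A *m Y')) /=.
    by rewrite !mulmxA !glueE.
  by rewrite -mulmx_suml -mulmx_sumr sumE mulmx1.
move=> e /setU1P [->|/imsetP [x xE ->]].
  by rewrite glue_gens_ul; apply: glue_block_ul.
rewrite glue_gens_dr; have [N1 [X1 [Y1 [b1 [b1c X1Y1 xE1 ->]]]]] := blk x xE.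
exists N1, (X1 *m X'), (Y' *m Y1), b1; split=> //.
- by rewrite mulmxA glueE.
- by rewrite xE1 !mulmxA.
by rewrite !mulmxA.
Qed.

Lemma glue_torus : torus glue_idems glue_gens = glue (centGL b0) (torus E' beta').
Proof.
apply/setP => g; apply/torusP/imset2P => [[gu gE]|[g0 h + /torusP [hu hE] ->]].
  have eE : Y *m X \in glue_idems by rewrite finset.setU11.
  have gb := gE _ eE; rewrite glue_gens_ul in gb.
  have ge := block_comm glue_block_ul gb.
  have gsp := glue_mx_split ge.
  set g0 := X *m g *m Y in gsp; set h := X' *m g *m Y' in gsp.
  have := gu; rewrite gsp glue_mx_unit => /andP [g0u hu].
  exists g0 h => //.
    rewrite !inE g0u /=; apply/eqP.
    have := congr1 (fun A => X *m A *m Y) gb; rewrite gsp /glue_mx /=.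
    by rewrite !(mulmxDr, mulmxDl) !mulmxA !glueE.
  apply/torusP; split=> // x xE.
  have xE2 : Y' *m x *m X' \in glue_idems by apply/setU1P; right; apply/imsetP; exists x.
  have := gE _ xE2; rewrite glue_gens_dr => /(congr1 (fun A => X' *m A *m Y')).
  by rewrite gsp /glue_mx /= !(mulmxDr, mulmxDl) !mulmxA !glueE.
rewrite !inE => /andP [g0u /eqP g0b].
rewrite glue_mx_unit g0u hu; split=> // e /setU1P [->|/imsetP [x xE ->]].
  rewrite glue_gens_ul /glue_mx !(mulmxDr, mulmxDl) !mulmxA !glueE.
  by rewrite -(mulmxA Y) g0b mulmxA.
rewrite glue_gens_dr /glue_mx !(mulmxDr, mulmxDl) !mulmxA !glueE.
by rewrite -(mulmxA Y') hE // mulmxA.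
Qed.

End GlueDatum.

Section Unglue.

Variables (E : {set 'M[k]_n}) (beta : 'M[k]_n -> 'M[k]_n).
Hypotheses (D : datum E beta) (eE : Y *m X \in E).

(** Removing the block with idempotent Y X from a datum: the remaining idempotents and
    blocks, in coordinates on the second summand. *)
Definition unglue_idems : {set 'M[k]_N'} := [set X' *m x *m Y' | x in E :\ (Y *m X)].
Definition unglue_gens (y : 'M[k]_N') : 'M[k]_N' := X' *m beta (Y' *m y *m X') *m Y'.

Lemma unglue_neg x : x \in E :\ (Y *m X) ->
  [/\ Y' *m X' *m x = x, x *m (Y' *m X') = x, X *m x = 0 & x *m Y = 0].
Proof.
have [orth _ _] := D.
move=> /setD1P [ne xE].
have E1 : Y' *m X' = 1%:M - Y *m X by rewrite -YX1 addrC addKr.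
have ex : Y *m X *m x = 0 by apply: orth => //; rewrite eq_sym.
have xe : x *m (Y *m X) = 0 by apply: orth.
split.
- by rewrite E1 mulmxBl ex subr0 mul1mx.
- by rewrite E1 mulmxBr xe subr0 mulmx1.
- by rewrite -(mul1mx (X *m x)) -XY -mulmxA (mulmxA Y) ex mulmx0.
by rewrite -(mulmx1 (x *m Y)) -XY mulmxA -(mulmxA x) xe mul0mx.
Qed.

Lemma unglue_cyc : cyc (X *m beta (Y *m X) *m Y).
Proof.
have [_ _ blk] := D; have [N1 [X1 [Y1 [b1 [b1c X1Y1 e1 ->]]]]] := blk _ eE.
have := @cyc_transport N N1 b1 (X *m Y1) (X1 *m Y) b1c.
rewrite !mulmxA; apply.
  by rewrite -(mulmxA X) -e1 !mulmxA !glueE.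
by rewrite -(mulmxA X1) e1 !mulmxA X1Y1 mul1mx.
Qed.

Lemma unglueK x : x \in E :\ (Y *m X) -> Y' *m (X' *m x *m Y') *m X' = x.
Proof.
move=> /unglue_neg [h1 h2 _ _].
by rewrite !mulmxA h1 -mulmxA h2.
Qed.

Lemma unglue_datum : datum unglue_idems unglue_gens.
Proof.
have [orth sumE blk] := D.
split.
- move=> _ _ /imsetP [x xE ->] /imsetP [y yE ->] ne.
  have [h1 h2 _ _] := unglue_neg xE.
  have -> : X' *m x *m Y' *m (X' *m y *m Y') = X' *m (x *m (Y' *m X') *m y) *m Y'.
    by rewrite !mulmxA.
  have /setD1P [_ xE'] := xE; have /setD1P [_ yE'] := yE.
  rewrite h2 (orth x y) ?mulmx0 ?mul0mx //.
  by apply: contra ne => /eqP ->.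
- rewrite big_imset /=; last first.
    by move=> x y xE yE /= E0; rewrite -(unglueK xE) E0 (unglueK yE).
  rewrite -mulmx_suml -mulmx_sumr.
  have -> : \sum_(x in E :\ (Y *m X)) x = 1%:M - Y *m X.
    by apply/eqP; rewrite eq_sym subr_eq -sumE (big_setD1 _ eE) /= addrC.
  by rewrite mulmxBr mulmxBl mulmx1 !mulmxA !glueE oppr0 addr0.
move=> _ /imsetP [x xE ->]; rewrite /unglue_gens unglueK //.
have /setD1P [_ xE'] := xE.
have [h1 h2 h3 h4] := unglue_neg xE.
have [N1 [X1 [Y1 [b1 [b1c X1Y1 e1 ->]]]]] := blk x xE'.
exists N1, (X1 *m Y'), (X' *m Y1), b1; split=> //.
- have [_ X1x xY1] := idem_of X1Y1; rewrite -e1 in X1x xY1.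
  by rewrite -{1}X1x -{1}xY1 !mulmxA -(mulmxA _ Y' X') -(mulmxA X1 x) h2 X1x -(mulmxA X1) xY1.
- by rewrite e1 !mulmxA.
by rewrite !mulmxA.
Qed.

Lemma unglue_torus :
  torus E beta = glue (centGL (X *m beta (Y *m X) *m Y)) (torus unglue_idems unglue_gens).
Proof.
have [orth sumE blk] := D.
rewrite -(glue_torus _ _ unglue_cyc).
have EE : glue_idems unglue_idems = E.
  rewrite -[RHS](finset.setD1K eE) /glue_idems; congr (_ :|: _).
  rewrite -imset_comp -[RHS]imset_id; apply: eq_in_imset => x xE /=.
  exact: unglueK.
rewrite /torus EE; apply/setP => g; rewrite !inE; congr (_ && _).
apply: eq_forallb_in => x xE.
suff -> : glue_gens (X *m beta (Y *m X) *m Y) unglue_gens x = beta x by [].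
rewrite /glue_gens; case: eqP => [->|/eqP ne].
  have [ee eb be] := block_idem (blk _ eE).
  by rewrite !mulmxA eb -mulmxA be.
have xE2 : x \in E :\ (Y *m X) by apply/setD1P.
rewrite /unglue_gens (unglueK xE2).
have [h1 h2 _ _] := unglue_neg xE2.
have [ee eb be] := block_idem (blk _ xE).
by rewrite !mulmxA -{1}eb (mulmxA _ x) h1 eb -{1}be -!mulmxA h2 be.
Qed.

End Unglue.

(** The groups that have Y X among their idempotents correspond to pairs formed by
    a centraliser in dimension N and a group in dimension N'. *)
Lemma card_calAm_idem :
  #|[set S in calAm n | Y *m X \in comps S]| = (#|Icyc k N| * #|calAm N'|)%N.
Proof.
rewrite -cardsX.
pose Phi (p : {set 'M[k]_N} * {set 'M[k]_N'}) := glue p.1 p.2.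
have one_c (b0 : 'M[k]_N) : 1%:M \in centGL b0 by rewrite !inE unitmx1 mul1mx mulmx1 eqxx.
rewrite -(card_in_imset (f := Phi) (D := mem (finset.setX (Icyc k N) (calAm N')))); last first.
  move=> [B S] [B2 S2]; rewrite !inE /=.
  move=> /andP [/imsetP [b _ ->] /asboolP [E [beta [_ ->]]]].
  move=> /andP [/imsetP [b2 _ ->] /asboolP [E2 [beta2 [_ ->]]]].
  by rewrite /Phi /= => /glue_inj [||||-> ->] //; apply: one_torus.
apply: eq_card => S; rewrite inE [S \in calAm n]inE; apply/andP/imsetP.
  move=> [/asboolP [E [beta [D ->]]]]; rewrite (comps_torus D) => eE.
  exists (centGL (X *m beta (Y *m X) *m Y), torus (unglue_idems E) (unglue_gens beta)).
    rewrite !inE /=; apply/andP; split.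
      apply: imset_f; rewrite inE; apply/asboolP.
      exact: unglue_cyc D eE.
    by apply/asboolP; exists (unglue_idems E), (unglue_gens beta); split=> //; apply: unglue_datum.
  exact: unglue_torus.
move=> [[B S']] /finset.setXP /= [/imsetP [b + ->] +] ->.
rewrite [b \in _]inE => /asboolP bc; rewrite [S' \in _]inE => /asboolP [E [beta [D ->]]].
rewrite /Phi /= -(glue_torus E beta bc).
have Dg := glue_datum bc D.
split; first by apply/asboolP; exists (glue_idems E), (glue_gens b beta).
by rewrite (comps_torus Dg) finset.setU11.
Qed.

End Glue.

(** The idempotents of a group in calAm have ranks that add up to n. *)
Lemma card_calAm_sum n :
  (n * #|calAm n| = \sum_(e : 'M[k]_n) \rank e * #|[set S in calAm n | e \in comps S]|)%N.
Proof.
rewrite mulnC -sum_nat_const.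
transitivity (\sum_(S in calAm n) \sum_(e in comps S) \rank e)%N.
  apply: eq_bigr => S; rewrite inE => /asboolP [E [beta [D ->]]].
  by rewrite (comps_torus D) (sum_rank_datum D).
rewrite (exchange_big_dep predT) //=; apply: eq_bigr => e _.
by rewrite -sum1_card big_distrr /=; apply: eq_big => S; rewrite ?inE ?muln1.
Qed.

Lemma idem_factor n (e : 'M[k]_n) : e *m e = e ->
  forall N, \rank e = N ->
  exists (X : 'M[k]_(N, n)) (Y : 'M[k]_(n, N)), X *m Y = 1%:M /\ Y *m X = e.
Proof.
move=> ee N <-.
have ce : e *m pinvmx (row_base e) *m row_base e = e.
  by rewrite mulmxKpV // eq_row_base.
exists (row_base e), (e *m pinvmx (row_base e)); split=> //.
have re : row_base e *m e = row_base e.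
  have /submxP [a ->] : (row_base e <= e)%MS by rewrite eq_row_base.
  by rewrite -mulmxA ee.
by rewrite mulmxA re mulmxVp // row_base_free.
Qed.

Lemma idem_split n (e : 'M[k]_n) N N' : e *m e = e -> \rank e = N -> (n = N + N')%N ->
  exists (X : 'M[k]_(N, n)) (Y : 'M[k]_(n, N)) (X' : 'M[k]_(N', n)) (Y' : 'M[k]_(n, N')),
    [/\ X *m Y = 1%:M, X' *m Y' = 1%:M, X *m Y' = 0, X' *m Y = 0 &
        Y *m X + Y' *m X' = 1%:M /\ Y *m X = e].
Proof.
move=> ee rN nN; set f := 1%:M - e.
have ef : e *m f = 0 by rewrite mulmxBr mulmx1 ee subrr.
have fe : f *m e = 0 by rewrite mulmxBl mul1mx ee subrr.
have ff : f *m f = f by rewrite {1}/f mulmxBl mul1mx ef subr0.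
have rf : \rank f = N'.
  have h1 := mulmx0_rank_max ef.
  have h2 : (n <= \rank e + \rank f)%N.
    rewrite -[X in (X <= _)%N](mxrank1 k n) -[1%:M](subrKC e) -/f.
    exact: mxrank_add.
  by lia.
have [X [Y [XY YX]]] := idem_factor ee rN.
have [X' [Y' [X'Y' Y'X']]] := idem_factor ff rf.
exists X, Y, X', Y'.
have [_ Xe eY] := idem_of XY; have [_ X'f fY'] := idem_of X'Y'.
rewrite YX in Xe eY; rewrite Y'X' in X'f fY'.
split=> //.
- by rewrite -Xe -fY' -mulmxA (mulmxA e) ef mul0mx mulmx0.
- by rewrite -X'f -eY -mulmxA (mulmxA f) fe mul0mx mulmx0.
by rewrite YX Y'X' subrKC.
Qed.

(** The idempotents of rank N in dimension N + N' form one conjugacy class, with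
    centraliser the product of two general linear groups. *)
Lemma card_idem N N' :
  (#|[set e : 'M[k]_(N + N') | (e *m e == e) && (\rank e == N)]|
    * (#|GLmx N| * #|GLmx N'|) = #|GLmx (N + N')|)%N.
Proof.
pose c : 'M[k]_(N + N') := block_mx 1%:M 0 0 0.
have rc : \rank c = N.
  by rewrite /c -pid_mx_block rank_pid_mx ?leq_addr // leq_addr.
have cc : c *m c = c.
  by rewrite /c mulmx_block !(mulmx0, mul0mx, mulmx1, addr0).
rewrite -(card_conj_class c); congr (_ * _)%N; last first.
  rewrite -cardsX -(card_in_imset (f := fun p => block_mx p.1 0 0 p.2 : 'M[k]_(N + N'))
     (D := mem (finset.setX (GLmx N) (GLmx N')))); last first.
    by move=> [g h] [g' h'] _ _ /= /eq_block_mx [-> _ _ ->].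
  apply: eq_card => g; rewrite !inE; apply/imsetP/andP => [[[a d]]|[gu /eqP gc]].
    rewrite !inE /= => /andP [au du] ->; split.
      by rewrite unitmxE det_ublock unitrM -!unitmxE au.
    by rewrite /c !mulmx_block !(mulmx0, mul0mx, mulmx1, mul1mx, addr0).
  move: gu gc; rewrite -[g]submxK /c.
  set a := ulsubmx g; set b := ursubmx g; set a' := dlsubmx g; set d := drsubmx g.
  rewrite !mulmx_block !(mulmx0, mul0mx, mulmx1, mul1mx, addr0) => gu.
  move=> /eq_block_mx [_ b0 a'0 _]; exists (a, d); last by rewrite a'0 -b0.
  by move: gu; rewrite a'0 -b0 unitmxE det_ublock unitrM -!unitmxE !inE.
apply: eq_card => e; rewrite inE; apply/andP/imsetP => [[/eqP ee /eqP re]|[P Pu ->]].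
  have [X [Y [X' [Y' [XY X'Y' XY' X'Y [YX1 YXe]]]]]] := idem_split ee re erefl.
  have PQ : row_mx Y Y' *m col_mx X X' = 1%:M by rewrite mul_row_col.
  have [_ Pu] := mulmx1_unit PQ.
  exists (col_mx X X'); first by rewrite inE.
  have -> : invmx (col_mx X X') = row_mx Y Y'.
    by rewrite -[LHS]mul1mx -PQ mulmxK.
  by rewrite -mulmxA /c mul_block_col mul_row_col !(mul0mx, mul1mx, mulmx0, addr0).
rewrite inE in Pu; split; last first.
  have fP : row_full (invmx P) by rewrite row_full_unit unitmx_inv.
  by rewrite mxrankMfree ?row_free_unit // (eqmxMfull c fP) rc.
by rewrite -!mulmxA mulKVmx // (mulmxA c) cc.
Qed.

Lemma GLmx_card_gt0 n : (0 < #|GLmx n|)%N.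
Proof. by apply/card_gt0P; exists 1%:M; rewrite inE unitmx1. Qed.

Lemma calAm_recursion (K : numFieldType) n :
  n%:R * (#|calAm n|%:R / #|GLmx n|%:R) =
  \sum_(N < n.+1) N%:R * (#|Icyc k N|%:R / #|GLmx N|%:R)
     * (#|calAm (n - N)|%:R / #|GLmx (n - N)|%:R) :> K.
Proof.
rewrite mulrA -natrM card_calAm_sum natr_sum mulr_suml.
pose rk (e : 'M[k]_n) : 'I_n.+1 := inord (\rank e).
have rkE e : rk e = \rank e :> nat by rewrite inordK // ltnS rank_leq_row.
rewrite (partition_big rk predT) //=; apply: eq_bigr => N _.
have nN : (n = N + (n - N))%N by rewrite subnKC // -ltnS.
pose Id := [set e : 'M[k]_n | (e *m e == e) && (\rank e == N)].
transitivity (\sum_(e in Id) (N * (#|Icyc k N| * #|calAm (n - N)|))%N%:R / #|GLmx n|%:R : K).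
  rewrite [LHS]big_mkcond [RHS]big_mkcond; apply: eq_bigr => e _.
  rewrite inE -val_eqE /= rkE; case: eqP => [rN|_]; last by rewrite andbF.
  rewrite andbT; case: eqP => [ee|nee]; last first.
    suff -> : #|[set S in calAm n | e \in comps S]| = 0%N by rewrite muln0 mul0r.
    apply/eqP; rewrite cards_eq0; apply/eqP/setP => S; rewrite !inE.
    by case: eqP => //; rewrite andbF.
  have [X [Y [X' [Y' [XY X'Y' XY' X'Y [YX1 YXe]]]]]] := idem_split ee rN nN.
  by rewrite rN -YXe (card_calAm_idem XY X'Y' XY' X'Y YX1).
rewrite sumr_const -mulr_natr.
have := card_idem N (n - N); rewrite -nN -/Id => cI.
rewrite -cI !natrM.
have G1 : #|GLmx N|%:R != 0 :> K by rewrite pnatr_eq0 -lt0n GLmx_card_gt0.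
have G2 : #|GLmx (n - N)|%:R != 0 :> K by rewrite pnatr_eq0 -lt0n GLmx_card_gt0.
have I0 : #|Id|%:R != 0 :> K.
  apply/eqP => /eqP; rewrite pnatr_eq0 => /eqP I0.
  by have := GLmx_card_gt0 n; rewrite -cI I0.
by field; rewrite G1 G2 I0.
Qed.

End Components.

Lemma card_calAm0 : #|calAm 0| = 1%N.
Proof.
have all0 (A B : 'M[k]_0) : A = B by apply/matrixP => -[].
rewrite -(cards1 (torus finset.set0 (fun x : 'M[k]_0 => x))); apply: eq_card => S.
have tE (E : {set 'M[k]_0}) beta : torus E beta = torus finset.set0 (fun x : 'M[k]_0 => x).
  apply/setP => g; apply/torusP/torusP => -[gu _]; split=> // e _; apply: all0.
rewrite !inE; apply/asboolP/eqP => [[E [beta [_ ->]]]|->]; first exact: tE.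
exists finset.set0, id; split; last exact: tE.
split; [by move=> e e'; rewrite inE | exact: all0 | by move=> e; rewrite inE].
Qed.

End Recursion.

(** * Groups of matrices and subgroups of the general linear group *)

Section BlockCommutant.

Variable k : finFieldType.

(** The commutant of a block is commutative on its support; hence a torus is abelian. *)
Lemma block_comm2 n (e b y z : 'M[k]_n) : block_of e b ->
  y *m b = b *m y -> z *m b = b *m z -> e *m y *m z = e *m z *m y.
Proof.
move=> blk yb zb.
have ye := block_comm blk yb; have ze := block_comm blk zb.
have [ee eb be] := block_idem blk.
have [N [X [Y [b0 [b0c XY eYX bYX]]]]] := blk.
have [_ Xe eY] := idem_of XY; rewrite -eYX in Xe eY.
have b0E : b0 = X *m b *m Y by rewrite bYX !mulmxA XY mul1mx -mulmxA XY mulmx1.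
have prod (u v : 'M[k]_n) : u *m e = e *m u -> X *m u *m Y *m (X *m v *m Y) = X *m (u *m v) *m Y.
  by move=> ue; rewrite !mulmxA -(mulmxA _ Y X) -eYX -(mulmxA X u e) ue mulmxA Xe.
have red u : u *m e = e *m u -> u *m b = b *m u -> X *m u *m Y *m b0 = b0 *m (X *m u *m Y).
  by move=> ue ub; rewrite b0E !prod ?ub // be eb.
have E : X *m (y *m z) *m Y = X *m (z *m y) *m Y.
  rewrite -!prod //; move: (red y ye yb) (red z ze zb).
  move: (X *m y *m Y) (X *m z *m Y) => y0 z0 y0b z0b.
  case: b0c => N0 b0u b0i {prod red b0E}.
  case: N N0 X Y b0 b0u b0i y0 z0 y0b z0b {XY eYX bYX Xe eY} => // N _ X Y b0 _ b0i y0 z0 y0b z0b.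
  have [f [r [f_irr _ r0 bf sz]]] := idem_indecomposable_minpoly b0i.
  have kc := kcyclic_minpoly f_irr r0 bf sz.
  have [gy ->] := kcyclic_comm kc y0b; have [gz ->] := kcyclic_comm kc z0b.
  exact: comm_horner_mx2.
have full u v : u *m e = e *m u -> v *m e = e *m v -> e *m u *m v = Y *m (X *m (u *m v) *m Y) *m X.
  move=> ue ve; have -> : Y *m (X *m (u *m v) *m Y) *m X = (Y *m X) *m u *m v *m (Y *m X).
    by rewrite !mulmxA.
  by rewrite -eYX -(mulmxA _ v) ve mulmxA -(mulmxA e u e) ue mulmxA ee.
by rewrite (full y z) // (full z y) // E.
Qed.

End BlockCommutant.

Section Bridge.

Variables (k : finFieldType) (m : nat).
Local Notation n := m.+1.
Local Notation gT := {'GL_m.+1[k]}.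

(** The matrix of an element of the general linear group. *)
Definition GLmat (g : gT) : 'M[k]_n := GLval g.

Lemma GLmat_inj : injective GLmat. Proof. exact: val_inj. Qed.

Lemma GLmatM (g h : gT) : GLmat (g * h)%g = GLmat g *m GLmat h.
Proof. exact: (GL_MxE g h). Qed.

Lemma GLmat1 : GLmat 1%g = 1%:M. Proof. exact: (GL_1E m.+1 k). Qed.

Lemma GLmat_unit (g : gT) : GLmat g \in unitmx. Proof. exact: (GL_unit g). Qed.

Lemma GLmat_surj (x : 'M[k]_n) : x \in unitmx -> exists g : gT, GLmat g = x.
Proof. by move=> xu; exists (FinRing.Unit xu). Qed.

Lemma card_GL : #|'GL_m.+1[k]%g| = #|GLmx k n|.
Proof.
rewrite -(card_imset _ GLmat_inj); apply: eq_card => x; rewrite [x \in GLmx _ _]inE.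
apply/imsetP/idP => [[g _ ->]|/GLmat_surj [g <-]]; first exact: GLmat_unit.
by exists g; rewrite // inE.
Qed.

Lemma mxmodule_natural (A : {group gT}) (U : 'M[k]_n) :
  reflect {in A, forall g, (U *m GLmat g <= U)%MS} (mxmodule (natural_repr A) U).
Proof. exact: (mxmoduleP (rG := natural_repr A)). Qed.

Lemma mxmodule_cycle (a : gT) (U : 'M[k]_n) :
  mxmodule (natural_repr <[a]>) U = (U *m GLmat a <= U)%MS.
Proof.
apply/mxmodule_natural/idP => [H|Ua]; first by apply: H; apply: cycle_id.
move=> _ /cycleP [i ->]; elim: i => [|i IH]; first by rewrite expg0 GLmat1 mulmx1.
by rewrite expgS GLmatM mulmxA (submx_trans (submxMr _ Ua)).
Qed.

(** The spaces V i are the row spaces of a complete system of orthogonal idempotents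
    e i, and a i is an element of the corresponding factor GL(V i). *)
Section Family.

Variables (r : nat) (V e : 'I_r -> 'M[k]_n).
Hypothesis Ve : forall i, (V i :=: e i)%MS.
Hypothesis orth : forall i j, e i *m e j = if i == j then e i else 0.
Hypothesis sume : \sum_i e i = 1%:M.

Lemma row_stab (g : 'M[k]_n) j : (V j *m g == V j) = (e j *m g == e j).
Proof.
have [c eV] : exists c, e j = c *m V j by apply/submxP; rewrite Ve.
have [d Vd] : exists d, V j = d *m e j by apply/submxP; rewrite Ve.
apply/eqP/eqP => E; first by rewrite eV -mulmxA E.
by rewrite Vd -mulmxA E.
Qed.

(** GL(V i) consists of the elements that commute with all the idempotents and fix
    the rows of e j for j different from i. *)
Lemma GLsummandP i (g : gT) :
  reflect ((forall j, j != i -> e j *m GLmat g = e j) /\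
           (forall j, GLmat g *m e j = e j *m GLmat g))
          (g \in GLsummand V i).
Proof.
have gi : (g \in GLsummand V i) = (V i *m GLmat g <= V i)%MS &&
    [forall j, (j != i) ==> (e j *m GLmat g == e j)].
  rewrite !inE /=; congr (_ && _).
  apply/bigcapP/forall_inP => H j ji.
    by rewrite -row_stab; have := H j ji; rewrite !inE.
  by rewrite !inE /= row_stab H.
rewrite gi; apply: (iffP andP) => [[sV /forall_inP sj]|[sj sc]].
  have {}sj j : j != i -> e j *m GLmat g = e j by move=> /sj/eqP.
  split=> // j.
  have ege : e i *m GLmat g *m e i = e i *m GLmat g.
    have /submxP [c ->] : (e i *m GLmat g <= e i)%MS.
      by rewrite -(eqmxMr _ (Ve i)) -(Ve i).
    by rewrite -mulmxA orth eqxx.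
  have E : GLmat g *m e j = \sum_l e l *m GLmat g *m e j.
    by rewrite -!mulmx_suml sume mul1mx.
  rewrite E (bigD1 i) //= (eq_bigr (fun l => e l *m e j)); last by move=> l /sj ->.
  have [->|ji] := eqVneq j i.
    by rewrite ege big1 ?addr0 // => l /negPf li; rewrite orth li.
  rewrite -ege -mulmxA orth eq_sym (negPf ji) mulmx0 add0r (bigD1 j) //=.
  rewrite orth eqxx big1 ?addr0 ?sj // => l /andP [_ /negPf lj].
  by rewrite orth lj.
split; last by apply/forall_inP => j ji; rewrite sj.
by rewrite Ve (eqmxMr _ (Ve i)) -sc submxMl.
Qed.

Variable a : 'I_r -> gT.
Hypothesis aV : forall i, a i \in GLsummand V i.

Lemma summand_elt_comm i j : GLmat (a i) *m e j = e j *m GLmat (a i).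
Proof. by have /GLsummandP [_ H] := aV i; apply: H. Qed.

(** The elements that commute with all e i and with all blocks e i a i. *)
Definition torus_set : {set gT} :=
  [set g : gT | [forall i, (GLmat g *m e i == e i *m GLmat g) &&
     (GLmat g *m (e i *m GLmat (a i)) == e i *m GLmat (a i) *m GLmat g)]].

Lemma torus_setP (g : gT) :
  reflect (forall i, GLmat g *m e i = e i *m GLmat g /\
     GLmat g *m (e i *m GLmat (a i)) = e i *m GLmat (a i) *m GLmat g) (g \in torus_set).
Proof.
rewrite inE; apply: (iffP forallP) => H i; have := H i.
  by case/andP => /eqP ? /eqP.
by case=> -> ->; rewrite !eqxx.
Qed.

Lemma torus_set_group : group_set torus_set.
Proof.
apply/group_setP; split.
  by apply/torus_setP => i; rewrite GLmat1 !(mul1mx, mulmx1).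
move=> g h /torus_setP gT1 /torus_setP hT1; apply/torus_setP => i.
have [g1 g2] := gT1 i; have [h1 h2] := hT1 i.
rewrite !GLmatM; split; first by rewrite -mulmxA h1 mulmxA g1 mulmxA.
by rewrite -mulmxA h2 mulmxA g2 mulmxA.
Qed.

(** The commutant of all the blocks e i a i, as a group. *)
Definition torus_group : {group gT} := Group torus_set_group.

Local Notation B i := 'C_(GLsummand V i)[a i]%G.

Lemma block_centP i g : g \in B i ->
  [/\ forall j, j != i -> e j *m GLmat g = e j,
      forall j, GLmat g *m e j = e j *m GLmat g &
      GLmat g *m GLmat (a i) = GLmat (a i) *m GLmat g].
Proof.
case/setIP => /GLsummandP [g1 g2] /cent1P ga; split=> //.
by rewrite -!GLmatM ga.
Qed.

Lemma block_sub_torus i : B i \subset torus_group.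
Proof.
apply/fintype.subsetP => g /block_centP [g1 g2 g3]; apply/torus_setP => j; split=> //.
have [->|ji] := eqVneq j i.
  by rewrite mulmxA g2 -!mulmxA g3.
by rewrite mulmxA g2 g1 // -summand_elt_comm -mulmxA g1.
Qed.

Lemma block_comm_block i j : i != j -> B j \subset 'C(B i)%g.
Proof.
move=> ij; apply/centsP => g /block_centP [g1 g2 _] h /block_centP [h1 h2 _].
apply: GLmat_inj; rewrite !GLmatM.
rewrite -[LHS]mul1mx -[RHS]mul1mx -sume !mulmx_suml; apply: eq_bigr => l _.
rewrite !mulmxA; have [->|li] := eqVneq l i.
  by rewrite g1 // -h2 -[in RHS]mulmxA g1.
by rewrite (h1 l li) -g2 -mulmxA h1.
Qed.

(** The commutant of all the blocks is the direct product of the centralisers of the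
    a i in GL(V i). *)
Lemma dprod_blocks : \big[dprod/1%g]_(i < r) B i = torus_group.
Proof.
have /eqP -> : \big[dprod/1%g]_(i < r) B i == (\prod_(i < r) B i)%G.
  apply/bigdprodYP => i _; rewrite bigprodGE.
  rewrite subsetD; apply/andP; split.
    rewrite gen_subG; apply/bigcupsP => j /andP [_ ji].
    by apply: block_comm_block; rewrite eq_sym.
  have st : <<\bigcup_(j < r | true && (j != i)) B j>>%g \subset rstab (GLrepr k m) (V i).
    rewrite gen_subG; apply/bigcupsP => j /andP [_ ji].
    apply/fintype.subsetP => g /block_centP [g1 _ _]; rewrite !inE /= row_stab.
    by rewrite g1 // eq_sym.
  apply/pred0P => x /=; apply/negP => /andP [/(fintype.subsetP st) xs /setD1P [x1 xB]].
  case/eqP: x1; apply: GLmat_inj; rewrite GLmat1.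
  have [h1 h2 h3] := block_centP (xB : x \in B i).
  rewrite -[LHS]mul1mx -sume mulmx_suml; apply: eq_bigr => l _.
  have [->|li] := eqVneq l i; last exact: h1.
  by apply/eqP; rewrite -row_stab; move: xs; rewrite !inE.
rewrite bigprodGE; apply/eqP; rewrite finset.eqEsubset; apply/andP; split.
  by rewrite gen_subG; apply/bigcupsP => i _; apply: block_sub_torus.
apply/fintype.subsetP => g /torus_setP gT1.
(* The component of g in GL(V i). *)
pose x i : 'M[k]_n := 1%:M + (GLmat g - 1%:M) *m e i.
have ge i : GLmat g *m e i = e i *m GLmat g by case: (gT1 i).
have gie i : invmx (GLmat g) *m e i = e i *m invmx (GLmat g).
  apply: (can_inj (mulKmx (GLmat_unit g))).
  by rewrite mulKVmx ?GLmat_unit // mulmxA ge -mulmxA mulmxV ?GLmat_unit // mulmx1.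
have eg i : (GLmat g - 1%:M) *m e i = e i *m (GLmat g - 1%:M).
  by rewrite mulmxBl mulmxBr ge mul1mx mulmx1.
have x_e i j : e j *m x i = if j == i then e i *m GLmat g else e j.
  rewrite /x mulmxDr mulmx1 eg mulmxA orth.
  case: eqP => [->|_]; last by rewrite mul0mx addr0.
  by rewrite mulmxBr mulmx1 addrC subrK.
have e_x i j : x i *m e j = if j == i then e i *m GLmat g else e j.
  rewrite /x mulmxDl mul1mx -mulmxA orth eq_sym.
  case: eqP => [->|_]; last by rewrite mulmx0 addr0.
  by rewrite mulmxBl mul1mx ge addrC subrK.
have xu i : x i \in unitmx.
  suff : x i *m (1%:M + (invmx (GLmat g) - 1%:M) *m e i) = 1%:M by case/mulmx1_unit.
  rewrite mulmxDr mulmx1 mulmxBl mul1mx gie mulmxBr mulmxA e_x eqxx.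
  rewrite -mulmxA mulmxV ?GLmat_unit // mulmx1 /x mulmxBl mul1mx ge.
  by rewrite -(opprB (e i *m GLmat g)) addrK.
have /choice [y yx] i : exists y : gT, GLmat y = x i by apply: GLmat_surj.
have yB i : y i \in B i.
  apply/setIP; split.
    apply/GLsummandP; rewrite yx; split=> [j /negPf ji|j]; first by rewrite x_e ji.
    by rewrite x_e e_x; case: eqP => // ->.
  apply/cent1P; apply: GLmat_inj; rewrite !GLmatM yx /x.
  rewrite mulmxDr mulmxDl mulmx1 mul1mx; congr (_ + _).
  have [_ ga] := gT1 i.
  rewrite mulmxBl mul1mx mulmxBr mulmxBl summand_elt_comm; congr (_ - _).
  by rewrite -mulmxA ga ge (mulmxA (GLmat (a i))) summand_elt_comm.
have prodE (s : seq 'I_r) : uniq s ->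
    GLmat (\prod_(i <- s) y i)%g = 1%:M + (GLmat g - 1%:M) *m (\sum_(i <- s) e i).
  elim: s => [|i s IH] /=; first by rewrite !big_nil mulmx0 addr0 GLmat1.
  case/andP => nis us; rewrite !big_cons GLmatM IH // yx /x.
  set S := \sum_(j <- s) e j.
  have eS : e i *m S = 0.
    rewrite mulmx_sumr big_seq big1 // => j js; rewrite orth.
    by case: eqP => // ij; rewrite ij js in nis.
  rewrite mulmxDl mul1mx mulmxDr mulmx1 (mulmxDr _ (e i)).
  rewrite mulmxA -(mulmxA _ (e i) (_ - _)) -eg mulmxA -(mulmxA _ (e i)) eS mulmx0 addr0.
  by rewrite -addrA (addrC (_ *m S)).
have -> : g = (\prod_(i < r) y i)%g.
  apply: GLmat_inj; rewrite prodE ?index_enum_uniq // sume mulmx1.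
  by rewrite addrC subrK.
by apply: group_prod => i _; apply: mem_gen; apply/bigcupP; exists i.
Qed.

(** An idempotent in the commutant of the block of a i cuts V i into two submodules. *)
Lemma indecomp_block i : mxindecomposable (natural_repr <[a i]>) (V i) ->
  block_of (e i) (e i *m GLmat (a i)).
Proof.
case=> _ V0 ind.
have ee : e i *m e i = e i by rewrite orth eqxx.
have [X [Y [XY YX]]] := idem_factor ee (erefl (\rank (e i))).
have [_ Xe eY] := idem_of XY; rewrite YX in Xe eY.
have ae := summand_elt_comm i i.
set A := GLmat (a i) in ae *.
have XAe : X *m A *m e i = X *m A by rewrite -mulmxA ae mulmxA Xe.
exists (\rank (e i)), X, Y, (X *m A *m Y); split=> //; last first.
  have -> : Y *m (X *m A *m Y) *m X = (Y *m X) *m A *m (Y *m X) by rewrite !mulmxA.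
  by rewrite YX -mulmxA ae mulmxA ee.
split.
- rewrite lt0n mxrank_eq0; apply: contra V0 => /eqP e0.
  by rewrite -submx0 Ve e0.
- have : X *m A *m Y *m (X *m invmx A *m Y) = 1%:M.
    rewrite !mulmxA -(mulmxA _ Y X) YX XAe -(mulmxA X) mulmxV ?GLmat_unit //.
    by rewrite mulmx1.
  by case/mulmx1_unit.
move=> p pp pA; pose P := Y *m p *m X.
have PP : P *m P = P by rewrite /P !mulmxA -(mulmxA _ X) XY mulmx1 -(mulmxA Y) pp.
have eP : e i *m P = P by rewrite /P !mulmxA eY.
have Pe : P *m e i = P by rewrite /P -!mulmxA Xe.
have PA : P *m A = A *m P.
  have -> : P *m A = Y *m (p *m (X *m A *m Y)) *m X.
    rewrite !mulmxA -(mulmxA _ Y X) YX -/P.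
    by rewrite -(mulmxA P) ae mulmxA Pe.
  rewrite pA !mulmxA YX -ae -(mulmxA _ (e i) Y) eY -(mulmxA A) -(mulmxA A).
  by rewrite /P.
have mod Z : Z *m A = A *m Z -> mxmodule (natural_repr <[a i]>) Z.
  by move=> ZA; rewrite mxmodule_cycle -/A ZA submxMl.
have mP := mod P PA.
have meP : mxmodule (natural_repr <[a i]>) (e i - P).
  by apply: mod; rewrite mulmxBl mulmxBr PA ae.
have sumP : (P + (e i - P) :=: V i)%MS.
  apply/eqmxP; rewrite !Ve addsmx_sub -{1}Pe submxMl.
  have -> : e i - P = (1%:M - P) *m e i by rewrite mulmxBl mul1mx Pe.
  rewrite submxMl /= mulmxBl mul1mx Pe -{1}[e i](subrKC P).
  exact: addmx_sub_adds.
have dirP : mxdirect (P + (e i - P)).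
  apply/mxdirect_addsP/eqP; rewrite -submx0; apply/rV_subP => u.
  rewrite sub_capmx => /andP [/submxP [c uc] /submxP [d ud]].
  have : u *m P = u by rewrite uc -mulmxA PP.
  by rewrite {1}ud -mulmxA mulmxBl eP PP subrr mulmx0 => <-; apply: sub0mx.
have [W0|W0] := ind _ _ mP meP sumP dirP.
- left; have : X *m P *m Y = p by rewrite /P !mulmxA XY mul1mx -mulmxA XY mulmx1.
  by rewrite W0 mulmx0 mul0mx.
right; have : X *m P *m Y = p by rewrite /P !mulmxA XY mul1mx -mulmxA XY mulmx1.
by move/eqP: W0; rewrite subr_eq0 => /eqP <-; rewrite Xe XY.
Qed.

(** Conversely, the projections of a decomposition of V i are idempotents that commute
    with the block. *)
Lemma block_indecomp i : block_of (e i) (e i *m GLmat (a i)) ->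
  mxindecomposable (natural_repr <[a i]>) (V i).
Proof.
move=> blk; have e0 := block_neq0 blk.
have ae := summand_elt_comm i i; set A := GLmat (a i) in ae blk *.
have ee : e i *m e i = e i by rewrite orth eqxx.
split.
- by rewrite mxmodule_cycle -/A (eqmxMr _ (Ve i)) Ve -ae submxMl.
- by apply: contra e0 => /eqP V0; rewrite -submx0 -V0 Ve.
move=> W1 W2; rewrite !mxmodule_cycle -/A => W1A W2A W12 /mxdirect_addsP cap.
have eW : (e i <= W1 + W2)%MS by rewrite W12 Ve.
have W1e : W1 *m e i = W1.
  have /submxP [c ->] : (W1 <= e i)%MS by rewrite -Ve -W12 addsmxSl.
  by rewrite -mulmxA ee.
have W2e : W2 *m e i = W2.
  have /submxP [c ->] : (W2 <= e i)%MS by rewrite -Ve -W12 addsmxSr.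
  by rewrite -mulmxA ee.
pose p := e i *m proj_mx W1 W2.
have p_sub : (p <= W1)%MS by apply: proj_mx_sub.
have pe : p *m e i = p by have /submxP [c ->] := p_sub; rewrite -mulmxA W1e.
have ep : e i *m p = p by rewrite /p mulmxA ee.
have pp : p *m p = p by rewrite {2}/p mulmxA pe /p proj_mx_id //; apply: proj_mx_sub.
have pA : p *m A = A *m p.
  have eA : e i *m A *m proj_mx W1 W2 = p *m A.
    have eE := add_proj_mx cap eW; rewrite -/p in eE.
    rewrite -{1}eE mulmxDl mulmxDl.
    rewrite (proj_mx_id cap); last by apply: submx_trans (submxMr _ p_sub) W1A.
    rewrite (proj_mx_0 cap) ?addr0 //.
    by apply: submx_trans (submxMr _ (proj_mx_sub _ _ _)) W2A.
  by rewrite -eA -ae /p -!mulmxA.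
have peA : p *m (e i *m A) = e i *m A *m p.
  by rewrite mulmxA pe pA -mulmxA -pA mulmxA ep.
have [p0|p1] := block_dichotomy blk pp peA.
  left; rewrite ep in p0.
  have := proj_mx_id cap (submx_refl W1).
  by rewrite -{1}W1e -mulmxA -/p p0 mulmx0 => <-.
right; rewrite ep in p1.
rewrite -W2e -p1 /p mulmxA W2e; exact: proj_mx_0.
Qed.

End Family.
Lemma calA_calAm (A : {group gT}) : in_calA A -> [set GLmat g | g in A] \in calAm k n.
Proof.
case=> _ [r [V [sumV dxV indV [B [BV AB /choice [a aP]]]]]].
have cap i : (V i :&: \sum_(j < r | j != i) V j)%MS = 0.
  by have /mxdirect_sumsP := dxV; apply.
(* The projections attached to the direct sum of the V i. *)
pose e i : 'M[k]_n := proj_mx (V i) (\sum_(j < r | j != i) V j)%MS.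
have VeE i j : V i *m e j = if i == j then V i else 0.
  case: eqP => [->|/eqP ij]; first by rewrite proj_mx_id.
  by rewrite proj_mx_0 //; apply: (sumsmx_sup i).
have [u uV] : exists u : 'I_r -> 'M[k]_n, 1%:M = \sum_i u i *m V i.
  by apply/sub_sumsmxP; rewrite sumV.
have ext (M N : 'M[k]_n) : (forall i, V i *m M = V i *m N) -> M = N.
  move=> MN; rewrite -(mul1mx M) -(mul1mx N) uV !mulmx_suml.
  by apply: eq_bigr => i _; rewrite -!mulmxA MN.
have orth i j : e i *m e j = if i == j then e i else 0.
  apply: ext => l; rewrite mulmxA VeE; case: (eqVneq i j) => [->|ij]; rewrite ?VeE ?mulmx0.
    by case: eqP => [->|_]; rewrite ?mul0mx // VeE eqxx.
  by case: eqP => [->|_]; rewrite ?mul0mx // VeE (negPf ij).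
have sume : \sum_i e i = 1%:M.
  apply: ext => l; rewrite mulmx_sumr mulmx1 (bigD1 l) //= VeE eqxx big1 ?addr0 //.
  by move=> i il; rewrite VeE eq_sym (negPf il).
have Ve i : (V i :=: e i)%MS.
  apply/eqmxP; rewrite -[e i]mul1mx proj_mx_sub andbT mul1mx.
  have -> : V i = V i *m e i by rewrite VeE eqxx.
  exact: submxMl.
have aV i : a i \in GLsummand V i by have [] := aP i.
have blk i : block_of (e i) (e i *m GLmat (a i)).
  by apply: (indecomp_block Ve orth sume aV); have [] := aP i.
have e0 i : e i != 0 := block_neq0 (blk i).
have e_inj : injective e.
  move=> i j eij; apply/eqP; apply: contraT => ij.
  by case/eqP: (e0 i); have := orth i j; rewrite (negPf ij) -eij orth eqxx.
have AT : A = torus_group e a.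
  apply/group_inj; rewrite -(dprod_blocks Ve orth sume aV) -AB.
  by apply: eq_bigr => i _; have [_ _ ->] := aP i.
pose beta x := if [pick i | x == e i] is Some i then e i *m GLmat (a i) else 0.
have betaE i : beta (e i) = e i *m GLmat (a i).
  rewrite /beta; case: pickP => [j /eqP/e_inj <-|/(_ i)] //.
  by rewrite eqxx.
rewrite inE; apply/asboolP; exists [set e i | i : 'I_r], beta; split.
  split.
  - move=> _ _ /imsetP [i _ ->] /imsetP [j _ ->] ij; rewrite orth.
    by case: eqP => // eij; rewrite eij eqxx in ij.
  - by rewrite big_imset /= ?sume // => i j _ _; apply: e_inj.
  by move=> _ /imsetP [i _ ->]; rewrite betaE.
apply/setP => x; apply/imsetP/torusP => [[g gA ->]|[xu xE]].
  split; first exact: GLmat_unit.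
  move: gA; rewrite AT => /torus_setP gA _ /imsetP [i _ ->].
  by rewrite betaE; have [] := gA i.
have [g gx] := GLmat_surj xu; exists g => //; rewrite AT; apply/torus_setP => i.
rewrite gx; have := xE (e i); rewrite betaE => /(_ _) xb.
have {}xb := xb (imset_f _ (isT : i \in 'I_r)).
by split=> //; apply: (block_comm (blk i)).
Qed.

Lemma calAm_calA (S : {set 'M[k]_n}) : S \in calAm k n ->
  exists2 A : {group gT}, in_calA A & S = [set GLmat g | g in A].
Proof.
rewrite inE => /asboolP [E [beta [D ->]]].
have [orthE sumE blkE] := D.
pose r := #|E|; pose e (i : 'I_r) : 'M[k]_n := enum_val i.
have eE i : e i \in E by apply: enum_valP.
have orth i j : e i *m e j = if i == j then e i else 0.
  case: (eqVneq i j) => [<-|ij]; first by have [] := block_idem (blkE _ (eE i)).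
  apply: orthE => //; apply: contra ij => /eqP/enum_val_inj ->; exact: eqxx.
have sume : \sum_i e i = 1%:M by rewrite -sumE [RHS]big_enum_val.
have Ve i : (e i :=: e i)%MS by [].
(* The element of GL(V i) that acts on V i as the block on e i. *)
pose x i := 1%:M - e i + beta (e i).
have bI i := block_idem (blkE _ (eE i)).
have xe i j : e j *m x i = if j == i then beta (e i) else e j.
  have [ee eb be] := bI i.
  rewrite /x mulmxDr mulmxBr mulmx1 orth -{1}eb mulmxA orth.
  case: eqP => [->|_]; first by rewrite subrr add0r eb.
  by rewrite mul0mx subr0 addr0.
have ex i j : x i *m e j = if j == i then beta (e i) else e j.
  have [ee eb be] := bI i.
  rewrite /x mulmxDl mulmxBl mul1mx orth [i == j]eq_sym -{1}be -mulmxA orth [i == j]eq_sym.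
  case: eqP => [->|_]; first by rewrite subrr add0r be.
  by rewrite mulmx0 subr0 addr0.
have xu i : x i \in unitmx.
  have [ee eb be] := bI i.
  have [N [X [Y [b0 [[_ b0u _] XY eYX bYX]]]]] := blkE _ (eE i).
  suff : x i *m (1%:M - e i + Y *m invmx b0 *m X) = 1%:M by case/mulmx1_unit.
  have Yx : e i *m Y = Y by rewrite eYX -mulmxA XY mulmx1.
  rewrite mulmxDr mulmxBr mulmx1 ex eqxx -{1}Yx !mulmxA ex eqxx.
  have -> : beta (e i) *m Y *m invmx b0 *m X = e i.
    by rewrite bYX -(mulmxA _ X Y) XY mulmx1 mulmxK // eYX.
  by rewrite /x addrK subrK.
have /choice [a ax] i : exists g : gT, GLmat g = x i by apply: GLmat_surj.
have aV i : a i \in GLsummand e i.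
  apply/(GLsummandP Ve orth sume); rewrite ax; split=> [j /negPf ji|j].
    by rewrite xe ji.
  by rewrite xe ex.
have ea i : e i *m GLmat (a i) = beta (e i) by rewrite ax xe eqxx.
have blk i : block_of (e i) (e i *m GLmat (a i)) by rewrite ea; apply: blkE.
have dprodB := dprod_blocks Ve orth sume aV.
exists (torus_group e a).
  split.
    apply/centsP => g /torus_setP gT1 h /torus_setP hT1.
    apply: GLmat_inj; rewrite !GLmatM.
    rewrite -[LHS]mul1mx -[RHS]mul1mx -sume !mulmx_suml; apply: eq_bigr => i _.
    have [_ g2] := gT1 i; have [_ h2] := hT1 i.
    by rewrite !mulmxA; apply: (block_comm2 (blk i)).
  exists r, e; split.
  - by apply/eqmxP; rewrite submx1 /= -{1}sume; apply: summx_sub_sums.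
  - apply/mxdirect_sumsP => i _; apply/eqP; rewrite -submx0.
    apply/rV_subP => u; rewrite sub_capmx => /andP [/submxP [c uc] /sub_sumsmxP [d ud]].
    have -> : u = u *m e i by rewrite uc -mulmxA orth eqxx.
    rewrite ud mulmx_suml big1 ?sub0mx // => j ji.
    by rewrite -mulmxA orth (negPf ji) mulmx0.
  - move=> i; have [W1 W2 W3] := block_indecomp Ve orth sume aV (blk i).
    have ai : a i \in torus_group e a.
      apply: (fintype.subsetP (block_sub_torus Ve orth sume aV i)).
      by rewrite inE aV cent1id.
    have down (U : 'M[k]_n) : mxmodule (natural_repr (torus_group e a)) U ->
        mxmodule (natural_repr <[a i]>) U.
      by rewrite mxmodule_cycle => /mxmodule_natural H; apply: H.
    split=> //; last by move=> U1 U2 /down H1 /down H2; apply: W3.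
    apply/mxmodule_natural => g /torus_setP /(_ i) [g1 _].
    by rewrite -g1 submxMl.
  exists (fun i => 'C_(GLsummand e i)[a i]%G); split=> //.
  - by move=> i; apply: subsetIl.
  move=> i; exists (a i); split=> //.
  exact: (block_indecomp Ve orth sume aV (blk i)).
apply/setP => y; apply/torusP/imsetP => [[yu yE]|[g /torus_setP gT1 ->]].
  have [g gy] := GLmat_surj yu; exists g => //; apply/torus_setP => i.
  rewrite gy ea yE //; split=> //.
  exact: (block_comm (blkE _ (eE i)) (yE _ (eE i))).
split; first exact: GLmat_unit.
move=> z zE; have -> : z = e (enum_rank_in zE z) by rewrite /e enum_rankK_in.
by rewrite -ea; have [] := gT1 (enum_rank_in zE z).
Qed.

Lemma card_calA : #|calA k m| = #|calAm k n|.
Proof.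
pose f (A : {group gT}) := [set GLmat g | g in A].
have f_inj : injective f.
  by move=> A A' /(imset_inj GLmat_inj) /group_inj.
rewrite -(card_imset _ f_inj); apply: eq_card => S; apply/imsetP/idP.
  by move=> [A + ->]; rewrite inE => /asboolP; apply: calA_calAm.
by move=> /calAm_calA [A Ac ->]; exists A; rewrite // inE; apply/asboolP.
Qed.

End Bridge.

(** * Formal exponentials *)

Section Expo.

Variable R : numFieldType.

(** The coefficients of index at most n of the series expo p below. *)
Fixpoint expo_upto (p : nat -> R) (n : nat) : nat -> R :=
  if n is n'.+1 then
    fun i => if (i <= n')%N then expo_upto p n' i
             else n'.+1%:R^-1 * \sum_(N < n'.+1) p N.+1 * expo_upto p n' (n' - N)
  else fun=> 1.

(** The coefficients of the power series exp (sum over N > 0 of p N t^N / N), defined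
    by the recursion of expoS. The value p 0 is not used. *)
Definition expo (p : nat -> R) (n : nat) : R := expo_upto p n n.

Lemma expo_upto_stable p n i : (i <= n)%N -> expo_upto p n i = expo p i.
Proof.
elim: n => [|n IH] /=; first by rewrite leqn0 => /eqP ->.
rewrite leq_eqVlt ltnS => /orP [/eqP ->|le_in]; first by rewrite /expo /= ltnn.
by rewrite le_in IH.
Qed.

Lemma expo0 p : expo p 0 = 1. Proof. by []. Qed.

Lemma expoS p n : n.+1%:R * expo p n.+1 = \sum_(N < n.+1) p N.+1 * expo p (n - N).
Proof.
rewrite /expo /= ltnn mulrA divff ?pnatr_eq0 // mul1r.
by apply: eq_bigr => N _; rewrite expo_upto_stable // leq_subr.
Qed.

Lemma expo_unique p a : a 0%N = 1 ->
  (forall n, n.+1%:R * a n.+1 = \sum_(N < n.+1) p N.+1 * a (n - N)%N) -> a =1 expo p.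
Proof.
move=> a0 aS n; elim/ltn_ind: n => -[|n] IH; first by rewrite a0.
apply: (mulfI (_ : n.+1%:R != 0)); first by rewrite pnatr_eq0.
rewrite aS expoS; apply: eq_bigr => N _; rewrite IH // ltnS; exact: leq_subr.
Qed.

Lemma eq_expo p p' : (forall N, (0 < N)%N -> p N = p' N) -> expo p =1 expo p'.
Proof.
move=> pp'; apply: expo_unique => // n; rewrite expoS.
by apply: eq_bigr => N _; rewrite pp'.
Qed.

Lemma expo_ge0 p : (forall N, 0 <= p N) -> forall n, 0 <= expo p n.
Proof.
move=> p0 n; elim/ltn_ind: n => -[|n] IH; first by rewrite expo0.
rewrite -(pmulr_rge0 _ (_ : 0 < n.+1%:R)) ?ltr0n // expoS sumr_ge0 // => N _.
by rewrite mulr_ge0 // IH // ltnS leq_subr.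
Qed.

Lemma ler_expo p p' : (forall N, 0 <= p N <= p' N) -> forall n, expo p n <= expo p' n.
Proof.
move=> pp' n; have p0 N : 0 <= p N by case/andP: (pp' N).
elim/ltn_ind: n => -[|n] IH; first by rewrite !expo0.
rewrite -(ler_pM2l (_ : 0 < n.+1%:R)) ?ltr0n // !expoS ler_sum // => N _.
apply: ler_pM => //; first exact: expo_ge0.
  by case/andP: (pp' N.+1).
by rewrite IH // ltnS leq_subr.
Qed.

Lemma expo0_fun n : expo (fun=> 0) n = (n == 0%N)%:R.
Proof.
symmetry; apply: (expo_unique (a := fun n => (n == 0%N)%:R)) => // {}n.
by rewrite mulr0 big1 // => N _; rewrite mul0r.
Qed.

(** The sequence p for which expo p is the geometric series 1 / (1 - w t^m):
    N times the coefficient of t^N in - log (1 - w t^m). The value at N = 0 is 0, so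
    that infinite sums of such sequences also converge there. *)
Definition delta (m : nat) (w : R) (N : nat) : R :=
  if (0 < N)%N && (m %| N)%N then m%:R * w ^+ (N %/ m) else 0.

Lemma delta_ge0 m w N : 0 <= w -> 0 <= delta m w N.
Proof. by move=> w0; rewrite /delta; case: ifP => // _; rewrite mulr_ge0 ?exprn_ge0. Qed.

Lemma deltaD m w N : (0 < m)%N -> (0 < N)%N -> delta m w (m + N) = w * delta m w N.
Proof.
move=> m0 N0; rewrite /delta dvdn_addr // addn_gt0 m0 N0 /=; case: ifP => _; last by rewrite mulr0.
by rewrite divnDl // divnn m0 exprS mulrCA.
Qed.

(** Adding delta m w to p multiplies the series by 1 / (1 - w t^m). *)
Lemma expo_factor p m w n : (0 < m)%N ->
  expo (fun N => p N + delta m w N) n =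
  expo p n + (if (m <= n)%N then w * expo (fun N => p N + delta m w N) (n - m) else 0).
Proof.
move=> m0; set b := expo _.
pose S (f : nat -> R) n := \sum_(1 <= N < n.+1) f N * b (n - N)%N.
have bS i : i%:R * b i = S p i + S (delta m w) i.
  rewrite /S -big_split /=; under eq_bigr do rewrite -mulrDl.
  case: i => [|i]; first by rewrite mul0r big_geq.
  by rewrite [LHS]expoS big_add1 big_mkord; apply: eq_bigr => N _; rewrite subSS.
have Sd i : S (delta m w) i = if (m <= i)%N then w * S (delta m w) (i - m)%N + w * m%:R * b (i - m)%N else 0.
  case: leqP => mi; last first.
    rewrite /S big_nat big1 // => N /andP [N0 Ni].
    by rewrite /delta gtnNdvd ?andbF ?mul0r // (leq_trans _ mi).
  rewrite /S (big_cat_nat (n := m)) //=; last by rewrite ltnW // ltnS.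
  rewrite [X in X + _]big_nat big1 ?add0r; last first.
    by move=> N /andP [N0 Nm]; rewrite /delta gtnNdvd ?andbF ?mul0r.
  have dm : delta m w m = w * m%:R by rewrite /delta dvdnn divnn m0 /= expr1 mulrC.
  rewrite big_ltn // dm addrC; congr (_ + _).
  rewrite -[m.+1]add1n big_addn subSn // mulr_sumr !big_nat.
  apply: eq_bigr => N /andP [N0 _].
  by rewrite addnC deltaD // mulrA subnDA.
pose c i := b i - (if (m <= i)%N then w * b (i - m)%N else 0).
suff -> : expo p n = c n by rewrite /c subrK.
symmetry; move: n; apply: expo_unique => [|n].
  by rewrite /c leqNgt m0 /= subr0.
have -> : \sum_(N < n.+1) p N.+1 * c (n - N)%N =
    S p n.+1 - (if (m <= n.+1)%N then w * S p (n.+1 - m)%N else 0).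
  have -> : \sum_(N < n.+1) p N.+1 * c (n - N)%N = \sum_(1 <= N < n.+2) p N * c (n.+1 - N)%N.
    by rewrite big_add1 big_mkord; apply: eq_bigr => N _; rewrite subSS.
  rewrite /c; under eq_bigr do rewrite mulrBr.
  rewrite sumrB -/(S p n.+1); congr (_ - _).
  case: leqP => mn; last first.
    rewrite big_nat big1 // => N /andP [N0 Nn].
    by rewrite leqNgt (leq_ltn_trans (leq_subr _ _)) ?mulr0.
  rewrite (big_cat_nat (n := (n.+1 - m).+1)) //=; last by rewrite ltnS leq_subr.
  rewrite [X in _ + X]big_nat [X in _ + X]big1 ?addr0; last first.
    by move=> N /andP [N1 N2]; rewrite ifF ?mulr0 //; apply/negbTE; lia.
  rewrite /S mulr_sumr !big_nat; apply: eq_bigr => N /andP [N1 N2].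
  rewrite ifT; last by lia.
  by rewrite mulrCA; congr (_ * (_ * b _)); lia.
rewrite /c mulrBr bS Sd.
case: leqP => mn; last by rewrite mulr0 !addr0.
rewrite mulrCA.
have -> : n.+1%:R * b (n.+1 - m)%N = (n.+1 - m)%:R * b (n.+1 - m)%N + m%:R * b (n.+1 - m)%N.
  by rewrite -mulrDl -natrD subnK.
by rewrite bS; ring.
Qed.

End Expo.

(** * Sums of power series *)

Local Open Scope classical_set_scope.

Section PowerSeries.

Lemma eq_has_psum (K : numFieldType) (c c' : nat -> K) t l :
  c =1 c' -> has_psum c t l -> has_psum c' t l.
Proof. by move=> /funext ->. Qed.

Lemma has_psumB (K : numFieldType) (c c' : nat -> K) t l l' :
  has_psum c t l -> has_psum c' t l' -> has_psum (fun n => c n - c' n) t (l - l').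
Proof.
move=> cl cl'; rewrite /has_psum.
have -> : series (fun n => (c n - c' n) * t ^+ n) =
   (series (fun n => c n * t ^+ n)) - (series (fun n => c' n * t ^+ n)).
  apply/funext => n; rewrite /series /= !fctE -sumrB.
  by apply: eq_bigr => i _; rewrite mulrBl.
exact: cvgB.
Qed.

Lemma has_psum1 (K : numFieldType) (t : K) : has_psum (fun n => (n == 0%N)%:R) t 1.
Proof.
rewrite /has_psum; apply: cvg_near_cst; exists 1%N => // n /= n0.
rewrite /series /= big_ltn // mul1r expr0 big_nat big1 ?addr0 // => i /andP [i0 _].
by rewrite eqn0Ngt i0 mul0r.
Qed.

Lemma series_factor (K : numFieldType) (a a' : nat -> K) m w t M :
  (forall n, a' n = a n + (if (m <= n)%N then w * a' (n - m)%N else 0)) ->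
  series (fun n => a' n * t ^+ n) M =
   series (fun n => a n * t ^+ n) M + w * t ^+ m * series (fun n => a' n * t ^+ n) (M - m)%N.
Proof.
move=> aE.
rewrite /series /= (eq_bigr (fun n => a n * t ^+ n + (if (m <= n)%N then w * a' (n - m)%N else 0) * t ^+ n)); last first.
  by move=> n _; rewrite {1}aE mulrDl.
rewrite big_split /=; congr (_ + _).
have [Mm|mM] := leqP M m.
  have -> : (M - m = 0)%N by apply/eqP.
  rewrite [X in _ = _ * X]big_geq // mulr0 big_nat big1 // => n /andP [_ nM].
  by rewrite leqNgt (leq_trans nM) ?mul0r.
rewrite (big_cat_nat (n := m)) //=; last exact: ltnW.
rewrite [X in X + _]big_nat big1 ?add0r; last first.
  by move=> n /andP [_ nm]; rewrite leqNgt nm mul0r.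
rewrite -{1}[m]add0n big_addn mulr_sumr; apply: eq_bigr => n _.
by rewrite leq_addl addnK exprD; ring.
Qed.

Lemma psum_factor (K : numFieldType) (a a' : nat -> K) m w t L L' :
  (forall n, a' n = a n + (if (m <= n)%N then w * a' (n - m)%N else 0)) ->
  has_psum a t L -> has_psum a' t L' -> L' * (1 - w * t ^+ m) = L.
Proof.
move=> aE aL aL'.
have cv1 : (fun M => series (fun n => a n * t ^+ n) M + w * t ^+ m * series (fun n => a' n * t ^+ n) (M - m)%N) @ \oo --> L + w * t ^+ m * L'.
  apply: cvgD => //; apply: cvgMr; rewrite (cvg_centern m (series (fun n => a' n * t ^+ n))) //.
move: cv1.
have -> : (fun M => series (fun n => a n * t ^+ n) M + w * t ^+ m * series (fun n => a' n * t ^+ n) (M - m)%N)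
   = series (fun n => a' n * t ^+ n) by apply/funext => M; rewrite -(series_factor t M aE).
move=> /(cvg_unique _ aL').
by move=> /(_ (@norm_hausdorff _ _)) E; rewrite mulrBr mulr1 {1}E [L' * _]mulrC addrK.
Qed.

Variable R : realType.
Implicit Types (a b : nat -> R) (r : R).

Lemma nneg_psum_mono a r : (forall n, 0 <= a n) -> 0 <= r ->
  nondecreasing_seq (series (fun n => a n * r ^+ n)).
Proof.
move=> a0 r0; apply/nondecreasing_seqP => n.
by rewrite /series /= big_nat_recr //= lerDl mulr_ge0 // exprn_ge0.
Qed.

Lemma nneg_psum_cvg a r B : (forall n, 0 <= a n) -> 0 <= r ->
  (forall M, series (fun n => a n * r ^+ n) M <= B) -> exists L, has_psum a r L.
Proof.
move=> a0 r0 aB; exists (limn (series (fun n => a n * r ^+ n))).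
apply: nondecreasing_is_cvgn; first exact: nneg_psum_mono.
by exists B => _ [n _ <-].
Qed.

Lemma nneg_psum_le a r L M : (forall n, 0 <= a n) -> 0 <= r -> has_psum a r L ->
  series (fun n => a n * r ^+ n) M <= L.
Proof.
move=> a0 r0 aL; rewrite -(cvg_lim (@Rhausdorff R) aL).
apply: nondecreasing_cvgn_le; first exact: nneg_psum_mono.
by apply/cvg_ex; exists L.
Qed.

Lemma psum_le_bound a r L B : has_psum a r L ->
  (forall M, series (fun n => a n * r ^+ n) M <= B) -> L <= B.
Proof.
move=> aL aB; rewrite -(cvg_lim (@Rhausdorff R) aL); apply: limr_le.
  by apply/cvg_ex; exists L.
by near=> n.
Unshelve. all: by end_near. Qed.

(** Multiplication by a geometric series preserves convergence at r when w r^m < 1;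
    nonnegativity makes bounded partial sums sufficient. *)
Lemma nneg_psum_factor a a' m w r L : 0 <= w -> 0 <= r -> w * r ^+ m < 1 ->
  (forall n, 0 <= a n) -> (forall n, 0 <= a' n) ->
  (forall n, a' n = a n + (if (m <= n)%N then w * a' (n - m)%N else 0)) ->
  has_psum a r L -> has_psum a' r (L * (1 - w * r ^+ m)^-1).
Proof.
move=> w0 r0 wr a0 a'0 aE aL.
have wr1 : 0 < 1 - w * r ^+ m by rewrite subr_gt0.
have [L' aL'] : exists L', has_psum a' r L'.
  apply: (nneg_psum_cvg (B := L * (1 - w * r ^+ m)^-1)) => // M.
  rewrite ler_pdivlMr // mulrBr mulr1 lerBlDr.
  have : series (fun n => a' n * r ^+ n) M <= series (fun n => a n * r ^+ n) M + w * r ^+ m * series (fun n => a' n * r ^+ n) M.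
    rewrite {1}(series_factor r M aE) lerD2l ler_wpM2l ?mulr_ge0 ?exprn_ge0 //.
    by apply: nneg_psum_mono => //; apply: leq_subr.
  move=> h; apply: (le_trans h); rewrite [X in _ <= _ + X]mulrC lerD2r.
  exact: nneg_psum_le.
rewrite -(psum_factor aE aL aL') mulfK //.
by rewrite gt_eqF.
Qed.

Section FiniteProducts.

Variables (I : eqType) (wt : I -> R) (ex : I -> nat).
Hypotheses (wt0 : forall x, 0 <= wt x).

(** The sequence p for which expo p is the product of the 1 / (1 - wt x t^(ex x)),
    for x in s. *)
Definition pfun (s : seq I) (N : nat) : R := \sum_(x <- s) delta (ex x) (wt x) N.

Lemma pfun_ge0 s N : 0 <= pfun s N.
Proof. by rewrite sumr_ge0 // => x _; apply: delta_ge0. Qed.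

Lemma expo_pfun_cons x s n : (0 < ex x)%N -> expo (pfun (x :: s)) n =
  expo (pfun s) n + (if (ex x <= n)%N then wt x * expo (pfun (x :: s)) (n - ex x)%N else 0).
Proof.
move=> ex0.
have E : expo (pfun (x :: s)) =1 expo (fun N => pfun s N + delta (ex x) (wt x) N).
  by apply: eq_expo => N _; rewrite /pfun big_cons addrC.
by rewrite !E; exact: expo_factor.
Qed.

Lemma psum_pfun s r : 0 <= r ->
  (forall x, x \in s -> (0 < ex x)%N /\ wt x * r ^+ ex x < 1) ->
  has_psum (expo (pfun s)) r (\prod_(x <- s) (1 - wt x * r ^+ ex x)^-1).
Proof.
move=> r0; elim: s => [|x s IH] H.
  rewrite big_nil; apply: eq_has_psum (has_psum1 r) => n.
  by rewrite -expo0_fun; apply: eq_expo => N _; rewrite /pfun big_nil.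
have [ex0 wx] := H x (mem_head _ _).
rewrite big_cons mulrC.
apply: (nneg_psum_factor (a := expo (pfun s)) (wt0 x) r0 wx) => [n|n|n|].
- by apply: expo_ge0; apply: pfun_ge0.
- by apply: expo_ge0; apply: pfun_ge0.
- exact: expo_pfun_cons.
by apply: IH => y ys; apply: H; rewrite inE ys orbT.
Qed.

End FiniteProducts.

End PowerSeries.

(** * Complex power series with nonnegative coefficients *)

Section ComplexSeries.

Variable R : realType.
Local Notation C := (Cplx R).

(** The embedding of the reals in the complex numbers. *)
Definition toC (x : R) : C := (real_complex R x : R[i]).
(** The modulus as a real number; the norm itself is complex-valued. *)
Definition cabs (z : C) : R := complex.Re (`|z| : R[i]).

Lemma toCD x y : toC (x + y) = toC x + toC y.
Proof. exact: (rmorphD (real_complex R)). Qed.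
Lemma toCB x y : toC (x - y) = toC x - toC y.
Proof. exact: (rmorphB (real_complex R)). Qed.
Lemma toCM x y : toC (x * y) = toC x * toC y.
Proof. exact: (rmorphM (real_complex R)). Qed.
Lemma toCX x n : toC (x ^+ n) = toC x ^+ n.
Proof. exact: (rmorphXn (real_complex R)). Qed.
Lemma toCV x : toC x^-1 = (toC x)^-1.
Proof. exact: (fmorphV (real_complex R)). Qed.
Lemma toC0 : toC 0 = 0. Proof. by []. Qed.
Lemma toC1 : toC 1 = 1. Proof. by []. Qed.
Lemma toC_nat n : toC n%:R = n%:R.
Proof. exact: (rmorph_nat (real_complex R)). Qed.
Lemma toC_sum I (s : seq I) (P : pred I) (F : I -> R) :
  toC (\sum_(i <- s | P i) F i) = \sum_(i <- s | P i) toC (F i).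
Proof. exact: (rmorph_sum (real_complex R)). Qed.
Lemma toC_le x y : (toC x <= toC y) = (x <= y). Proof. exact: lecR. Qed.
Lemma toC_lt x y : (toC x < toC y) = (x < y). Proof. exact: ltcR. Qed.
Lemma toC_inj : injective toC. Proof. exact: complexI. Qed.

Lemma pos_toC (e : C) : 0 < e -> exists2 x : R, 0 < x & e = toC x.
Proof.
move=> e0; have eR : (e : R[i]) \is Num.real by rewrite gtr0_real.
exists (complex.Re (e : R[i])); last exact: esym (RRe_real eR).
by rewrite -ltcR RRe_real.
Qed.

Lemma cabsE (z : C) : `|z| = toC (cabs z).
Proof. by rewrite /toC /cabs RRe_real // normr_real. Qed.

Lemma cabs_ge0 z : 0 <= cabs z. Proof. by rewrite -toC_le -cabsE; apply: normr_ge0. Qed.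

Lemma norm_toC x : 0 <= x -> `|toC x| = toC x.
Proof. by move=> x0; rewrite ger0_norm // toC_le. Qed.

(** Absolute convergence. *)
Lemma psum_complex (a : nat -> R) (t : C) L : (forall n, 0 <= a n) ->
  has_psum a (cabs t) L -> exists l, has_psum (fun n => toC (a n)) t l.
Proof.
move=> a0 aL.
pose u n := toC (a n) * t ^+ n.
have uabs n : `|u n| = toC (a n * cabs t ^+ n).
  by rewrite /u normrM normrX norm_toC // cabsE -toCX -toCM.
have sabs : cvgn (series (fun n => a n * cabs t ^+ n)) by apply/cvg_ex; exists L.
have re_cv : cvgn (series (fun n => complex.Re (u n : R[i]))).
  apply: normed_cvg; apply: series_le_cvg sabs => n.
  - exact: normr_ge0.
  - by rewrite mulr_ge0 ?exprn_ge0 ?cabs_ge0.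
  - by rewrite -toC_le -uabs; apply: normc_ge_Re.
have im_cv : cvgn (series (fun n => complex.Im (u n : R[i]))).
  apply: normed_cvg; apply: series_le_cvg sabs => n.
  - exact: normr_ge0.
  - by rewrite mulr_ge0 ?exprn_ge0 ?cabs_ge0.
  rewrite -toC_le -uabs.
  have := normc_ge_Re ((u n : R[i]) * 'i%C); rewrite ReiNIm normrN => h.
  apply: (le_trans h); rewrite normrM.
  by rewrite (_ : `|'i%C : R[i]| = 1) ?mulr1 // normc_def /= expr0n expr1n add0r sqrtr1.
pose l : C := toC (limn (series (fun n => complex.Re (u n : R[i])))) +
   ('i%C : C) * toC (limn (series (fun n => complex.Im (u n : R[i])))).
exists l.
apply/cvgrPdist_lt => e /pos_toC [x x0 ->].
have x20 : 0 < x / 2 by rewrite divr_gt0.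
have /cvgrPdist_lt /(_ _ x20) re1 := re_cv.
have /cvgrPdist_lt /(_ _ x20) im1 := im_cv.
near=> n.
have h1 : `|limn (series (fun n => complex.Re (u n : R[i]))) - series (fun n => complex.Re (u n : R[i])) n| < x / 2.
  by near: n.
have h2 : `|limn (series (fun n => complex.Im (u n : R[i]))) - series (fun n => complex.Im (u n : R[i])) n| < x / 2.
  by near: n.
have -> : series (fun n => toC (a n) * t ^+ n) n = toC (series (fun n => complex.Re (u n : R[i])) n)
     + ('i%C : C) * toC (series (fun n => complex.Im (u n : R[i])) n).
  rewrite /series /= !toC_sum mulr_sumr -big_split /=; apply: eq_bigr => i _.
  exact: (complexE (u i : R[i])).
rewrite /l opprD addrACA -mulrBr -!toCB (splitr x) (toCD (x / 2)).
apply: le_lt_trans (ler_normD _ _) _.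
have nC (y : R) : `|toC y| = toC `|y|.
  by rewrite /toC normc_def /= expr0n addr0 sqrtr_sqr.
rewrite normrM (_ : `|'i%C : C| = 1); last first.
  by rewrite [LHS](@normc_def R) /= expr0n expr1n add0r sqrtr1.
by rewrite mul1r !nC; apply: ltrD; rewrite toC_lt.
Unshelve. all: by end_near. Qed.

Lemma cvg_norm_le (u : nat -> C) (l : C) (B : R) :
  u @ \oo --> l -> (forall n, `|u n| <= toC B) -> `|l| <= toC B.
Proof.
move=> ul uB; rewrite cabsE toC_le leNgt; apply/negP => lB.
have e0 : 0 < toC (cabs l - B) by rewrite -toC0 toC_lt subr_gt0.
have /cvgrPdist_lt /(_ _ e0) [N _ /(_ N (leqnn N))] := ul.
rewrite /= => h.
have : `|l| < toC (cabs l).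
  rewrite -[X in `|X|](subrK (u N)).
  apply: le_lt_trans (ler_normD _ _) _.
  rewrite -[cabs l](subrK B) toCD; exact: ltr_leD.
by rewrite cabsE ltxx.
Qed.

(** The distance between the values at t of two series with coefficients b <= a is at
    most the distance between their values at |t|. This transfers the convergence
    of infinite products from real to complex points. *)
Lemma psum_dist (a b : nat -> R) (t l l' : C) L L' :
  (forall n, 0 <= b n <= a n) ->
  has_psum a (cabs t) L -> has_psum b (cabs t) L' ->
  has_psum (fun n => toC (a n)) t l -> has_psum (fun n => toC (b n)) t l' ->
  `|l - l'| <= toC (L - L').
Proof.
move=> ba aL bL al bl.
have abL := has_psumB aL bL.
have abl := has_psumB al bl.
apply: cvg_norm_le abl _ => M.
apply: le_trans (_ : toC (series (fun n => (a n - b n) * cabs t ^+ n) M) <= _).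
  rewrite /series /= toC_sum; apply: le_trans (ler_norm_sum _ _ _) _.
  apply: ler_sum => i _; rewrite -toCB normrM normrX norm_toC.
    by rewrite cabsE -toCX -toCM.
  by rewrite subr_ge0; case/andP: (ba i).
rewrite toC_le; apply: nneg_psum_le => //; last exact: cabs_ge0.
by move=> n; rewrite subr_ge0; case/andP: (ba n).
Qed.

End ComplexSeries.

Lemma cvg_sum_seq (K : numFieldType) (T : Type) (s : seq T)
    (F : T -> nat -> K) (l : T -> K) :
  (forall i, F i M @[M --> \oo] --> l i) ->
  \sum_(i <- s) F i M @[M --> \oo] --> \sum_(i <- s) l i.
Proof.
move=> Fl; elim: s => [|x s IH].
  by under eq_fun do rewrite big_nil; rewrite big_nil; apply: cvg_cst.
by under eq_fun do rewrite big_cons; rewrite big_cons; apply: cvgD.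
Qed.

(** * Infinite products over triples of indices *)

Section Boxes.

(** The triples (m, i, j) with all entries less than M. *)
Definition box (M : nat) : seq (nat * nat * nat) :=
  [seq (x, j) | x <- [seq (m, i) | m <- iota 0 M, i <- iota 0 M], j <- iota 0 M].

Lemma box_uniq M : uniq (box M).
Proof.
apply: allpairs_uniq; rewrite ?iota_uniq //; last by move=> [? ?] [? ?].
by apply: allpairs_uniq; rewrite ?iota_uniq // => -[? ?] [? ?].
Qed.

Lemma mem_box M x : (x \in box M) = [&& (x.1.1 < M)%N, (x.1.2 < M)%N & (x.2 < M)%N].
Proof.
case: x => [[m i] j]; apply/allpairsP/and3P => /= [[[[a b] c] [/= /allpairsP [[m' i'] /=]]]|].
  rewrite !mem_iota !add0n /= => -[m'M i'M [-> ->]] cM [-> -> ->].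
  by [].
move=> [mM iM jM]; exists ((m, i), j); rewrite mem_iota; split=> //.
by apply/allpairsP; exists (m, i); rewrite !mem_iota.
Qed.

Lemma box_sub M M' : (M <= M')%N -> {subset box M <= box M'}.
Proof.
move=> MM' x; rewrite !mem_box => /and3P [a b c].
by rewrite !(leq_trans _ MM').
Qed.

Lemma sub_some_box (s : seq (nat * nat * nat)) : exists M, {subset s <= box M}.
Proof.
elim: s => [|[[m i] j] s [M IH]]; first by exists 0%N.
exists (maxn M (maxn m (maxn i j)).+1) => x; rewrite inE => /orP [/eqP ->|/IH].
  by rewrite mem_box /=; apply/and3P; split; lia.
by apply: box_sub; rewrite leq_maxl.
Qed.

Lemma big_box (T : Type) (idx_in : T) (op : Monoid.law idx_in) M (F : nat * nat * nat -> T) :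
  \big[op/idx_in]_(x <- box M) F x =
  \big[op/idx_in]_(0 <= m < M) \big[op/idx_in]_(0 <= i < M) \big[op/idx_in]_(0 <= j < M) F (m, i, j).
Proof. by rewrite /index_iota subn0 !big_allpairs. Qed.

End Boxes.

(** The exponent m of t in the factor of index (m, i, j). *)
Definition tdeg (x : nat * nat * nat) : nat := x.1.1.

Section BoxConvergence.

Variable R : realType.
Local Notation I := (nat * nat * nat)%type.
Local Notation ex := tdeg.

Lemma ler_sum_sub (T : eqType) (s s' : seq T) (F : T -> R) :
  uniq s -> uniq s' -> {subset s <= s'} -> (forall x, 0 <= F x) ->
  \sum_(x <- s) F x <= \sum_(x <- s') F x.
Proof.
move=> us us' ss' F0; rewrite [X in _ <= X](bigID (mem s)) /=.
rewrite -[X in _ <= X + _]big_filter.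
rewrite (perm_big [seq x <- s' | x \in s]); last first.
  apply: uniq_perm => //; first exact: filter_uniq.
  by move=> x; rewrite mem_filter; case: (boolP (x \in s)) => // /ss' ->.
by rewrite lerDl sumr_ge0.
Qed.

Lemma geo_sum_le (y : R) M : 0 <= y < 1 -> \sum_(0 <= i < M) y ^+ i <= (1 - y)^-1.
Proof.
move=> /andP [y0 y1]; have y1' : 0 < 1 - y by rewrite subr_gt0.
rewrite -[X in _ <= X]mul1r ler_pdivlMr // big_mkord mulrC.
have -> : (1 - y) * \sum_(i < M) y ^+ i = 1 - y ^+ M.
  by rewrite -[RHS]opprB subrX1 -mulNr opprB.
by rewrite gerBl exprn_ge0.
Qed.

Lemma prod_le_expR (T : eqType) (s : seq T) (z : T -> R) (y : R) : y < 1 ->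
  (forall x, x \in s -> 0 <= z x <= y) ->
  0 <= \prod_(x <- s) (1 - z x)^-1 <= expR ((\sum_(x <- s) z x) / (1 - y)).
Proof.
move=> y1; have y1' : 0 < 1 - y by rewrite subr_gt0.
elim: s => [|x s IH] H; first by rewrite !big_nil mul0r expR0 ler01 lexx.
have /andP [z0 zy] := H x (mem_head _ _).
have /andP [h0 h1] := IH (fun x' h => H x' (mem_behead (s := x :: s) h)).
have zz : 0 < 1 - z x by rewrite subr_gt0 (le_lt_trans zy).
rewrite !big_cons mulr_ge0 ?invr_ge0 ?(ltW zz) //= mulrDl expRD ler_pM ?invr_ge0 ?(ltW zz) //.
apply: le_trans (expR_ge1Dx _).
rewrite -[X in X <= _]mul1r ler_pdivrMr // mulrDl mul1r.
rewrite -lerBlDl opprB addrC subrK -mulrA ler_peMr // mulrC ler_pdivlMr // mul1r.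
by rewrite lerD2l lerN2.
Qed.

Variables (wt : I -> R) (P : pred I) (p : nat -> R).
Hypothesis wt0 : forall x, 0 <= wt x.
Hypothesis exP : forall x, P x -> (0 < ex x)%N.

(** The triples of the box of size M that satisfy P. *)
Definition boxP M : seq I := seq.filter P (box M).

(** p defines the infinite product: it is the limit of the sequences that define the
    products over boxes. *)
Hypothesis pP : forall N, pfun wt ex (boxP M) N @[M --> \oo] --> p N.

Lemma boxP_uniq M : uniq (boxP M).
Proof. by rewrite filter_uniq // box_uniq. Qed.

Lemma boxP_sub M M' : (M <= M')%N -> {subset boxP M <= boxP M'}.
Proof. by move=> /box_sub MM' x; rewrite !mem_filter => /andP [-> /MM' ->]. Qed.

Lemma pfun_sub s s' N : uniq s -> uniq s' -> {subset s <= s'} ->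
  pfun wt ex s N <= pfun wt ex s' N.
Proof. by move=> us us' ss'; apply: ler_sum_sub => // x; apply: delta_ge0. Qed.

Lemma pfun_le_lim s N : uniq s -> all P s -> pfun wt ex s N <= p N.
Proof.
move=> us /allP sP; have [M0 sM0] := sub_some_box s.
have sub : {subset s <= boxP M0} by move=> x xs; rewrite mem_filter sP // sM0.
apply: (le_trans (pfun_sub N us (boxP_uniq _) sub)).
rewrite -(cvg_lim (@Rhausdorff R) (@pP N)).
apply: (nondecreasing_cvgn_le (u_ := fun M => pfun wt ex (boxP M) N)).
  by move=> M M' MM'; apply: pfun_sub (boxP_uniq _) (boxP_uniq _) (boxP_sub MM').
by apply/cvg_ex; exists (p N).
Qed.

Lemma pfun_lim_ge0 N : 0 <= p N.
Proof. by have := @pfun_le_lim [::] N isT isT; rewrite /pfun big_nil. Qed.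

Lemma cvg_expo_box n : expo (pfun wt ex (boxP M)) n @[M --> \oo] --> expo p n.
Proof.
elim/ltn_ind: n => -[|n] IH; first exact: cvg_cst.
have E (p' : nat -> R) : expo p' n.+1 = n.+1%:R^-1 * \sum_(N < n.+1) p' N.+1 * expo p' (n - N).
  by rewrite -expoS mulKf // pnatr_eq0.
under eq_fun do rewrite E.
rewrite E; apply: cvgMr; apply: (cvg_sum_seq (T := 'I_n.+1)) => N; apply: cvgM; first exact: pP.
by apply: IH; rewrite ltnS leq_subr.
Qed.

(** Convergence at a radius r where the terms wt x r^(ex x) are at most y < 1 and
    dominated by a summable family. *)
Section AtRadius.

Variables (r y : R).
Hypotheses (r0 : 0 <= r) (y01 : 0 <= y < 1).
Hypothesis wy : forall x, P x -> wt x * r ^+ ex x <= y.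
Hypothesis wbound : forall x : I, P x ->
  wt x * r ^+ ex x <= 2 * y ^+ x.1.1 * 2^-1 ^+ x.1.2 * 2^-1 ^+ x.2.

Lemma factor_lt1 x : P x -> (0 < ex x)%N /\ wt x * r ^+ ex x < 1.
Proof.
by move=> Px; split; [exact: exP | apply: le_lt_trans (wy Px) _; case/andP: y01].
Qed.

Local Notation fac x := (1 - wt x * r ^+ ex x)^-1.

Lemma box_prod_bound : exists B, forall M, \prod_(x <- boxP M) fac x <= B.
Proof.
have /andP [y0 y1] := y01; have y1' : 0 < 1 - y by rewrite subr_gt0.
pose K := 2 * ((1 - y)^-1 * ((1 - 2^-1)^-1 * (1 - 2^-1)^-1)) : R.
exists (expR (K / (1 - y))) => M.
have w0 x : 0 <= wt x * r ^+ ex x by rewrite mulr_ge0 // exprn_ge0.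
have bnd x : x \in boxP M -> 0 <= wt x * r ^+ ex x <= y.
  by rewrite mem_filter => /andP [Px _]; rewrite w0 wy.
have /andP [_ h] := prod_le_expR y1 bnd.
apply: (le_trans h); rewrite ler_expR ler_pM2r ?invr_gt0 //.
rewrite big_filter big_mkcond /=.
apply: (le_trans (y := \sum_(x <- box M) 2 * y ^+ x.1.1 * 2^-1 ^+ x.1.2 * 2^-1 ^+ x.2)).
  apply: ler_sum => x _; case: ifP => [/wbound //|_].
  by rewrite !mulr_ge0 ?exprn_ge0 // invr_ge0.
rewrite big_box /=.
have -> : \sum_(0 <= m < M) \sum_(0 <= i < M) \sum_(0 <= j < M) 2 * y ^+ m * 2^-1 ^+ i * 2^-1 ^+ j
   = 2 * ((\sum_(0 <= m < M) y ^+ m) * ((\sum_(0 <= i < M) 2^-1 ^+ i) * (\sum_(0 <= i < M) 2^-1 ^+ i))) :> R.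
  rewrite mulr_suml mulr_sumr; apply: eq_bigr => m _.
  rewrite mulr_suml !mulr_sumr; apply: eq_bigr => i _.
  rewrite !mulr_sumr; apply: eq_bigr => j _; ring.
have h2 : 0 <= (2^-1 : R) < 1 by rewrite invr_ge0 ler0n /= invf_lt1 ?ltr1n.
have s0 (z : R) : 0 <= z -> 0 <= \sum_(0 <= i < M) z ^+ i.
  by move=> z0; rewrite sumr_ge0 // => i _; rewrite exprn_ge0.
have h20 : 0 <= (2^-1 : R) by case/andP: h2.
rewrite /K ler_pM2l //; apply: ler_pM; rewrite ?mulr_ge0 ?s0 //; first exact: geo_sum_le.
by apply: ler_pM; rewrite ?s0 //; apply: geo_sum_le.
Qed.

Lemma psum_boxP M : has_psum (expo (pfun wt ex (boxP M))) r (\prod_(x <- boxP M) fac x).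
Proof.
by apply: psum_pfun => // x; rewrite mem_filter => /andP [/factor_lt1].
Qed.

(** At a nonnegative real point the products over boxes increase to the value of the
    series, which bounds all finite products. *)
Lemma box_real : exists L, [/\ has_psum (expo p) r L,
  forall s, uniq s -> all P s -> \prod_(x <- s) fac x <= L &
  forall e, 0 < e -> exists M0, L - e < \prod_(x <- boxP M0) fac x].
Proof.
have [B prodB] := box_prod_bound.
have expo0n s := expo_ge0 (pfun_ge0 ex wt0 s).
have partial M n : series (fun i => expo (pfun wt ex (boxP M)) i * r ^+ i) n
    <= \prod_(x <- boxP M) fac x.
  by have h := @psum_boxP M; exact: (nneg_psum_le n (expo0n _) r0 h).
have cvg_partial n : series (fun i => expo (pfun wt ex (boxP M)) i * r ^+ i) n @[M --> \oo]
    --> series (fun i => expo p i * r ^+ i) n.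
  rewrite /series /=; apply: cvg_sum_seq => i; apply: cvgMl; exact: cvg_expo_box.
have expop0 := expo_ge0 pfun_lim_ge0.
have [L pL] : exists L, has_psum (expo p) r L.
  apply: (nneg_psum_cvg (B := B)) => // n.
  rewrite -(cvg_lim (@Rhausdorff R) (cvg_partial n)); apply: limr_le.
    by apply/cvg_ex; exists (series (fun i => expo p i * r ^+ i) n).
  by near=> M; apply: le_trans (partial M n) (prodB M).
exists L; split=> //.
  move=> s us sP.
  have sps : has_psum (expo (pfun wt ex s)) r (\prod_(x <- s) fac x).
    by apply: psum_pfun => // x /(allP sP) /factor_lt1.
  apply: (psum_le_bound sps) => n; apply: le_trans (nneg_psum_le n expop0 r0 pL).
  apply: ler_sum => i _; rewrite ler_wpM2r ?exprn_ge0 //.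
  by apply: ler_expo => N; rewrite pfun_ge0 //= pfun_le_lim.
move=> e e0; have e20 : 0 < e / 2 by rewrite divr_gt0.
have /cvgrPdist_lt /(_ _ e20) [n _ /(_ n (leqnn n)) /=] := pL.
rewrite ltr_norml => /andP [_ h1].
have /cvgrPdist_lt /(_ _ e20) [M _ /(_ M (leqnn M)) /=] := cvg_partial n.
rewrite ltr_norml => /andP [_ h2].
exists M; apply: lt_le_trans (partial M n).
move: h1 h2; set u := series _ n; set v := series _ n; lra.
Unshelve. all: by end_near. Qed.

End AtRadius.

Section Complex.

Local Notation C := (Cplx R).

Lemma psum_pfun_complex s (t : C) :
  (forall x, x \in s -> (0 < ex x)%N /\ wt x * cabs t ^+ ex x < 1) ->
  has_psum (fun n => toC (expo (pfun wt ex s) n)) t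
    (\prod_(x <- s) (1 - toC (wt x) * t ^+ ex x)^-1).
Proof.
elim: s => [|x s IH] H.
  rewrite big_nil; apply: eq_has_psum (has_psum1 t) => n.
  rewrite -(toC_nat R) -expo0_fun; congr (toC _); apply: eq_expo => N _.
  by rewrite /pfun big_nil.
have [ex0 wx] := H x (mem_head _ _).
have {}IH := IH (fun x' h => H x' (mem_behead (s := x :: s) h)).
have [L aL] : exists L, has_psum (expo (pfun wt ex (x :: s))) (cabs t) L.
  by eexists; apply: psum_pfun => //; exact: cabs_ge0.
have [l al] := psum_complex (expo_ge0 (pfun_ge0 ex wt0 (x :: s))) aL.
have E n : toC (expo (pfun wt ex (x :: s)) n) = toC (expo (pfun wt ex s) n) +
   (if (ex x <= n)%N then toC (wt x) * toC (expo (pfun wt ex (x :: s)) (n - ex x)%N) else 0).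
  by rewrite expo_pfun_cons // toCD; case: ifP => _; rewrite ?toCM.
have := psum_factor E IH al => lE.
rewrite big_cons -lE mulrC mulfK //.
rewrite subr_eq0 eq_sym; apply/eqP => w1.
have : `|toC (wt x) * t ^+ ex x| < 1.
  by rewrite normrM normrX norm_toC // cabsE -toCX -toCM -toC1 toC_lt.
by rewrite w1 normr1 ltxx.
Qed.

(** At a complex point the series converges to the value of the infinite product:
    by psum_dist, the error of a finite product is at most its error at |t|. *)
Lemma box_complex (t : C) (y : R) : 0 <= y < 1 ->
  (forall x, P x -> wt x * cabs t ^+ ex x <= y) ->
  (forall x : I, P x -> wt x * cabs t ^+ ex x <= 2 * y ^+ x.1.1 * 2^-1 ^+ x.1.2 * 2^-1 ^+ x.2) ->
  exists l, has_psum (fun n => toC (expo p n)) t l /\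
    has_prod P (fun x => (1 - toC (wt x) * t ^+ ex x)^-1) l.
Proof.
move=> y01 wy wb.
have [L [pL sL eL]] := box_real (cabs_ge0 t) y01 wy wb.
have expop0 := expo_ge0 pfun_lim_ge0.
have [l al] := psum_complex expop0 pL.
exists l; split=> // e /pos_toC [e' e'0 ->].
have factor_lt1 x : P x -> (0 < ex x)%N /\ wt x * cabs t ^+ ex x < 1.
  by move=> Px; split; [exact: exP | apply: le_lt_trans (wy x Px) _; case/andP: y01].
have [M0 hM0] := eL e' e'0.
exists [fset x | x in box M0]%fset => J J0J.
pose s := seq.filter P J.
have us : uniq s by rewrite filter_uniq // fset_uniq.
have sP : all P s by apply/allP => x; rewrite mem_filter => /andP [].
rewrite -big_filter -/s distrC.
have sw x : x \in s -> (0 < ex x)%N /\ wt x * cabs t ^+ ex x < 1.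
  by move/(allP sP)/factor_lt1.
have r1 := psum_pfun wt0 (cabs_ge0 t) sw.
have c1 := psum_pfun_complex sw.
have le_expo n : 0 <= expo (pfun wt ex s) n <= expo p n.
  rewrite (expo_ge0 (pfun_ge0 ex wt0 s)) /=.
  by apply: ler_expo => N; rewrite pfun_ge0 //= pfun_le_lim.
apply: le_lt_trans (psum_dist le_expo pL r1 al c1) _.
rewrite toC_lt ltrBlDr -ltrBlDl; apply: (lt_le_trans hM0).
have sub : {subset boxP M0 <= s}.
  move=> x; rewrite !mem_filter => /andP [-> xM] /=.
  by apply: (fsubsetP J0J); rewrite in_fset /=.
have r0 : has_psum (expo (pfun wt ex (boxP M0))) (cabs t)
    (\prod_(x <- boxP M0) (1 - wt x * cabs t ^+ ex x)^-1).
  exact: psum_boxP (cabs_ge0 t) y01 wy M0.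
apply: (psum_le_bound r0) => n.
have expo_s0 := expo_ge0 (pfun_ge0 ex wt0 s).
apply: le_trans (nneg_psum_le n expo_s0 (cabs_ge0 t) r1).
apply: ler_sum => i _; rewrite ler_wpM2r ?exprn_ge0 ?cabs_ge0 //.
by apply: ler_expo => N; rewrite pfun_ge0 //= pfun_sub // boxP_uniq.
Qed.

End Complex.

End BoxConvergence.

(** * Analyticity *)

Section Analytic.

Variable R : realType.
Local Notation C := (Cplx R).

Lemma cabsM (x y : C) : cabs (x * y) = cabs x * cabs y.
Proof. by apply: toC_inj; rewrite toCM -!cabsE normrM. Qed.

Lemma cabsX (x : C) n : cabs (x ^+ n) = cabs x ^+ n.
Proof. by apply: toC_inj; rewrite toCX -!cabsE normrX. Qed.

Lemma cabsV (x : C) : cabs x^-1 = (cabs x)^-1.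
Proof. by apply: toC_inj; rewrite toCV -!cabsE normfV. Qed.

Lemma ler_cabsD (x y : C) : cabs (x + y) <= cabs x + cabs y.
Proof. by rewrite -toC_le toCD -!cabsE ler_normD. Qed.

Lemma ler_cabs_sum (I : Type) (s : seq I) (P : pred I) (F : I -> C) :
  cabs (\sum_(i <- s | P i) F i) <= \sum_(i <- s | P i) cabs (F i).
Proof.
rewrite -toC_le toC_sum -cabsE; apply: le_trans (ler_norm_sum _ _ _) _.
by apply: ler_sum => i _; rewrite cabsE.
Qed.

Lemma cabs_toC x : 0 <= x -> cabs (toC x : C) = x.
Proof. by move=> x0; apply: toC_inj; rewrite -cabsE norm_toC. Qed.

Lemma cabs_eq0 (x : C) : (cabs x == 0) = (x == 0).
Proof. by rewrite -(normr_eq0 x) cabsE -toC0 (inj_eq (@toC_inj R)). Qed.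

Lemma cabs_nat n : cabs (n%:R : C) = n%:R.
Proof. by rewrite -toC_nat cabs_toC. Qed.

Lemma cvg_toC0 (u : nat -> C) (l : C) (v : nat -> R) :
  v @ \oo --> 0 -> (forall n, cabs (l - u n) <= v n) -> u @ \oo --> l.
Proof.
move=> v0 uv; apply/cvgrPdist_lt => e /pos_toC [x x0 ->].
have /cvgrPdist_lt /(_ _ x0) [N _ vN] := v0.
exists N => // n Nn /=; rewrite cabsE toC_lt.
have := vN n Nn; rewrite /= sub0r normrN => h.
by apply: le_lt_trans (uv n) _; apply: le_lt_trans h; apply: ler_norm.
Qed.

Lemma near_cabs (z : C) (r : R) (P : C -> Prop) : 0 < r ->
  (forall w, cabs (w - z) < r -> P w) -> \forall w \near z, P w.
Proof.
move=> r0 H; apply/nbhs_ballP; exists (toC r) => /=; first by rewrite -toC0 toC_lt.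
by move=> w; rewrite /ball /= distrC cabsE toC_lt; apply: H.
Qed.

Lemma cabs_near (z : C) (P : C -> Prop) : (\forall w \near z, P w) ->
  exists2 r : R, 0 < r & forall w, cabs (w - z) < r -> P w.
Proof.
move=> /nbhs_ballP [e /= /pos_toC [r r0 ->] H]; exists r => // w wr.
by apply: H; rewrite /ball /= distrC cabsE toC_lt.
Qed.

Lemma cvg_geo_half (B : R) : B * 2^-1 ^+ n @[n --> \oo] --> 0.
Proof.
rewrite -[X in _ --> X](mulr0 B); apply: cvgMr; apply: cvg_expr.
by rewrite ger0_norm ?invr_ge0 // invf_lt1 // ltr1n.
Qed.

(** The terms of degree at least M in the binomial expansion of (z + h)^n. *)
Lemma binom_tail (z h : C) (x d : R) n M : cabs z <= x -> cabs h <= d / 2 -> 0 <= d ->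
  cabs ((z + h) ^+ n - \sum_(0 <= k < M) ('C(n, k))%:R * z ^+ (n - k) * h ^+ k)
    <= 2^-1 ^+ M * (x + d) ^+ n.
Proof.
move=> zx hd d0; have x0 : 0 <= x := le_trans (cabs_ge0 _) zx.
pose N := maxn M n.+1.
have pad (u v : C) : (u + v) ^+ n = \sum_(0 <= k < N) ('C(n, k))%:R * u ^+ (n - k) * v ^+ k.
  rewrite exprDn (big_cat_nat (n := n.+1)) ?leq_maxr //= [X in _ = _ + X]big_nat.
  rewrite [X in _ = _ + X]big1 ?addr0 ?big_mkord => [|k /andP [nk _]].
    by apply: eq_bigr => k _; rewrite -mulr_natl mulrA.
  by rewrite bin_small // !mul0r.
have padR : (x + d) ^+ n = \sum_(0 <= k < N) ('C(n, k))%:R * x ^+ (n - k) * d ^+ k.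
  rewrite exprDn (big_cat_nat (n := n.+1)) ?leq_maxr //= [X in _ = _ + X]big_nat.
  rewrite [X in _ = _ + X]big1 ?addr0 ?big_mkord => [|k /andP [nk _]].
    by apply: eq_bigr => k _; rewrite -mulr_natl mulrA.
  by rewrite bin_small // !mul0r.
rewrite pad (big_cat_nat (n := M)) ?leq_maxl //= addrAC subrr add0r.
apply: le_trans (ler_cabs_sum _ _ _) _.
rewrite padR mulr_sumr [X in _ <= X](big_cat_nat (n := M)) ?leq_maxl //=.
rewrite -[X in X <= _]add0r; apply: lerD.
  by apply: sumr_ge0 => k _; rewrite !mulr_ge0 ?exprn_ge0 // invr_ge0.
rewrite !big_nat; apply: ler_sum => k /andP [Mk _].
rewrite !cabsM !cabsX cabs_nat -!mulrA [X in _ <= X]mulrCA ler_wpM2l //.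
rewrite [X in _ <= X]mulrCA; apply: ler_pM; rewrite ?exprn_ge0 ?cabs_ge0 //.
  by rewrite lerXn2r // nnegrE cabs_ge0.
apply: (@le_trans _ _ ((d / 2) ^+ k)).
  by rewrite lerXn2r // nnegrE ?cabs_ge0 // mulr_ge0 // invr_ge0.
rewrite exprMn mulrC ler_wpM2r ?exprn_ge0 //.
by rewrite ler_wiXn2l ?invr_ge0 // invf_le1 // ler1n.
Qed.

(** Existence of the k-th coefficient of the expansion at z. *)
Lemma psum_recenter (a : nat -> R) (x d L : R) (z : C) (k : nat) :
  (forall n, 0 <= a n) -> cabs z <= x -> 0 < d -> has_psum a (x + d) L ->
  exists c : C,
    series (fun n => toC (a n) * (('C(n, k))%:R * z ^+ (n - k))) @ \oo --> c.
Proof.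
move=> a0 zx d0 aL; have x0 : 0 <= x := le_trans (cabs_ge0 _) zx.
pose b n := a (n + k)%N * ('C(n + k, k))%:R.
have b0 n : 0 <= b n by rewrite mulr_ge0.
have [L' bL'] : exists L', has_psum b (cabs z) L'.
  apply: (nneg_psum_cvg (B := d ^- k * L)) => [//||M]; first exact: cabs_ge0.
  apply: le_trans (_ : d ^- k * series (fun n => a n * (x + d) ^+ n) (k + M)%N <= _).
    rewrite mulrC ler_pdivlMr ?exprn_gt0 //.
    rewrite /series /= [X in _ <= X](big_cat_nat (n := k)) ?leq_addr //=.
    rewrite -[X in X <= _]add0r lerD //.
      by apply: sumr_ge0 => i _; rewrite mulr_ge0 ?exprn_ge0 // addr_ge0 // ltW.
    have -> : \sum_(k <= i < k + M) a i * (x + d) ^+ i =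
        \sum_(0 <= i < M) a (i + k)%N * (x + d) ^+ (i + k).
      by rewrite -{1}[k]add0n [(k + M)%N]addnC big_addn addnK.
    rewrite mulr_suml; apply: ler_sum => i _.
    rewrite /b -!mulrA ler_wpM2l // exprDn.
    have ki : (k < (i + k).+1)%N by rewrite ltnS leq_addl.
    rewrite (bigD1 (Ordinal ki)) //= addnK.
    apply: (@le_trans _ _ (x ^+ i * d ^+ k *+ 'C(i + k, k))).
      rewrite -[X in _ <= X]mulr_natl ler_wpM2l // ler_wpM2r ?exprn_ge0 ?(ltW d0) //.
      by rewrite lerXn2r // nnegrE cabs_ge0.
    rewrite lerDl sumr_ge0 // => j _.
    by rewrite mulrn_wge0 // mulr_ge0 // exprn_ge0 // ltW.
  rewrite ler_wpM2l ?invr_ge0 ?exprn_ge0 ?(ltW d0) //.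
  by apply: nneg_psum_le => //; rewrite addr_ge0 // ltW.
have [c bc] := psum_complex b0 bL'; exists c.
rewrite -(cvg_shiftn k).
rewrite (_ : (fun n => _) = series (fun n => toC (b n) * z ^+ n)) //.
apply/funext => n; rewrite /series /= (big_cat_nat (n := k)) ?leq_addl //=.
rewrite big_nat big1 ?add0r => [|i /andP [_ ik]]; last first.
  by rewrite bin_small // mul0r mulr0.
rewrite -{1}[k]add0n big_addn addnK; apply: eq_bigr => i _.
by rewrite /b addnK toCM toC_nat mulrA.
Qed.

(** A power series with nonnegative coefficients is analytic in its disk of
    convergence: the error of the expansion at z truncated at order M is at most
    2^-M times the value of the real series at |z| + d. *)
Lemma analytic_psum (a : nat -> R) (rho : R) (G : C -> C) :
  (forall n, 0 <= a n) ->
  (forall r, 0 <= r < rho -> exists L, has_psum a r L) ->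
  (forall t, cabs t < rho -> has_psum (fun n => toC (a n)) t (G t)) ->
  forall z, cabs z < rho -> analytic_at G z.
Proof.
move=> a0 aL aG z zrho.
pose d := (rho - cabs z) / 2.
have d0 : 0 < d by rewrite divr_gt0 // subr_gt0.
have xd : 0 <= cabs z + d < rho.
  by rewrite addr_ge0 ?cabs_ge0 ?(ltW d0) //= /d; lra.
have [L aL'] := aL _ xd.
have /choice [c cP] : forall k, exists c : C,
    series (fun n => toC (a n) * (('C(n, k))%:R * z ^+ (n - k))) @ \oo --> c.
  by move=> k; apply: psum_recenter aL'.
(* For |h| < d / 2, terms of degree k in h gain a factor 2^-k against d^k. *)
exists c; apply: (near_cabs (r := d / 2)); first by rewrite divr_gt0.
move=> w; set h := w - z => hd.
have wE : w = z + h by rewrite /h addrC subrK.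
have wrho : cabs w < rho.
  rewrite wE; apply: le_lt_trans (ler_cabsD _ _) _.
  have := xd; lra.
apply: (@cvg_toC0 _ _ (fun M => L * 2^-1 ^+ M)); first exact: cvg_geo_half.
move=> M; rewrite -toC_le -cabsE.
pose T N := series (fun n => toC (a n) * w ^+ n) N -
  \sum_(0 <= k < M) series (fun n => toC (a n) * (('C(n, k))%:R * z ^+ (n - k))) N * h ^+ k.
have TG : T @ \oo --> G w - series (fun n => c n * h ^+ n) M.
  apply: cvgB; first exact: aG.
  apply: cvg_sum_seq => k; apply: cvgMl; exact: cP.
apply: cvg_norm_le TG _ => N.
rewrite cabsE toC_le.
have -> : T N = \sum_(0 <= n < N) toC (a n) *
     ((z + h) ^+ n - \sum_(0 <= k < M) ('C(n, k))%:R * z ^+ (n - k) * h ^+ k).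
  rewrite /T /series /= -wE.
  under [in RHS]eq_bigr => n _ do rewrite mulrBr mulr_sumr.
  rewrite sumrB exchange_big /=; congr (_ - _); apply: eq_bigr => k _.
  by rewrite mulr_suml; apply: eq_bigr => n _; rewrite !mulrA.
apply: le_trans (ler_cabs_sum _ _ _) _.
apply: (@le_trans _ _ (series (fun n => a n * (cabs z + d) ^+ n) N * 2^-1 ^+ M)).
  rewrite /series /= mulr_suml; apply: ler_sum => n _.
  rewrite cabsM cabs_toC // -mulrA ler_wpM2l // mulrC.
  by apply: binom_tail => //; apply: ltW.
rewrite ler_wpM2r ?exprn_ge0 ?invr_ge0 //.
by apply: nneg_psum_le => //; case/andP: xd.
Qed.

Lemma analyticZ (f : C -> C) (z s : C) :
  analytic_at f z -> analytic_at (fun w => s * f w) z.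
Proof.
move=> [c cf]; exists (fun n => s * c n).
apply: filterS cf => w cw; rewrite /has_psum.
rewrite (_ : series _ = (fun n => s * series (fun n => c n * (w - z) ^+ n) n)).
  exact: cvgMr.
by apply/funext => n; rewrite /series /= mulr_sumr; apply: eq_bigr => i _; rewrite mulrA.
Qed.

(** The coefficients in h of the quotient of the series with coefficients a by s - h. *)
Fixpoint quot_coef (a : nat -> C) (s : C) (n : nat) : C :=
  if n is m.+1 then (a n + quot_coef a s m) / s else a 0%N / s.

Lemma series_quot a (s h : C) M : s != 0 ->
  (s - h) * series (fun n => quot_coef a s n * h ^+ n) M.+1 =
  series (fun n => a n * h ^+ n) M.+1 - quot_coef a s M * h ^+ M.+1.
Proof.
move=> s0; elim: M => [|M IH].
  by rewrite /series /= !big_nat1 !mulr1 /=; field.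
move: IH; rewrite /series /= => IH.
by rewrite !(big_nat_recr M.+1) //= mulrDr IH (exprS h M.+1); field.
Qed.

Lemma quot_coef_le a (s : C) (r B : R) : 0 < r -> 2 * r <= cabs s ->
  (forall n, cabs (a n) * r ^+ n <= B) ->
  forall n, cabs (quot_coef a s n) * r ^+ n.+1 <= B.
Proof.
move=> r0 rs aB; have s0 : 0 < cabs s by apply: lt_le_trans rs; rewrite mulr_gt0.
have B0 : 0 <= B by apply: le_trans (aB 0%N); rewrite mulr_ge0 ?cabs_ge0 ?exprn_ge0 // ltW.
have step (u : C) n : cabs u * r ^+ n <= 2 * B -> cabs (u / s) * r ^+ n.+1 <= B.
  move=> uB; rewrite cabsM cabsV mulrAC ler_pdivrMr // exprSr mulrA.
  apply: (@le_trans _ _ (2 * B * r)); first by rewrite ler_wpM2r // ltW.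
  by rewrite mulrAC mulrC ler_wpM2l.
elim=> [|n IH]; apply: step.
  by apply: le_trans (aB 0%N) _; lra.
apply: (@le_trans _ _ ((cabs (a n.+1) + cabs (quot_coef a s n)) * r ^+ n.+1)).
  by rewrite ler_wpM2r ?exprn_ge0 ?(ltW r0) // ler_cabsD.
by rewrite mulrDl; move: (aB n.+1) IH; lra.
Qed.

(** The quotient of an analytic function by Q - w is analytic away from Q. *)
Lemma analytic_div (f : C -> C) (z Q : C) : z <> Q ->
  analytic_at f z -> analytic_at (fun w => f w / (Q - w)) z.
Proof.
move=> zQ [a af]; have [e e0 eP] := cabs_near af.
pose s := Q - z; have s0 : s != 0 by rewrite subr_eq0 eq_sym; apply/eqP.
have cs0 : 0 < cabs s by rewrite lt_neqAle cabs_ge0 eq_sym cabs_eq0 s0.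
pose r := Num.min (e / 2) (cabs s / 2).
have r0 : 0 < r by rewrite lt_min !divr_gt0.
have re : r < e by rewrite gt_min; apply/orP; left; lra.
have rs : 2 * r <= cabs s by rewrite mulrC -ler_pdivlMr // ge_min lexx orbT.
have [B aB] : exists B, forall n, cabs (a n) * r ^+ n <= B.
  have /eP : cabs (z + toC r - z) < e by rewrite addrC addKr cabs_toC // ltW.
  rewrite addrC addKr => ps.
  have : cvgn (series (fun n => a n * toC r ^+ n)) by apply/cvg_ex; eexists; exact: ps.
  move/cvg_series_cvg_0 => t0.
  have /cvgrPdist_lt /(_ 1 ltr01) [N _ tN] := t0.
  exists (1 + \sum_(i < N) cabs (a i) * r ^+ i) => n.
  have b0 (m : 'I_N) : 0 <= cabs (a m) * r ^+ m by rewrite mulr_ge0 ?cabs_ge0 ?exprn_ge0 // ltW.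
  case: (leqP N n) => [/tN|nN].
    rewrite /= sub0r normrN cabsE -toC1 toC_lt cabsM cabsX cabs_toC ?(ltW r0) // => h.
    by apply: (le_trans (ltW h)); rewrite lerDl sumr_ge0.
  by rewrite (bigD1 (Ordinal nN)) //= addrCA lerDl addr_ge0 // sumr_ge0.
exists (quot_coef a s).
apply: (near_cabs (r := r / 2)); first by rewrite divr_gt0.
move=> w; set h := w - z => hr.
have sh : s - h = Q - w by rewrite /s /h; ring.
have sh0 : s - h != 0.
  apply/eqP => /subr0_eq sE; move: hr; rewrite -sE.
  by move: rs r0; lra.
have aw := eP w (lt_trans hr (lt_trans _ re)).
rewrite -sh /has_psum -(cvg_shiftn 1).
have -> : (fun n => series (fun i => quot_coef a s i * h ^+ i) (n + 1)%N) =
   (fun n => (series (fun i => a i * h ^+ i) (n + 1)%N - quot_coef a s n * h ^+ n.+1) / (s - h)).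
  by apply/funext => n; rewrite addn1 -series_quot // mulrC mulKf.
apply: cvgMl; rewrite -[X in _ --> X]subr0; apply: cvgB.
  by rewrite (cvg_shiftn 1 (series (fun i => a i * h ^+ i))); apply: aw; lra.
apply: (cvg_toC0 (cvg_geo_half (B / 2))) => n.
rewrite sub0r (_ : cabs (- _) = cabs (quot_coef a s n * h ^+ n.+1)); last first.
  by apply: toC_inj; rewrite -!cabsE normrN.
rewrite cabsM cabsX.
apply: (@le_trans _ _ (cabs (quot_coef a s n) * (r / 2) ^+ n.+1)).
  by rewrite ler_wpM2l ?cabs_ge0 // lerXn2r ?nnegrE ?cabs_ge0 ?(ltW hr) // divr_ge0 // ltW.
rewrite exprMn mulrA (exprS (2^-1)) mulrA ler_wpM2r ?exprn_ge0 ?invr_ge0 //.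
rewrite ler_wpM2r ?invr_ge0 //.
exact: quot_coef_le.
Qed.

End Analytic.

(** * Unconditional products and the weights of the generating function *)

Section InfiniteProducts.

Variable R : realType.
Local Notation C := (Cplx R).

Lemma has_prod_unique (I : choiceType) (P : pred I) (f : I -> C) l l' :
  has_prod P f l -> has_prod P f l' -> l = l'.
Proof.
move=> fl fl'; apply/eqP; rewrite -subr_eq0 -normr_eq0; apply/negP => /negP n0.
have e0 : 0 < `|l - l'| / 2 by rewrite divr_gt0 // lt_neqAle eq_sym n0 normr_ge0.
have [J1 H1] := fl _ e0; have [J2 H2] := fl' _ e0.
have h1 := H1 _ (fsubsetUl J1 J2); have h2 := H2 _ (fsubsetUr J1 J2).
have := ler_normB (\prod_(i <- (J1 `|` J2)%fset | P i) f i - l')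
                  (\prod_(i <- (J1 `|` J2)%fset | P i) f i - l).
rewrite opprB addrC addrA subrK => h.
have := le_lt_trans h (ltrD h2 h1).
by rewrite -mulr2n -[X in _ < X]mulr_natr mulfVK ?pnatr_eq0 // ltxx.
Qed.

Lemma has_prodM (I : choiceType) (P1 P2 : pred I) (f : I -> C) l1 l2 :
  (forall x, ~~ (P1 x && P2 x)) ->
  has_prod P1 f l1 -> has_prod P2 f l2 -> has_prod (predU P1 P2) f (l1 * l2).
Proof.
move=> dis f1 f2 e /pos_toC [e' e'0 ->].
pose D := cabs l1 + cabs l2 + 1.
have D0 : 0 < D by rewrite ltr_wpDl // addr_ge0 // cabs_ge0.
pose d := Num.min 1 (e' / D / 2).
have d0 : 0 < d by rewrite lt_min ltr01 /= !divr_gt0.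
have d1 : d <= 1 by rewrite ge_min lexx.
have de : d * D < e'.
  apply: (@le_lt_trans _ _ (e' / D / 2 * D)).
    by rewrite ler_wpM2r ?(ltW D0) // ge_min lexx orbT.
  rewrite mulrAC mulfVK ?gt_eqF //; lra.
have d0C : 0 < toC d by rewrite -toC0 toC_lt.
have [J1 H1] := f1 _ d0C; have [J2 H2] := f2 _ d0C.
exists (J1 `|` J2)%fset => J sJ.
have := H1 J (fsubset_trans (fsubsetUl _ _) sJ).
have := H2 J (fsubset_trans (fsubsetUr _ _) sJ).
have -> : \prod_(i <- J | predU P1 P2 i) f i =
    (\prod_(i <- J | P1 i) f i) * \prod_(i <- J | P2 i) f i.
  rewrite (bigID P1) /=; congr (_ * _); apply: eq_bigl => x.
    by rewrite andb_orl andbb orb_idr // => /andP [].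
  by have := dis x; case: (P1 x); case: (P2 x).
set a := \prod_(i <- J | P1 i) _; set b := \prod_(i <- J | P2 i) _.
rewrite !cabsE !toC_lt => hb ha.
have -> : a * b - l1 * l2 = (a - l1) * (b - l2) + (a - l1) * l2 + l1 * (b - l2) by ring.
apply: le_lt_trans de.
apply: le_trans (ler_cabsD _ _) _; apply: le_trans (lerD (ler_cabsD _ _) (lexx _)) _.
rewrite !cabsM /D.
have h1 : cabs (a - l1) * cabs (b - l2) <= d * 1.
  by apply: ler_pM; rewrite ?cabs_ge0 // ?ltW // (lt_le_trans hb).
have h2 : cabs (a - l1) * cabs l2 <= d * cabs l2 by rewrite ler_wpM2r ?cabs_ge0 // ltW.
have h3 : cabs l1 * cabs (b - l2) <= d * cabs l1 by rewrite mulrC ler_wpM2r ?cabs_ge0 // ltW.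
rewrite mulr1 in h1; rewrite !mulrDr mulr1; lra.
Qed.

(** An unconditional product over a countable set is also the limit of its partial
    products in any enumeration g. *)
Lemma has_prod_seq_of (I : choiceType) (P : pred I) (g : nat -> I) (f : I -> C) l :
  injective g -> (forall n, P (g n)) -> (forall x, P x -> exists n, x = g n) ->
  has_prod P f l -> has_prod_seq (fun n => f (g n)) l.
Proof.
move=> g_inj Pg gP fl; apply/cvgrPdist_lt => e e0.
have [J0 HJ] := fl e e0.
have bound (s : seq I) : exists N0, forall x, x \in s -> P x -> exists2 n, (n < N0)%N & x = g n.
  elim: s => [|x s [N0 IH]]; first by exists 0%N.
  case Px : (P x); last first.
    exists N0 => z; rewrite inE => /orP [/eqP ->|/IH//]; by rewrite Px.
  have [n xn] := gP _ Px; exists (maxn N0 n.+1) => z.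
  rewrite inE => /orP [/eqP -> _|zs Pz]; first by exists n; rewrite ?leq_maxr.
  have [n' n'N ->] := IH z zs Pz; exists n' => //.
  by rewrite (leq_trans n'N) // leq_maxl.
have [N0 hN0] := bound J0.
exists N0 => // N N0N /=.
have := HJ _ (fsubsetUl J0 [fset x in [seq g n | n <- iota 0 N]]%fset).
rewrite distrC -big_filter (perm_big [seq g n | n <- iota 0 N]).
  by rewrite big_map /index_iota subn0.
apply: uniq_perm; first by rewrite filter_uniq // fset_uniq.
  by rewrite map_inj_uniq // iota_uniq.
move=> x; rewrite mem_filter inE /= in_fset /=; apply/andP/idP => [[Px /orP [xJ|//]]|xs].
  have [n nN ->] := hN0 x xJ Px; apply: map_f.
  by rewrite mem_iota (leq_trans nN).
split; last by rewrite xs orbT.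
by have /mapP [n _ ->] := xs.
Qed.

Lemma eq_has_prod (I : choiceType) (P P' : pred I) (f f' : I -> C) l :
  P =1 P' -> f =1 f' -> has_prod P f l -> has_prod P' f' l.
Proof.
move=> PP' ff' fl e e0; have [J0 HJ] := fl e e0; exists J0 => J /HJ.
by rewrite (eq_bigl _ _ PP') (eq_bigr _ (fun x _ => ff' x)).
Qed.

End InfiniteProducts.

Section Weights.

Variables (R : realType) (q : nat).
Hypothesis q1 : (1 < q)%N.
Local Notation I := (nat * nat * nat)%type.
Local Notation qi := ((q%:R : R)^-1).

(** The weight q^-(i + j + 2 m - 1) of the triple (m, i, j). *)
Definition wt (x : I) : R := qi ^+ (x.1.2 + x.2 + 2 * x.1.1 - 1).

(** The triples with m in S. For m = 1 only j = 0 is kept, which gives the factors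
    1 / (1 - q^-(i+1) t) of the first product. *)
Definition idx_in (S : pred nat) (x : I) : bool :=
  [&& S x.1.1, (0 < x.1.1)%N & (x.1.1 == 1%N) ==> (x.2 == 0%N)].

(** The contribution to N times the coefficient of t^N in the logarithm of the
    product of all factors of exponent m, where m divides N: a geometric series
    over i for m = 1, and over i and j for m > 1. *)
Definition logterm (m N : nat) : R :=
  if m == 1%N then qi ^+ N / (1 - qi ^+ N)
  else m%:R * (qi ^+ (N %/ m)) ^+ (2 * m - 1) / (1 - qi ^+ (N %/ m)) ^+ 2.

(** N times the coefficient of t^N in the logarithm of the product of the factors with
    index in idx_in S. *)
Definition logcoef (S : pred nat) (N : nat) : R :=
  \sum_(m < N.+1 | [&& S m, (0 < m)%N & (m %| N)%N]) (if (0 < N)%N then logterm m N else 0).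

Lemma q0R : 0 < (q%:R : R). Proof. by rewrite ltr0n ltnW. Qed.
Lemma qi_ge0 : 0 <= qi. Proof. by rewrite invr_ge0. Qed.
Lemma qi_le_half : qi <= 2^-1.
Proof. by rewrite lef_pV2 ?posrE ?q0R // ler_nat. Qed.
Lemma qi_lt1 : qi < 1.
Proof. by rewrite invf_lt1 ?q0R // ltr1n. Qed.

Lemma wt_ge0 x : 0 <= wt x. Proof. exact: exprn_ge0 qi_ge0. Qed.

Lemma idx_in_gt0 S x : idx_in S x -> (0 < tdeg x)%N. Proof. by case/and3P. Qed.

Lemma cvg_geo (y : R) : 0 <= y < 1 -> \sum_(0 <= i < M) y ^+ i @[M --> \oo] --> (1 - y)^-1.
Proof.
move=> /andP [y0 y1]; have y1' : 1 - y != 0 by rewrite subr_eq0 gt_eqF.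
have -> : (fun M => \sum_(0 <= i < M) y ^+ i) = (fun M => (1 - y ^+ M) / (1 - y)).
  apply/funext => M; rewrite big_mkord.
  have -> : 1 - y ^+ M = (1 - y) * \sum_(i < M) y ^+ i.
    by rewrite -[LHS]opprB subrX1 -mulNr opprB.
  by rewrite mulrC mulKf.
suff : (1 - y ^+ M) / (1 - y) @[M --> \oo] --> (1 - 0) / (1 - y) by rewrite subr0 mul1r.
apply: cvgMl; apply: cvgB.
  exact: cvg_cst.
by apply: cvg_expr; rewrite ger0_norm.
Qed.

Lemma pfun_boxE S N M : (0 < N < M)%N -> pfun wt tdeg (boxP (idx_in S) M) N =
  \sum_(m < N.+1 | [&& S m, (0 < m)%N & (m %| N)%N])
    (if m == 1%N :> nat then \sum_(0 <= i < M) (qi ^+ N) ^+ i.+1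
     else m%:R * (qi ^+ (N %/ m)) ^+ (2 * m - 1) * (\sum_(0 <= i < M) (qi ^+ (N %/ m)) ^+ i) ^+ 2).
Proof.
move=> /andP [N0 NM]; rewrite /pfun big_filter big_mkcond big_box /=.
rewrite (big_cat_nat (n := N.+1)) //= [X in _ + X]big_nat [X in _ + X]big1 ?addr0; last first.
  move=> m /andP [Nm _]; rewrite big1 // => i _; rewrite big1 // => j _.
  by rewrite /delta /tdeg /= gtnNdvd // andbF; case: ifP.
rewrite big_mkord [RHS]big_mkcond; apply: eq_bigr => m _.
rewrite /idx_in /= /delta N0 /tdeg /=.
case Sm : (S m) => /=; last by rewrite big1 // => i _; rewrite big1.
case m0 : (0 < m)%N => /=; last by rewrite big1 // => i _; rewrite big1.
case mN : (m %| N)%N; last by rewrite big1 // => i _; rewrite big1 // => j _; case: ifP.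
case: eqVneq => [->|m1] /=.
  apply: eq_bigr => i _; rewrite big_ltn ?(ltn_trans N0 NM) // big_nat big1 ?addr0.
    by rewrite /= mul1r divn1 /wt /= -!exprM; congr (_ ^+ _); lia.
  by move=> j /andP [j0 _]; rewrite gtn_eqF.
rewrite expr2 big_distrlr /= mulr_sumr; apply: eq_bigr => i _.
rewrite mulr_sumr; apply: eq_bigr => j _.
rewrite -mulrA; congr (_ * _); rewrite /wt /= -!exprM -!exprD; congr (_ ^+ _).
rewrite -addnBA ?muln_gt0 ?m0 //; ring.
Qed.

Lemma cvg_pfun S N : pfun wt tdeg (boxP (idx_in S) M) N @[M --> \oo] --> logcoef S N.
Proof.
case: (posnP N) => [->|N0].
  rewrite /logcoef big1 //.
  rewrite (_ : (fun M => _) = fun=> 0); first exact: cvg_cst.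
  apply/funext => M; rewrite /pfun big1 // => x _; by rewrite /delta ltnn.
rewrite -(cvg_shiftn N.+1) /=.
pose u M (m : 'I_N.+1) : R := if [&& S m, (0 < m)%N & (m %| N)%N] then
  (if m == 1%N :> nat then \sum_(0 <= i < M) (qi ^+ N) ^+ i.+1
   else m%:R * (qi ^+ (N %/ m)) ^+ (2 * m - 1) * (\sum_(0 <= i < M) (qi ^+ (N %/ m)) ^+ i) ^+ 2) else 0.
have -> : (fun M => pfun wt tdeg (boxP (idx_in S) (M + N.+1)) N) =
    (fun M => \sum_(m < N.+1) u (M + N.+1)%N m).
  by apply/funext => M; rewrite pfun_boxE ?N0 ?leq_addl // big_mkcond.
rewrite (cvg_shiftn N.+1 (fun M => \sum_(m < N.+1) u M m)).
rewrite /logcoef big_mkcond; apply: cvg_sum_seq => m; rewrite /u N0.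
case: ifP => [/and3P [_ m0 mN]|_]; last exact: cvg_cst.
have qiX (n : nat) : (0 < n)%N -> 0 <= qi ^+ n < 1.
  by move=> n0; rewrite exprn_ge0 ?qi_ge0 //= exprn_ilt1 ?qi_ge0 ?qi_lt1 // -lt0n.
rewrite /logterm; case: ifP => _.
  under eq_fun do (under eq_bigr do rewrite exprS; rewrite -mulr_sumr).
  by apply: cvgMr; apply: cvg_geo; apply: qiX.
apply: cvgMr; rewrite -exprVn !expr2.
have geo := cvg_geo (qiX (N %/ m)%N _).
by under eq_fun do rewrite expr2; apply: cvgM; apply: geo; rewrite divn_gt0 // dvdn_leq.
Qed.

Lemma cvg_pfun_remove (P : pred I) x0 (p : nat -> R) : P x0 ->
  (forall N, pfun wt tdeg (boxP P M) N @[M --> \oo] --> p N) ->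
  forall N, pfun wt tdeg (boxP (predD1 P x0) M) N @[M --> \oo] -->
    p N - delta (tdeg x0) (wt x0) N.
Proof.
move=> Px0 pP N; have [M0 hM0] := sub_some_box [:: x0].
rewrite -(cvg_shiftn M0) /=.
have -> : (fun M => pfun wt tdeg (boxP (predD1 P x0) (M + M0)) N) =
    (fun M => pfun wt tdeg (boxP P (M + M0)) N - delta (tdeg x0) (wt x0) N).
  apply/funext => M; rewrite /pfun !big_filter.
  have x0M : x0 \in box (M + M0) by apply: box_sub (hM0 _ (mem_head _ _)); rewrite leq_addl.
  rewrite [in RHS]big_mkcond (bigD1_seq x0) ?box_uniq //= Px0 addrAC subrr add0r.
  exact: big_mkcondr.
apply: cvgB; last exact: cvg_cst.
by rewrite (cvg_shiftn M0 (fun M => pfun wt tdeg (boxP P M) N)); apply: pP.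
Qed.

Lemma wt_bound (r : R) x : (0 < tdeg x)%N -> 0 <= r < 1 ->
  wt x * r ^+ tdeg x <= r /\
  wt x * r ^+ tdeg x <= 2 * r ^+ x.1.1 * 2^-1 ^+ x.1.2 * 2^-1 ^+ x.2.
Proof.
case: x => [[m i] j]; rewrite /tdeg /wt /= => m0 /andP [r0 r1]; split.
  rewrite -[X in _ <= X]mul1r; apply: ler_pM; rewrite ?exprn_ge0 ?qi_ge0 //.
    by rewrite exprn_ile1 ?qi_ge0 // ltW ?qi_lt1.
  by rewrite -[X in _ <= X]expr1 ler_wiXn2l // ltW.
apply: (@le_trans _ _ (2^-1 ^+ i * 2^-1 ^+ j * r ^+ m)); last first.
  have -> : 2 * r ^+ m * 2^-1 ^+ i * 2^-1 ^+ j = 2 * (2^-1 ^+ i * 2^-1 ^+ j * r ^+ m) by ring.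
  by rewrite ler_peMl ?ler1n // !mulr_ge0 ?exprn_ge0 ?invr_ge0.
rewrite ler_wpM2r ?exprn_ge0 // -exprD.
apply: (@le_trans _ _ (qi ^+ (i + j))).
  by rewrite ler_wiXn2l ?qi_ge0 ?(ltW qi_lt1) // -addnBA ?muln_gt0 // leq_addr.
by rewrite lerXn2r ?nnegrE ?invr_ge0 ?qi_ge0 // qi_le_half.
Qed.

(** Apart from the factor 1 - t / q, whose index is (1, 0, 0), all the factors are under
    control up to the radius rho = q^(3/2). *)
Lemma wt_bound_big (rho r : R) x : 0 < rho -> rho ^+ 2 = q%:R ^+ 3 ->
  idx_in predT x -> x != (1%N, 0%N, 0%N) -> 0 <= r < rho ->
  wt x * r ^+ tdeg x <= r / rho /\
  wt x * r ^+ tdeg x <= 2 * (r / rho) ^+ x.1.1 * 2^-1 ^+ x.1.2 * 2^-1 ^+ x.2.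
Proof.
move=> rho0 rho2; case: x => [[m i] j]; rewrite /idx_in /tdeg /wt /= => /andP [m0 mj] xn /andP [r0 rr].
pose y := r / rho; have y0 : 0 <= y by rewrite divr_ge0 // ltW.
have y1 : y < 1 by rewrite ltr_pdivrMr // mul1r.
(* With c = q^(-1/2), a weight of exponent m >= 2 is at most c^(m-2) at radius rho. *)
pose c := rho * qi ^+ 2.
have q0 : (q%:R : R) != 0 by rewrite gt_eqF ?q0R.
have c0 : 0 <= c by rewrite mulr_ge0 ?exprn_ge0 ?qi_ge0 // ltW.
have c2 : c ^+ 2 = qi by rewrite exprMn rho2; field.
have c1 : c <= 1.
  by rewrite -(@expr_le1 _ 2) // c2 ltW ?qi_lt1.
have rE : r = y * (c * q%:R ^+ 2).
  by rewrite /y /c; field; rewrite q0 gt_eqF.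
rewrite -/y.
have half0 n : 0 <= (2^-1 : R) ^+ n by rewrite exprn_ge0 // invr_ge0.
have qihalf n : qi ^+ n <= 2^-1 ^+ n.
  by rewrite lerXn2r ?nnegrE ?invr_ge0 ?qi_ge0 // qi_le_half.
have ym : y ^+ m <= y by rewrite -[X in _ <= X]expr1 ler_wiXn2l // ltW.
case: (ltnP 1 m) => m1.
  have [u mu] : exists u, m = u.+2 by exists (m - 2)%N; rewrite -addn2 subnK.
  have E : qi ^+ (i + j + 2 * m - 1) * r ^+ m = qi ^+ (i + j) * c ^+ u * y ^+ m.
    have -> : (i + j + 2 * m - 1 = i + j + (2 * u + 3))%N by clear -mu; lia.
    have e : qi ^+ (2 * u + 3) * qi * q%:R ^+ (2 * m) = 1.
      rewrite -exprSr (_ : (2 * u + 3).+1 = (2 * m)%N); last by clear -mu; lia.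
      by rewrite -exprMn mulVf // expr1n.
    have cm : c ^+ m = c ^+ u * qi by rewrite mu -addn2 exprD c2.
    have rm : r ^+ m = y ^+ m * (c ^+ m * q%:R ^+ (2 * m)).
      by clearbody y c; rewrite {1}rE 2!exprMn -exprM.
    rewrite rm cm exprD.
    have := congr1 ( *%R (qi ^+ (i + j) * c ^+ u * y ^+ m)) e.
    by rewrite mulr1 => <-; clear; ring.
  have B : qi ^+ (i + j) * c ^+ u * y ^+ m <= 2^-1 ^+ i * 2^-1 ^+ j * y ^+ m.
    rewrite ler_wpM2r ?exprn_ge0 // -exprD -[X in _ <= X]mulr1.
    by apply: ler_pM; rewrite ?exprn_ge0 ?qi_ge0 // exprn_ile1.
  rewrite E; split; apply: (le_trans B).
    apply: le_trans ym; rewrite -[X in _ <= X]mul1r ler_wpM2r ?exprn_ge0 // -exprD.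
    by rewrite exprn_ile1 ?invr_ge0 // invf_le1 // ler1n.
  have -> : 2 * y ^+ m * 2^-1 ^+ i * 2^-1 ^+ j = 2 * (2^-1 ^+ i * 2^-1 ^+ j * y ^+ m) by ring.
  by rewrite ler_peMl ?ler1n // !mulr_ge0 ?exprn_ge0.
have mE : m = 1%N by clear -m0 m1; lia.
move: mj xn; rewrite {}mE /= => /eqP ->; case: i => [|i] // _.
have -> : qi ^+ (i.+1 + 0 + 2 * 1 - 1) * r ^+ 1 = qi ^+ i * c * y.
  rewrite (_ : (i.+1 + 0 + 2 * 1 - 1 = i + 2)%N); last by clear; lia.
  by rewrite rE exprD; field.
have B : qi ^+ i * c * y <= 2^-1 ^+ i * y.
  rewrite ler_wpM2r // -[X in _ <= X]mulr1.
  by apply: ler_pM; rewrite ?exprn_ge0 ?qi_ge0.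
split; apply: (le_trans B).
  by rewrite -[X in _ <= X]mul1r ler_wpM2r // exprn_ile1 ?invr_ge0 // invf_le1 // ler1n.
rewrite expr1 expr0 mulr1 exprS [X in _ <= X](_ : _ = 2^-1 ^+ i * y) //.
by field.
Qed.

End Weights.

(** * The generating function *)

Section Assembly.

Variables (R : realType) (k : finFieldType).
Local Notation q := #|k|.
Local Notation C := (Cplx R).
Local Notation I := (nat * nat * nat)%type.

(** The term of degree d in card_Icyc gives the factors of exponent m = N / d. *)
Lemma logterm_kappa d m : (0 < d)%N -> (0 < m)%N ->
  (d * m)%:R * ((q ^ (d * m) - q ^ (d * m - d)) * (d * kappa k d m))%N%:R^-1
    = logterm R q m (d * m).
Proof.
move=> d0 m0; have q1 : (1 < q)%N := finNzRing_gt1 k.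
have q0 : (q%:R : R) != 0 by rewrite pnatr_eq0 -lt0n ltnW.
pose z : R := q%:R ^+ d.
have z0 : z != 0 by rewrite expf_neq0.
have z1 : z - 1 != 0 by rewrite subr_eq0 gt_eqF // exprn_egt1 ?ltr1n // -lt0n.
have dR : (d%:R : R) != 0 by rewrite pnatr_eq0 -lt0n.
have qz : (q%:R : R)^-1 ^+ d = z^-1 by rewrite exprVn.
rewrite /logterm /kappa; case: eqVneq => [->|m1].
  rewrite !muln1 subnn natrM natrB ?expn_gt0 ?(ltnW q1) // !natrX expr0 -/z qz.
  by field; rewrite z0 z1 dR.
have [u ->] : exists u, m = u.+2 by exists (m - 2)%N; clear -m0 m1; lia.
rewrite mulnK //= qz.
have zX n : (q ^ (d * n))%:R = z ^+ n :> R by rewrite natrX exprM.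
rewrite -{4}[d]muln1 -mulnBr !natrM natrB ?leq_pexp2l ?(ltnW q1) ?leq_mul2l ?leq_subr ?orbT //.
rewrite natrB ?leq_pexp2l ?(ltnW q1) ?leq_mul2l ?leqnSn ?orbT // !zX.
have uR : (u.+2%:R : R) != 0 by rewrite pnatr_eq0.
rewrite subSS subn0 (_ : (2 * u.+2 - 1 = u + u + 3)%N); last by clear; lia.
rewrite !exprVn exprD exprD !exprSr.
have : z ^+ u != 0 by rewrite expf_neq0.
move: (z ^+ u) => w w0; rewrite !expr0 !mul1r.
have e1 : w * z - w = w * (z - 1) by ring.
have e2 : w * z * z - w * z = w * z * (z - 1) by ring.
by field; rewrite z0 z1 w0 dR e1 e2 !mulf_neq0.
Qed.

Lemma logcoef_Icyc n :
  n.+1%:R * (#|Icyc k n.+1|%:R / #|GLmx k n.+1|%:R) = logcoef R q predT n.+1.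
Proof.
rewrite card_Icyc mulr_sumr /logcoef /=; set N := n.+1.
pose g (d : 'I_N.+1) : 'I_N.+1 := inord (N %/ d).
have gE d : g d = (N %/ d)%N :> nat by rewrite inordK // ltnS leq_div.
have gK (d : 'I_N.+1) : (0 < d)%N && (d %| N)%N -> g (g d) = d.
  move=> /andP [d0 dN]; apply/val_inj; rewrite /= !gE.
  by rewrite -{1}(divnK dN) mulKn // divn_gt0 // dvdn_leq.
have dvd_div d : (d %| N)%N -> (N %/ d %| N)%N.
  by move=> dN; apply/dvdnP; exists d; rewrite mulnC divnK.
have div_gt0 d : (d %| N)%N -> (0 < N %/ d)%N.
  by move=> /dvd_div; case: posnP => // ->; rewrite dvd0n.
rewrite [LHS](reindex_onto g g) => [|d]; last exact: gK.
apply: eq_big => [d|d /andP [/andP [gd0 gdN] /eqP ggd]] /=.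
  apply/andP/idP => [[/andP [h1 h2] /eqP <-]|h].
    by rewrite gE div_gt0 // dvd_div.
  have /andP [d0 dN] := h; rewrite gK // eqxx; split=> //.
  by rewrite !gE div_gt0 // dvd_div.
have e : (N %/ g d)%N = d by rewrite -gE ggd.
have d0 : (0 < d)%N by rewrite -e div_gt0.
have Ndm : (g d * d)%N = N by rewrite -{1}e mulnC divnK.
have := logterm_kappa gd0 d0; rewrite Ndm => <-.
by rewrite e.
Qed.

(** A field with more than two elements has a scalar as needed by comps. *)
Lemma two_scalars : (2 < q)%N -> exists lam : k, (lam != 0) && (lam != 1).
Proof.
move=> q2; apply/existsP; apply: contraLR q2; rewrite negb_exists => /forallP H.
have h : (#|k| <= #|[set (0%R : k); 1%R]%SET|)%N.
  apply/subset_leq_card/fintype.subsetP => x _; rewrite in_set2.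
  by have := H x; rewrite negb_and !negbK.
by rewrite -leqNgt (leq_trans h) // cards2 ltnS leq_b1.
Qed.

Lemma card_GLmx0 : #|GLmx k 0| = 1%N.
Proof.
apply/eqP; rewrite eqn_leq GLmx_card_gt0 andbT.
by apply: leq_trans (max_card _) _; rewrite card_mx.
Qed.

(** The numbers a_n are the coefficients of the infinite product. *)
Lemma coefA_expo : (2 < q)%N -> @coefA k R =1 expo (logcoef R q predT).
Proof.
move=> /two_scalars [lam /andP [lam0 lam1]].
have cE n : @coefA k R n = #|calAm k n|%:R / #|GLmx k n|%:R.
  case: n => [|n] /=; first by rewrite card_calAm0 card_GLmx0 divr1.
  by rewrite card_calA card_GL.
apply: expo_unique => // n; rewrite cE (calAm_recursion lam0 lam1) big_ord_recl mul0r mul0r add0r.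
apply: eq_bigr => N _; rewrite lift0 subSS cE; congr (_ * _).
exact: logcoef_Icyc.
Qed.

Lemma coefA_toC n : @coefA k C n = toC (@coefA k R n).
Proof. by case: n => [|n] //=; rewrite toCM toCV !toC_nat. Qed.

(** The sequences p and p' belong to the product over all the factors and to the
    product over the factors other than 1 / (1 - t / q), whose indices form P'. *)
Local Notation p := (logcoef R q predT).
Local Notation p' := (fun N => p N - delta 1 (q%:R : R)^-1 N).
Local Notation P' := (predD1 (idx_in predT) (1%N, 0%N, 0%N)).

Let q1 : (1 < q)%N. Proof. exact: finNzRing_gt1. Qed.

Lemma cvg_reduced N : pfun (wt R q) tdeg (boxP P' M) N @[M --> \oo] --> p' N.
Proof.
have pP (n : nat) : pfun (wt R q) tdeg (boxP (idx_in predT) M) n @[M --> \oo] --> p n.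
  exact: cvg_pfun.
exact: (@cvg_pfun_remove R q (idx_in predT) (1%N, 0%N, 0%N) p isT pP N).
Qed.

Lemma reduced_gt0 x : P' x -> (0 < tdeg x)%N.
Proof. by move=> /andP [_ /idx_in_gt0]. Qed.

Section Radius.

Variable rho : R.
Hypotheses (rho0 : 0 < rho) (rho2 : rho ^+ 2 = q%:R ^+ 3).

Lemma ratio01 r : 0 <= r < rho -> 0 <= r / rho < 1.
Proof. by move=> /andP [r0 rr]; rewrite divr_ge0 ?(ltW rho0) //= ltr_pdivrMr // mul1r. Qed.

Lemma reduced_bound r : 0 <= r < rho -> forall x, P' x ->
  wt R q x * r ^+ tdeg x <= r / rho /\
  wt R q x * r ^+ tdeg x <= 2 * (r / rho) ^+ x.1.1 * 2^-1 ^+ x.1.2 * 2^-1 ^+ x.2.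
Proof. by move=> rr x /andP [xn Px]; apply: wt_bound_big. Qed.

Lemma psum_reduced_real r : 0 <= r < rho -> exists L, has_psum (expo p') r L.
Proof.
move=> rr; have r0 : 0 <= r by case/andP: rr.
have [L [pL _ _]] := box_real (@wt_ge0 R q) reduced_gt0 cvg_reduced r0 (ratio01 rr)
  (fun x Px => proj1 (reduced_bound rr Px)) (fun x Px => proj2 (reduced_bound rr Px)).
by exists L.
Qed.

Lemma psum_reduced_complex (t : C) : cabs t < rho ->
  exists l, has_psum (fun n => toC (expo p' n)) t l.
Proof.
move=> tr; have rr : 0 <= cabs t < rho by rewrite cabs_ge0.
have [L pL] := psum_reduced_real rr.
by apply: psum_complex pL; apply: expo_ge0; apply: (pfun_lim_ge0 (@wt_ge0 R q) cvg_reduced).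
Qed.

End Radius.

Lemma psum_idx S (t : C) : cabs t < 1 ->
  exists l, has_psum (fun n => toC (expo (logcoef R q S) n)) t l /\
    has_prod (idx_in S) (fun x => (1 - toC (wt R q x) * t ^+ tdeg x)^-1) l.
Proof.
move=> t1; have t01 : 0 <= cabs t < 1 by rewrite cabs_ge0.
apply: (box_complex (@wt_ge0 R q) (@idx_in_gt0 S) (fun N => @cvg_pfun R q q1 S N) t01).
  by move=> x /idx_in_gt0 x0; have [] := wt_bound q1 x0 t01.
by move=> x /idx_in_gt0 x0; have [] := wt_bound q1 x0 t01.
Qed.

Lemma expo_split_pole n : toC (expo p n) =
  toC (expo p' n) + (if (1 <= n)%N then toC (q%:R)^-1 * toC (expo p (n - 1)) else 0) :> C.
Proof.
have E : expo p =1 expo (fun N => p' N + delta 1 (q%:R)^-1 N).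
  by apply: eq_expo => N _; rewrite subrK.
by rewrite E expo_factor // toCD; case: ifP => _; rewrite ?toCM -?E.
Qed.

End Assembly.

Local Open Scope complex_scope.
Local Open Scope ring_scope.

Theorem theorem1p8 (R : realType) (q : nat) (k : finFieldType)
    (hk : #|k| = q) (hq : (2 < q)%N) :
  let Q : Cplx R := q%:R in
  let D : set (Cplx R) := ball (0 : Cplx R) ((q%:R : R) `^ (3%:R / 2%:R))%:C in
  exists F : Cplx R -> Cplx R,
    [/\ (\forall t \near (0 : Cplx R), has_psum (@coefA k (Cplx R)) t (F t)),
        (\forall t \near (0 : Cplx R), exists P1 P2 : Cplx R,
           [/\ has_prod_seq (fun i => (1 - Q ^- i.+1 * t)^-1) P1,
               has_prod (fun x : nat * nat * nat => (2 <= x.1.1)%N)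
                 (fun x => let: (m, i, j) := x in
                    (1 - Q ^- (i + j + 2 * m - 1)%N * t ^+ m)^-1) P2 &
               F t = P1 * P2]),
        analytic_on (D `\ Q) F,
        simple_pole F Q &
        exists2 G : Cplx R -> Cplx R,
          analytic_on D G &
          forall t, D t -> t <> Q -> G t = (1 - Q^-1 * t) * F t].
Proof.
subst q; move=> Q D.
pose C := Cplx R; pose q := #|k|.
have q0 : 0 < (q%:R : R) by rewrite ltr0n; apply: leq_trans hq.
have q1 : 1 < (q%:R : R) by rewrite ltr1n; apply: leq_trans hq.
pose rho : R := q%:R `^ (3%:R / 2%:R).
have rho0 : 0 < rho by rewrite powR_gt0.
have rho2 : rho ^+ 2 = q%:R ^+ 3.
  by rewrite -powR_mulrn ?powR_ge0 // -powRrM mulfVK ?pnatr_eq0 // powR_mulrn // ltW.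
have qrho : q%:R < rho.
  rewrite -(@ltr_pXn2r _ 2) ?nnegrE ?(ltW q0) ?(ltW rho0) // rho2.
  by rewrite ltr_eXn2l.
have DE t : D t <-> cabs t < rho.
  by rewrite /D /ball /= sub0r normrN cabsE -[(_)%:C]/(toC rho) toC_lt.
have QE : Q = toC q%:R by rewrite toC_nat.
have Q0 : Q != 0 by rewrite pnatr_eq0 -lt0n; apply: leq_trans hq.
pose p := logcoef R q predT.
pose p' N := p N - delta 1 (q%:R : R)^-1 N.
have p'_ge0 := expo_ge0 (pfun_lim_ge0 (@wt_ge0 R q) (@cvg_reduced R k)).
have /choice [G GP] : forall t : C, exists l : C,
    cabs t < rho -> has_psum (fun n => toC (expo p' n)) t l.
  move=> t; case: (boolP (cabs t < rho)) => [tr|/negP tr]; last by exists 0.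
  by have [l pl] := psum_reduced_complex rho0 rho2 tr; exists l.
have Ganal z : D z -> analytic_at G z.
  by move=> /DE; apply: analytic_psum GP z => // r; apply: psum_reduced_real.
(* G is the product without the factor 1 - t / Q; dividing by it continues F to the
   disk without Q. *)
pose F (t : C) : C := Q * G t / (Q - t).
have near1 (t : C) : cabs t < 1 -> has_psum (fun n => toC (expo p n)) t (F t) /\
    has_prod (idx_in predT) (fun x => (1 - toC (wt R q x) * t ^+ tdeg x)^-1) (F t).
  move=> t1; have [l [pl prl]] := @psum_idx R k predT t t1.
  suff -> : F t = l by [].
  have tr : cabs t < rho by apply: lt_trans (lt_trans t1 q1) qrho.
  have := psum_factor (@expo_split_pole R k) (GP t tr) pl.
  rewrite expr1 /F => <-.
  have Qt : Q - t != 0.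
    rewrite subr_eq0; apply/eqP => Qt; move: t1; rewrite -Qt QE cabs_toC ?(ltW q0) //.
    by rewrite ltNge (ltW q1).
  by rewrite toCV -QE; field; rewrite Qt Q0.
exists F; split.
- apply: (near_cabs ltr01) => t; rewrite subr0 => /near1 [h _].
  by apply: eq_has_psum h => n; rewrite coefA_toC coefA_expo.
- apply: (near_cabs ltr01) => t; rewrite subr0 => t1.
  have [_ hP] := near1 t t1.
  have [l1 [_ hP1]] := @psum_idx R k (pred1 1%N) t t1.
  have [l2 [_ hP2]] := @psum_idx R k (fun m => 2 <= m)%N t t1.
  have wtE (m i j : nat) : toC (wt R q (m, i, j)) = Q ^- (i + j + 2 * m - 1)%N.
    by rewrite /wt /= exprVn toCV toCX -QE.
  exists l1, l2; split.
  + have := has_prod_seq_of (g := fun i => (1%N, i, 0%N)) _ _ _ hP1.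
    have -> : (fun n => (1 - toC (wt R q (1%N, n, 0%N)) * t ^+ tdeg (1%N, n, 0%N))^-1) =
       (fun i => (1 - Q ^- i.+1 * t)^-1).
      apply/funext => n; rewrite wtE /tdeg /= expr1.
      by rewrite (_ : (n + 0 + 2 * 1 - 1 = n.+1)%N) //; clear; lia.
    apply.
    * by move=> i i' [].
    * by [].
    * by move=> [[m i] j] /and3P [/= /eqP -> _ /eqP ->]; exists i.
  + apply: eq_has_prod hP2; last by move=> [[m i] j]; rewrite wtE.
    move=> [[m i] j]; rewrite /idx_in /=; case: m => [|[|m]] //=.
  + apply: has_prod_unique hP _.
    have := has_prodM _ hP1 hP2.
    move=> h; apply: eq_has_prod (h _) => //.
      by move=> [[m i] j]; rewrite /idx_in /=; case: m => [|[|m]] //=; rewrite ?orbF.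
    by move=> [[m i] j]; rewrite /idx_in /=; case: m => [|[|m]] //=; rewrite ?andbF.
- move=> z [Dz zQ]; rewrite /F.
  apply: (@analytic_div R (fun w => Q * G w) z Q zQ).
  apply: analyticZ.
  exact: Ganal Dz.
- have DQ : D Q by apply/DE; rewrite QE cabs_toC // ltW.
  exists (fun w => - Q * G w); split.
  + by apply: analyticZ; apply: Ganal.
  (* G Q is at least 1, since its series has nonnegative coefficients and constant term 1. *)
  + rewrite mulf_neq0 ?oppr_eq0 //; apply/eqP => GQ.
    have /GP : cabs Q < rho by apply/DE.
    rewrite GQ => /cvgrPdist_lt /(_ 1 ltr01) [N _ /(_ N.+1 (leqnSn N))] /=.
    rewrite sub0r normrN QE.
    have -> : series (fun n => toC (expo p' n) * toC q%:R ^+ n) N.+1 =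
        toC (series (fun n => expo p' n * q%:R ^+ n) N.+1) :> C.
      by rewrite /series /= toC_sum; apply: eq_bigr => i _; rewrite toCM toCX.
    have s1 : 1 <= series (fun n => expo p' n * q%:R ^+ n) N.+1.
      rewrite /series /= big_ltn // expo0 expr0 mulr1 lerDl sumr_ge0 // => i _.
      by rewrite mulr_ge0 // exprn_ge0 // ltW.
    rewrite norm_toC ?(le_trans ler01) // -toC1 toC_lt.
    by rewrite ltNge s1.
  + by apply: nearW => w; rewrite /F -(opprB w Q) invrN mulrN !mulNr.
exists G => // t Dt /eqP tQ; rewrite /F; field.
by rewrite Q0 subr_eq0 eq_sym andbT.
Qed.
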